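(* Let $p>2$, let $\mathcal{G}\in\mathbf{G}$ be a periodic graph, let $Z$ be a set of vertices of degree $1$ of $\mathcal{G}$ having the same periodicity as $\mathcal{G}$, and let $\lambda>0$. Then $\mathcal{G}$ admits a ground state. Furthermore, $$\inf_{v\in\mathcal{M}_{\lambda,Z}(\mathcal{G})}J_\lambda(v)=2\inf_{v\in\mathcal{N}_{\lambda,Z}(\mathcal{G})}J_\lambda(v)$$ and there are no nodal ground states.
   Context: $\mathbf{G}$ is the class of connected metric graphs $\mathcal{G}=(\mathbb{V},\mathbb{E})$ with at most countably many edges and vertices, every vertex of finite degree, and edge lengths bounded away from $0$: $\inf_{e\in\mathbb{E}}\ell_e>0$. A graph is periodic ($\mathbb{Z}^n$-periodic for some $n\ge1$) if it has infinitely many edges, all bounded, and is equipped with an action $(k,x)\mapsto k\cdot x$ of $\mathbb{Z}^n$ by homeomorphisms that preserve the graph structure (vertices, edges, incidence) and edge lengths, which is free ($k\cdot x=x$ for some $x$ implies $k=0$), discrete (every point has a neighbourhood $U$ with $k\cdot x\notin U$ for $k\ne0$), and co-compact: there is a compact set $W\subset\mathcal{G}$ (a fundamental domain) with $\mathcal{G}=\bigcup_{k\in\mathbb{Z}^n}W_k$, where $W_k=k\cdot W$ is a copy of $W$ and $W_i\cap W_j$ contains at most finitely many points for $i\ne j$. The set $Z$ is (possibly empty and) $\mathbb{Z}^n$-periodic: $Z\cap W_k$ is a copy of $Z\cap W$ for every $k$, i.e. $Z$ is invariant under the action. $H^1(\mathcal{G})$ is the space of continuous real functions on $\mathcal{G}$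 that are $H^1$ on each edge with finite total $H^1$ norm, and $H^1_Z(\mathcal{G})=\{u\in H^1(\mathcal{G}): u(\mathrm{v})=0\ \forall\,\mathrm{v}\in Z\}$. Define $$J_\lambda(u)=\tfrac12\|u'\|_{L^2(\mathcal{G})}^2+\tfrac{\lambda}{2}\|u\|_{L^2(\mathcal{G})}^2-\tfrac1p\|u\|_{L^p(\mathcal{G})}^p ,$$ $$\mathcal{N}_{\lambda,Z}(\mathcal{G})=\{u\in H^1_Z(\mathcal{G}): u\neq0,\ \|u'\|_{L^2}^2+\lambda\|u\|_{L^2}^2=\|u\|_{L^p}^p\},$$ $$\mathcal{M}_{\lambda,Z}(\mathcal{G})=\{u\in H^1_Z(\mathcal{G}): u^+,u^-\in\mathcal{N}_{\lambda,Z}(\mathcal{G})\},\quad u^+=\max(u,0),\ u^-=\min(u,0).$$ A ground state is $u\in\mathcal{N}_{\lambda,Z}(\mathcal{G})$ with $J_\lambda(u)=\inf_{\mathcal{N}_{\lambda,Z}(\mathcal{G})}J_\lambda$; a nodal ground state is $u\in\mathcal{M}_{\lambda,Z}(\mathcal{G})$ with $J_\lambda(u)=\inf_{\mathcal{M}_{\lambda,Z}(\mathcal{G})}J_\lambda$. *)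

(* Defs.v *)
From HB Require Import structures.
From mathcomp Require Import all_boot all_order all_algebra.
From mathcomp Require Import finmap.
From mathcomp Require Import all_classical all_reals all_analysis.
Import Order.TTheory GRing.Theory Num.Theory.
Import numFieldNormedType.Exports.

Set Implicit Arguments.
Unset Strict Implicit.
Unset Printing Implicit Defensive.

Local Open Scope classical_set_scope.
Local Open Scope ring_scope.

(* Loops and multiple edges are allowed.  The orientation of an edge only fixes
   its parametrization by [0, len e], with t = 0 at [src e]; an unbounded edge is
   a half-line [0, +oo), which has no second vertex. *)
Record metricGraph (R : realType) := MetricGraph {
  vertex : choiceType;
  edge : choiceType;
  src : edge -> vertex;
  tgt : edge -> option vertex;
  len : edge -> \bar R;
  len_gt0 : forall e, (0 < len e)%E;
  tgt_None : forall e, tgt e = None <-> len e = +oo%E }.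

Arguments src {R m} _.
Arguments tgt {R m} _.
Arguments len {R m} _.

Inductive gpoint (R : realType) (G : metricGraph R) : Type :=
| Vert of vertex G
| Inner (e : edge G) of {t : R | (0 < t) && (t%:E < len e)%E}.

Arguments Vert {R G} _.
Arguments Inner {R G} _ _.

(* The parametrization of the edge [e], extended to all of R by its values at
   the endpoints of [0, len e].  The default value of [odflt] is never reached:
   if [tgt e = None] then [len e = +oo]. *)
Definition edge_point (R : realType) (G : metricGraph R) (e : edge G) (t : R)
    : gpoint G :=
  if insub t is Some s then Inner e s
  else Vert (if t <= 0 then src e else odflt (src e) (tgt e)).

HB.instance Definition _ (R : realType) (G : metricGraph R) :=
  gen_eqMixin (gpoint G).
HB.instance Definition _ (R : realType) (G : metricGraph R) :=
  gen_choiceMixin (gpoint G).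

(* The quotient topology of the disjoint union of the edges; under the
   assumptions of [class_G] it is the topology of the path metric.  As
   [edge_point e] is constant to the left of 0 and to the right of [len e], its
   preimages are open in R iff their traces on [0, len e] are relatively open. *)
Definition graph_open (R : realType) (G : metricGraph R) (U : set (gpoint G)) :=
  forall e : edge G, open (edge_point e @^-1` U).

Lemma graph_openT (R : realType) (G : metricGraph R) :
  graph_open [set: gpoint G].
Proof. by move=> e; rewrite preimage_setT; exact: openT. Qed.

Lemma graph_openI (R : realType) (G : metricGraph R) (A B : set (gpoint G)) :
  graph_open A -> graph_open B -> graph_open (A `&` B).
Proof. by move=> oA oB e; rewrite preimage_setI; exact: openI. Qed.

Lemma graph_open_bigU (R : realType) (G : metricGraph R) (I : Type)
    (f : I -> set (gpoint G)) :
  (forall i, graph_open (f i)) -> graph_open (\bigcup_i f i).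
Proof.
move=> of_ e; rewrite preimage_bigcup.
by apply: bigcup_open => i _; exact: of_.
Qed.

HB.instance Definition _ (R : realType) (G : metricGraph R) :=
  isOpenTopological.Build (gpoint G)
    (@graph_openT R G) (@graph_openI R G) (@graph_open_bigU R G).

Section Graphs.
Variables (R : realType) (G : metricGraph R).

(* The ends of edges at [v]; [(e, false)] is the end at [src e] and [(e, true)]
   the one at [tgt e], so that a loop contributes two ends. *)
Definition ends (v : vertex G) : set (edge G * bool) :=
  [set h | (if h.2 then tgt h.1 else Some (src h.1)) = Some v].

Definition degree (v : vertex G) : nat := #|` fset_set (ends v)|.

Definition incident (v : vertex G) (e : edge G) : Prop :=
  src e = v \/ tgt e = Some v.

Definition open_edge (e : edge G) : set (gpoint G) :=
  [set x | exists t, x = Inner e t].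

Definition class_G : Prop :=
  [/\ connected [set: gpoint G],
      countable [set: vertex G],
      countable [set: edge G],
      forall v : vertex G, finite_set (ends v) &
      (0 < ereal_inf [set len e | e in [set: edge G]])%E].

Definition preserves_graph (f : gpoint G -> gpoint G) : Prop :=
  exists (fV : vertex G -> vertex G) (fE : edge G -> edge G),
    [/\ forall v, f (Vert v) = Vert (fV v),
        forall e, f @` open_edge e = open_edge (fE e),
        forall v e, incident v e <-> incident (fV v) (fE e) &
        forall e, len (fE e) = len e].

(* Each [act k] is a homeomorphism, being continuous with inverse [act (- k)]. *)
Record periodic_graph (n : nat) (act : 'rV[int]_n -> gpoint G -> gpoint G)
    : Prop := PeriodicGraph {
  per_edges : infinite_set [set: edge G];
  per_bounded : forall e : edge G, (len e < +oo)%E;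
  per_act0 : forall x, act 0 x = x;
  per_actD : forall k l x, act (k + l) x = act k (act l x);
  per_cont : forall k, continuous (act k);
  per_graph : forall k, preserves_graph (act k);
  per_free : forall k x, act k x = x -> k = 0;
  per_discrete : forall x, exists2 U, nbhs x U &
    forall k, k <> 0 -> ~ U (act k x);
  per_cocompact : exists W : set (gpoint G),
    [/\ compact W,
        \bigcup_k (act k @` W) = [set: gpoint G] &
        forall i j, i <> j -> finite_set ((act i @` W) `&` (act j @` W))] }.

Definition periodic_vertices (n : nat)
    (act : 'rV[int]_n -> gpoint G -> gpoint G) (Z : set (vertex G)) : Prop :=
  forall k, act k @` (Vert @` Z) = Vert @` Z.

End Graphs.

Section Sobolev.
Variable R : realType.
Local Notation mu := (@lebesgue_measure R).

Definition test_function (I : set R) (phi : R -> R) : Prop :=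
  [/\ forall x, derivable phi x 1,
      continuous (derive1 phi) &
      exists K, [/\ compact K, K `<=` I & forall x, ~ K x -> phi x = 0]].

Definition in_L2 (I : set R) (f : R -> R) : Prop :=
  measurable_fun I f /\ (\int[mu]_(x in I) ((f x) ^+ 2)%:E < +oo)%E.

Definition weak_derivative (I : set R) (f g : R -> R) : Prop :=
  in_L2 I g /\
  forall phi, test_function I phi ->
    (\int[mu]_(x in I) (f x * derive1 phi x) = - \int[mu]_(x in I) (g x * phi x))%R.

Definition in_H1 (I : set R) (f : R -> R) : Prop :=
  in_L2 I f /\ exists g, weak_derivative I f g.

(* Unique up to a null set of [I] when [f] is in H^1(I). *)
Definition wderiv (I : set R) (f : R -> R) : R -> R :=
  xget (cst 0) (weak_derivative I f).

Variable G : metricGraph R.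

Definition edge_itv (e : edge G) : set R :=
  [set t | (0 < t) && (t%:E < len e)%E].

Definition on_edge (u : gpoint G -> R) (e : edge G) : R -> R :=
  fun t => u (edge_point e t).

(* ||u||_{L^q(G)}^q *)
Definition Lq_pow (q : R) (u : gpoint G -> R) : \bar R :=
  \esum_(e in [set: edge G])
    (\int[mu]_(t in edge_itv e) (`|on_edge u e t| `^ q)%:E)%E.

(* ||u'||_{L^2(G)}^2 *)
Definition dirichlet (u : gpoint G -> R) : \bar R :=
  \esum_(e in [set: edge G])
    (\int[mu]_(t in edge_itv e) ((wderiv (edge_itv e) (on_edge u e) t) ^+ 2)%:E)%E.

Definition H1 : set (gpoint G -> R) :=
  [set u | [/\ continuous u,
               forall e, in_H1 (edge_itv e) (on_edge u e) &
               (dirichlet u + Lq_pow 2 u < +oo)%E]].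

Definition H1_Z (Z : set (vertex G)) : set (gpoint G -> R) :=
  [set u | H1 u /\ forall v, Z v -> u (Vert v) = 0].

Definition nls_action (lambda p : R) (u : gpoint G -> R) : \bar R :=
  ((2^-1)%:E * dirichlet u + (lambda / 2)%:E * Lq_pow 2 u
   - (p^-1)%:E * Lq_pow p u)%E.

Definition nehari (lambda p : R) (Z : set (vertex G)) : set (gpoint G -> R) :=
  [set u | [/\ H1_Z Z u, u <> cst 0 &
     (dirichlet u + lambda%:E * Lq_pow 2 u = Lq_pow p u)%E]].

Definition pos_part (u : gpoint G -> R) : gpoint G -> R :=
  fun x => Num.max (u x) 0.
Definition neg_part (u : gpoint G -> R) : gpoint G -> R :=
  fun x => Num.min (u x) 0.

Definition nodal_nehari (lambda p : R) (Z : set (vertex G))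
    : set (gpoint G -> R) :=
  [set u | [/\ H1_Z Z u, nehari lambda p Z (pos_part u) &
                         nehari lambda p Z (neg_part u)]].

(* The infimum of the action over [S], in the extended reals (+oo if [S] is
   empty). *)
Definition inf_action (lambda p : R) (S : set (gpoint G -> R)) : \bar R :=
  ereal_inf [set nls_action lambda p u | u in S].

Definition ground_state (lambda p : R) (Z : set (vertex G))
    (u : gpoint G -> R) : Prop :=
  nehari lambda p Z u /\
  nls_action lambda p u = inf_action lambda p (nehari lambda p Z).

Definition nodal_ground_state (lambda p : R) (Z : set (vertex G))
    (u : gpoint G -> R) : Prop :=
  nodal_nehari lambda p Z u /\
  nls_action lambda p u = inf_action lambda p (nodal_nehari lambda p Z).

End Sobolev.

(* Main.v *)
(** The action on the Nehari set is [(1/2 - 1/p) A], where [A u = ||u'||^2 + lambda ||u||^2],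
    and with [P u = ||u||_p^p] and [K = sup {P u | A u <= 1}] one has [P <= K A^(p/2)]; hence
    ground states are the rescaled maximizers of [P] on [{A <= 1}].  A maximizing sequence
    does not vanish, so after translation it has a non-zero pointwise limit [u], and the
    Brezis-Lieb splitting gives [K <= P u + K (1 - A u)], which with [p > 2] forces [A u = 1]
    and [P u = K].  Truncating a maximizer to finitely many edges and subtracting a far
    translate yields nodal functions of action close to twice the ground state level, while
    [A u >= A u^+ + A u^-] gives the lower bound.  The positive part of a nodal ground state
    would be a ground state [v >= 0] with zeros: as [v] minimizes [A] among the functions
    with larger [P], testing with tents shows that zeros spread through edges and through
    vertices outside [Z], and vertices of degree 1 do not block them.

    The Dirichlet energy of a continuous function is handled through its dyadic
    approximations [sum |f(b) - f(a)|^2 / (b - a)], which increase with the depth and pass to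
    pointwise limits, so that lower semicontinuity requires no weak convergence. *)

Require Import Defs.
From mathcomp Require Import all_boot all_order all_algebra.
From mathcomp Require Import finmap.
From mathcomp Require Import all_classical all_reals all_analysis.
From mathcomp Require Import measurable_realfun.
From mathcomp Require Import ring lra.
Import Order.TTheory GRing.Theory Num.Theory.
Import numFieldNormedType.Exports.

Set Implicit Arguments.
Unset Strict Implicit.
Unset Printing Implicit Defensive.

Local Open Scope classical_set_scope.
Local Open Scope ring_scope.

(** * Dyadic energies and the Sobolev space of an interval *)

(** The lattice acts by homeomorphisms that may distort the edges, so functions are translated by
    edge isometries inducing the same graph automorphism. Non-vanishing comes from
    [P u <= sup|u|^(p-2) A u / lambda]: if [P u] is close to [K], then [|u|] is bounded below at
    some point, which can be moved to one of finitely many representative edges. The supremum itself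
    is controlled by [A] because edge lengths are bounded below. The pointwise limit is taken along
    an ultrafilter, at all points at once, and 1/2-Hölder bounds make it uniform on each edge. No
    Euler-Lagrange equation is derived: minimality of [A] among functions with larger [P] gives a
    one-sided first variation in which [P] is never differentiated. *)

Section DyadicEnergy.
Variable R : realType.
Implicit Types (a b c t : R) (f h : R -> R).

(* The difference quotients of [f] over the dyadic partition of [[a, b]] of depth [n];
   they increase to the integral of [f'^2], or to +oo if [f] is not in H^1. *)
Fixpoint dyE n a b f : R :=
  if n is m.+1 then dyE m a ((a + b) / 2) f + dyE m ((a + b) / 2) b f
  else (f b - f a) ^+ 2 / (b - a).

Lemma dyE_ge0 n a b f : a < b -> 0 <= dyE n a b f.
Proof.
elim: n a b => [|n IH] a b ab /=.
  by rewrite divr_ge0 ?sqr_ge0 // subr_ge0 ltW.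
by rewrite addr_ge0 // IH //; lra.
Qed.

(** One bisection is enough: if [x] and [y] are the increments of [f] over the two halves,
    [(x + y)^2 / 2 <= x^2 + y^2]. *)
Lemma dyE_mono n m a b f : a < b -> (n <= m)%N -> dyE n a b f <= dyE m a b f.
Proof.
move=> ab /subnK <-; elim: (m - n)%N => // k IH; apply: le_trans IH _.
rewrite addSn; move: {m k}(k + n)%N => k.
elim: k a b ab => [|k IH] a b ab; last by rewrite /= lerD // IH //; lra.
rewrite /=; set c := (a + b) / 2.
have -> : c - a = (b - a) / 2 by rewrite /c; lra.
have -> : b - c = (b - a) / 2 by rewrite /c; lra.
have d0 : 0 < b - a by lra.
rewrite invf_div !mulrA -mulrDl ler_pM2r ?invr_gt0 //.
have := sqr_ge0 ((f c - f a) - (f b - f c)); nra.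
Qed.

Lemma dyE_contract n a b f h : a < b ->
  (forall s t, a <= s <= b -> a <= t <= b -> `|f s - f t| <= `|h s - h t|) ->
  dyE n a b f <= dyE n a b h.
Proof.
elim: n a b => [|n IH] a b ab fh /=.
  rewrite ler_pM2r ?invr_gt0 ?subr_gt0 //.
  by rewrite -[leLHS]real_normK ?num_real // -[leRHS]real_normK ?num_real //
     lerXn2r ?nnegrE // fh //; lra.
by apply: lerD; apply: IH => [|s t sI tI]; try lra; apply: fh; lra.
Qed.

(** The increments of the two parts have the same sign and add up to that of [f], so the sum of
    their squares is at most the square of the increment of [f]; the inequality may be strict on a
    cell where [f] changes sign. *)
Lemma dyE_pos_neg n a b f : a < b ->
  dyE n a b (fun t => Num.max (f t) 0) + dyE n a b (fun t => Num.min (f t) 0)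
    <= dyE n a b f.
Proof.
elim: n a b => [|n IH] a b ab /=.
  rewrite -mulrDl ler_pM2r ?invr_gt0 ?subr_gt0 //.
  rewrite /Num.max /Num.min; case: ifPn => B; case: ifPn => A; nra.
by rewrite addrACA lerD // IH //; lra.
Qed.

(** The weight [s] will be large: a lower bound for the energy of [f + s * h] yields an upper bound
    for that of [f - h], so lower semicontinuity alone controls a remainder. *)
Lemma dyE_parallelogram n a b f h s : 0 < s ->
  dyE n a b (fun t => f t - h t) + s^-1 * dyE n a b (fun t => f t + s * h t) =
  (1 + s^-1) * dyE n a b f + (1 + s) * dyE n a b h.
Proof.
move=> s0; elim: n a b => [|n IH] a b /=; last by rewrite mulrDr addrACA !IH; ring.
have s1 : s * s^-1 = 1 by rewrite mulfV // gt_eqF.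
rewrite !mulrA -!mulrDl; congr (_ / _).
set x := f b - f a; set y := h b - h a.
have -> : f b - h b - (f a - h a) = x - y by rewrite /x /y; ring.
have -> : f b + s * h b - (f a + s * h a) = x + s * y by rewrite /x /y; ring.
transitivity ((x - y) ^+ 2 + s^-1 * x ^+ 2 + 2 * (s * s^-1) * x * y +
   (s * s^-1) * s * y^+2); first by ring.
rewrite s1; ring.
Qed.

Lemma dyE_scale n a b f c : dyE n a b (fun t => c * f t) = c ^+ 2 * dyE n a b f.
Proof.
by elim: n a b => [|n IH] a b /=; rewrite ?IH -?mulrDr // -mulrBr exprMn mulrA.
Qed.

Lemma dyE_rev n a b c f :
  dyE n a b (fun t => f (c - t)) = dyE n (c - b) (c - a) f.
Proof.
elim: n a b => [|n IH] a b /=.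
  by congr (_ / _); [rewrite -sqrrN; congr (_ ^+ 2); ring | ring].
by rewrite addrC !IH; congr (dyE _ _ _ _ + dyE _ _ _ _); lra.
Qed.

Lemma eq_dyE n a b f h : a < b ->
  (forall t, a <= t <= b -> f t = h t) -> dyE n a b f = dyE n a b h.
Proof.
move=> ab fh; apply/eqP; rewrite eq_le; apply/andP; split;
  by apply: dyE_contract => // s t sI tI; rewrite !fh.
Qed.

(** A fixed depth reads only finitely many values of the functions. *)
Lemma cvg_dyE (T : Type) (F : set_system T) {FF : Filter F} (g : T -> R -> R) f n a b :
  (forall t, g ^~ t @ F --> f t) -> dyE n a b (g x) @[x --> F] --> dyE n a b f.
Proof.
move=> gf; elim: n a b => [|n IH] a b /=; last by apply: cvgD; apply: IH.
by apply: cvgMl; rewrite exprS expr1; apply: cvgM; apply: cvgB; apply: gf.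
Qed.

End DyadicEnergy.

(** * Integrals and square integrability on half-open intervals *)

Section IntervalIntegrals.
Variable R : realType.
Local Notation mu := (@lebesgue_measure R).
Implicit Types (a b c s t : R) (f g h : R -> R).

(** Half-open intervals are disjoint when adjacent, which makes the integral additive with no care
    for endpoints. *)
Definition ig a b f : R := \int[mu]_(x in `[a, b[) f x.
Definition intg a b f : Prop := mu.-integrable `[a, b[ (EFin \o f).

Lemma intg_sub a b c d f : a <= c -> d <= b -> intg a b f -> intg c d f.
Proof.
move=> ac db; apply: integrableS => //.
by move=> x /=; rewrite !in_itv/= => /andP[cx xd]; lra.
Qed.

Lemma ig_split a m b f : a <= m -> m <= b -> intg a b f ->
  ig a b f = ig a m f + ig m b f.
Proof.
move=> am mb fi; rewrite /ig (@itv_bndbnd_setU _ _ (BLeft a) (BLeft m) (BLeft b)) //.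
rewrite Rintegral_setU //.
  by rewrite -(@itv_bndbnd_setU _ _ (BLeft a) (BLeft m) (BLeft b)).
by apply/disj_setPS => y [/=]; rewrite !in_itv/= => /andP[_ ym] /andP[my]; lra.
Qed.

Lemma eq_ig a b f g : (forall x, a <= x < b -> f x = g x) -> ig a b f = ig a b g.
Proof. by move=> fg; apply: eq_Rintegral => x; rewrite inE /= in_itv/=; apply: fg. Qed.

Lemma eq_intg a b f g : (forall x, a <= x < b -> f x = g x) ->
  intg a b f -> intg a b g.
Proof.
move=> fg; apply: eq_integrable => // x.
by rewrite inE/= in_itv/= => xI; rewrite fg.
Qed.

Lemma igxx a f : ig a a f = 0.
Proof. by rewrite /ig set_itv_ge ?Rintegral_set0 // bnd_simp ltxx. Qed.

Lemma intg_cst a b c : intg a b (cst c).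
Proof.
apply: measurable_bounded_integrable => //=.
  by rewrite lebesgue_measure_itv/=; case: ifP => // _; rewrite -EFinB ltry.
by exists `|c|; split; rewrite ?num_real // => M cM x _ /=; exact: ltW.
Qed.

Lemma ig_cst a b c : a <= b -> ig a b (fun=> c) = c * (b - a).
Proof.
move=> ab; rewrite /ig Rintegral_cst //= lebesgue_measure_itv/= lte_fin.
by move: ab; rewrite le_eqVlt => /predU1P[->|->//]; rewrite ltxx subrr.
Qed.

Lemma intgD a b f g : intg a b f -> intg a b g -> intg a b (fun x => f x + g x).
Proof. by move=> fi gi; exact: (integrableD _ fi gi). Qed.

Lemma intgZ a b c f : intg a b f -> intg a b (fun x => c * f x).
Proof. by move=> fi; exact: (integrableZl _ _ fi). Qed.

Lemma igD a b f g : intg a b f -> intg a b g ->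
  ig a b (fun x => f x + g x) = ig a b f + ig a b g.
Proof. by move=> fi gi; rewrite /ig RintegralD. Qed.

Lemma igZ a b c f : intg a b f -> ig a b (fun x => c * f x) = c * ig a b f.
Proof. by move=> fi; rewrite /ig RintegralZl. Qed.

Lemma intgB a b f g : intg a b f -> intg a b g -> intg a b (fun x => f x - g x).
Proof.
move=> fi /(intgZ (-1)) gi; have := intgD fi gi.
by apply: eq_intg => x _; rewrite mulN1r.
Qed.

Lemma igB a b f g : intg a b f -> intg a b g ->
  ig a b (fun x => f x - g x) = ig a b f - ig a b g.
Proof. by move=> fi gi; rewrite /ig RintegralB. Qed.

Lemma le_ig a b f g : intg a b f -> intg a b g ->
  (forall x, a <= x < b -> f x <= g x) -> ig a b f <= ig a b g.
Proof.
move=> fi gi fg; apply: le_Rintegral => // x /=; rewrite in_itv/=; exact: fg.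
Qed.

Lemma ig_ge0 a b f : (forall x, a <= x < b -> 0 <= f x) -> 0 <= ig a b f.
Proof. by move=> f0; apply: Rintegral_ge0 => x /=; rewrite in_itv/=; apply: f0. Qed.

Lemma intg_norm a b f : intg a b f -> intg a b (fun x => `|f x|).
Proof. by move=> fi; exact: (integrable_norm fi). Qed.

Lemma le_norm_ig a b f : intg a b f -> `|ig a b f| <= ig a b (fun x => `|f x|).
Proof. by move=> fi; apply: le_normr_Rintegral. Qed.

Lemma EFin_ig a b f : intg a b f -> (\int[mu]_(x in `[a, b[) (f x)%:E)%E = (ig a b f)%:E.
Proof. by move=> fi; rewrite /ig /Rintegral fineK // integrable_fin_num. Qed.

Lemma intg_measurable a b f : intg a b f -> measurable_fun `[a, b[ f.
Proof. by move=> /integrableP[/measurable_EFinP]. Qed.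

Lemma intg_continuous a b f : continuous f -> intg a b f.
Proof.
move=> cf.
have ci : mu.-integrable `[a, b] (EFin \o f).
  apply: continuous_compact_integrable; first exact: segment_compact.
  exact: continuous_subspaceT.
apply: integrableS ci => //.
by move=> x /=; rewrite !in_itv/= => /andP[-> /ltW].
Qed.

Lemma intg_le a b f g : measurable_fun `[a, b[ f ->
  (forall x, a <= x < b -> `|f x| <= g x) -> intg a b g -> intg a b f.
Proof.
move=> mf fg; apply: le_integrable => //; first exact/measurable_EFinP.
move=> x /=; rewrite in_itv/= => /fg fgx.
by rewrite lee_fin (le_trans fgx) // ler_norm.
Qed.

Definition L2 a b g : Prop :=
  measurable_fun `[a, b[ g /\ intg a b (fun x => g x ^+ 2).

Lemma L2_sub a b c d f : a <= c -> d <= b -> L2 a b f -> L2 c d f.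
Proof.
move=> ac db [mf fi]; split; last exact: intg_sub fi.
apply: measurable_funS mf => //.
by move=> x /=; rewrite !in_itv/= => /andP[cx xd]; lra.
Qed.

Lemma intg_mul a b f g : L2 a b f -> L2 a b g -> intg a b (fun x => f x * g x).
Proof.
move=> [mf fi] [mg gi]; apply: intg_le (intgD fi gi) => //.
  exact: measurable_funM.
by move=> x _; rewrite normrM -(real_normK (num_real (f x)))
  -(real_normK (num_real (g x))); nra.
Qed.

Lemma L2_cst a b c : L2 a b (cst c).
Proof. by split => //; exact: (intg_cst a b (c ^+ 2)). Qed.

Lemma L2_intg a b f : L2 a b f -> intg a b f.
Proof.
by move=> /intg_mul/(_ (L2_cst a b 1)); apply: eq_intg => x _ /=; rewrite mulr1.
Qed.

Lemma L2_axpy a b c f g : L2 a b f -> L2 a b g -> L2 a b (fun x => f x + c * g x).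
Proof.
move=> Lf Lg; have fg := intg_mul Lf Lg; case: Lf Lg => mf fi [mg gi]; split.
  by apply: measurable_funD => //; apply: measurable_funM.
have := intgD (intgD fi (intgZ (2 * c) fg)) (intgZ (c ^+ 2) gi).
by apply: eq_intg => x _; ring.
Qed.

Lemma ig_axpy_sqr a b c f g : L2 a b f -> L2 a b g ->
  ig a b (fun x => (f x + c * g x) ^+ 2) =
  ig a b (fun x => f x ^+ 2) + 2 * c * ig a b (fun x => f x * g x)
  + c ^+ 2 * ig a b (fun x => g x ^+ 2).
Proof.
move=> Lf Lg; have fg := intg_mul Lf Lg; case: Lf Lg => mf fi [mg gi].
have cfg := intgZ (2 * c) fg; have cgi := intgZ (c ^+ 2) gi.
have ficfg := intgD fi cfg.
rewrite -(igZ _ fg) -(igZ _ gi) -(igD fi cfg) -(igD ficfg cgi).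
by apply: eq_ig => x _; ring.
Qed.

Lemma L2_continuous a b f : continuous f -> L2 a b f.
Proof.
move=> cf; split.
  apply: measurable_funTS; exact: continuous_measurable_fun.
apply: intg_continuous => x.
by under eq_fun do rewrite expr2; apply: cvgM; apply: cf.
Qed.

Lemma L2_bounded a b M f : measurable_fun `[a, b[ f ->
  (forall x, a <= x < b -> `|f x| <= M) -> L2 a b f.
Proof.
move=> mf fM; split => //; apply: intg_le (intg_cst a b (M ^+ 2)).
  exact: measurable_funX.
by move=> x /fM xM /=; rewrite normrX lerXn2r ?nnegrE // (le_trans _ xM).
Qed.

Lemma ig_CS a b f : a < b -> L2 a b f ->
  ig a b f ^+ 2 / (b - a) <= ig a b (fun x => f x ^+ 2).
Proof.
(* Minus the mean of [f]: the inequality is the non-negativity of the integral of [(f + m)^2]. *)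
move=> ab Lf; set m := - (ig a b f / (b - a)).
have := ig_axpy_sqr m Lf (L2_cst a b 1).
rewrite /= (_ : ig a b (fun=> 1 ^+ 2) = b - a); last first.
  by rewrite ig_cst ?expr1n ?mul1r // ltW.
rewrite (_ : ig a b (fun x => f x * 1) = ig a b f); last first.
  by apply: eq_ig => x _; rewrite mulr1.
have := @ig_ge0 a b (fun x => (f x + m * 1) ^+ 2) (fun x _ => sqr_ge0 _).
move=> + E; rewrite E => H.
have d0 : b - a != 0 by rewrite gt_eqF // subr_gt0.
rewrite -subr_ge0; apply: le_trans H _; rewrite le_eqVlt; apply/orP; left; apply/eqP.
by rewrite /m; field.
Qed.

End IntervalIntegrals.

(** * L^2 limits of rapidly Cauchy sequences *)

Section L2Completeness.
Variable R : realType.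
Local Notation mu := (@lebesgue_measure R).

Lemma eq_L2 a b (f g : R -> R) : (forall x, a <= x < b -> f x = g x) ->
  L2 a b f -> L2 a b g.
Proof.
move=> fg [mf fi]; split; last by apply: eq_intg fi => x xI; rewrite fg.
by apply: eq_measurable_fun mf => x; rewrite inE /= in_itv/=; exact: fg.
Qed.

Lemma cvg_sqr (T : Type) (F : set_system T) {FF : Filter F} (f : T -> R) (l : R) :
  f @ F --> l -> f x ^+ 2 @[x --> F] --> l ^+ 2.
Proof. by move=> fl; rewrite expr2; under eq_cvg do rewrite expr2; exact: cvgM. Qed.

Lemma limn_einf_le (u : (\bar R)^nat) (B : \bar R) :
  (\forall j \near \oo, (u j <= B)%E) -> (limn_einf u <= B)%E.
Proof.
move=> [N _ uB]; rewrite limn_einf_lim; apply: lime_le; first exact: is_cvg_einfs.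
apply: nearW => n; apply: (@le_trans _ _ (u (maxn n N))).
  by apply: ereal_inf_lbound; exists (maxn n N) => //=; exact: leq_maxl.
by apply: uB => /=; exact: leq_maxr.
Qed.

Lemma nneseries_half_lty (c : R) (u : nat -> R) : (forall k, 0 <= u k) ->
  (forall k, u k <= c * 2^-1 ^+ k) -> (\sum_(k <oo) (u k)%:E < +oo)%E.
Proof.
move=> u0 uc.
have cv : cvgn (series u).
  apply: (@series_le_cvg _ _ (geometric c 2^-1)) => //.
    by move=> k; exact: le_trans (u0 k) (uc k).
  apply: is_cvg_geometric_series.
  by rewrite ger0_norm ?invr_ge0 // invf_lt1 // ltr1n.
have -> : (\sum_(k <oo) (u k)%:E)%E = (limn (series u))%:E.
  rewrite -EFin_lim //; congr (limn _); apply/funext => n /=.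
  by rewrite /series/= sumEFin.
exact: ltry.
Qed.

(* Riesz-Fischer for a sequence whose increments decay geometrically; the
   characterization by Fatou of the limit is all that is needed of it. *)
Lemma L2_fast_cauchy a b (s : nat -> R -> R) :
  (forall k, measurable_fun setT (s k)) -> (forall k, L2 a b (s k)) ->
  (forall k, ig a b (fun x => (s k.+1 x - s k x) ^+ 2) <= 4^-1 ^+ k) ->
  exists2 g : R -> R, measurable_fun setT g &
    forall r B, measurable_fun setT r -> L2 a b r ->
      (\forall j \near \oo, ig a b (fun x => (s j x - r x) ^+ 2) <= B) ->
      L2 a b (fun x => g x - r x) /\ ig a b (fun x => (g x - r x) ^+ 2) <= B.
Proof.
move=> ms Ls incr.
pose h k x := s k.+1 x - s k x.
have Lh k : L2 a b (h k).
  have := L2_axpy (-1) (Ls k.+1) (Ls k); apply: eq_L2 => x _.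
  by rewrite mulN1r.
(* [q k] dominates [|h k|] since [2 |h| <= 2^k h^2 + 2^-k], and its integral is at most
   [(1 + b - a) / 2^k]; so the increments are summable at almost every point. *)
pose q k x := 2 ^+ k * h k x ^+ 2 + 2^-1 ^+ k.
have q0 k x : 0 <= q k x.
  by apply: addr_ge0; [apply: mulr_ge0; [exact: exprn_ge0|exact: sqr_ge0]|
    apply: exprn_ge0; rewrite invr_ge0].
have qi k : intg a b (q k).
  by apply: intgD; [apply: intgZ; case: (Lh k)|exact: (intg_cst a b (2^-1 ^+ k))].
have mh k : measurable_fun setT (h k) by exact: measurable_funB.
have mq k : measurable_fun setT (q k).
  apply: measurable_funD => //; apply: measurable_funM => //.
  exact: measurable_funX.
have mEq k : measurable_fun `[a, b[ (fun x => (q k x)%:E).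
  by apply: measurable_funTS; exact/measurable_EFinP.
pose G x := (\sum_(k <oo) (q k x)%:E)%E.
have mG : measurable_fun `[a, b[ G.
  apply: (@ge0_emeasurable_sum _ _ _ _ (fun k x => (q k x)%:E) xpredT).
    by move=> k x _ _; rewrite lee_fin.
  by move=> k _; exact: mEq.
have intG : mu.-integrable `[a, b[ G.
  apply/integrableP; split => //.
  under eq_integral.
    move=> x _; rewrite gee0_abs; last by apply: nneseries_ge0 => *; rewrite lee_fin.
    over.
  rewrite integral_nneseries //; last first.
    by move=> n x _; rewrite lee_fin.
  rewrite (eq_eseriesr (g := fun k => (ig a b (q k))%:E)); last first.
    by move=> k _; rewrite (EFin_ig (qi k)).
  have [ab|ba] := leP a b; last first.
    rewrite eseries0 ?ltry // => k _ _.
    by rewrite /ig set_itv_ge ?Rintegral_set0 // bnd_simp -leNgt ltW.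
  apply: (@nneseries_half_lty (1 + (b - a))) => k; first exact: ig_ge0.
  have hi := (Lh k).2.
  rewrite igD; [|exact: intgZ|exact: (intg_cst a b (2^-1 ^+ k))].
  rewrite igZ // ig_cst // mulrDl mul1r; apply: lerD; last by rewrite mulrC.
  apply: (@le_trans _ _ (2 ^+ k * 4^-1 ^+ k)).
    by rewrite ler_pM2l ?exprn_gt0 //; exact: incr.
  by rewrite -exprMn lerXn2r ?nnegrE //; lra.
(* The upper limit is measurable whether or not the sequence converges, and it is the limit almost
   everywhere. *)
pose g x := fine (limn_esup (fun k => (s k x)%:E)).
have mg : measurable_fun setT g.
  apply: measurableT_comp => //; apply: measurable_fun_limn_esup => k.
  exact/measurable_EFinP.
have aeg : {ae mu, forall x, `[a, b[%classic x -> s ^~ x @ \oo --> g x}.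
  apply: filterS (integrable_ae _ intG) => // x + xI => /(_ xI).
  rewrite ge0_fin_numE; last by apply: nneseries_ge0 => *; rewrite lee_fin.
  move=> /nnseries_is_cvg; move=> /(_ (fun k => q0 k x)) cq.
  have cs : cvgn (s ^~ x).
    have ch : cvgn (series (fun k => h k x)).
      apply: normed_cvg; apply: (series_le_cvg _ _ _ cq) => //= k.
      rewrite /q; have k0 : (0 < 2 ^+ k :> R) by rewrite exprn_gt0.
      rewrite -(ler_pM2l k0) mulrDr -exprMn mulfV // expr1n mulrA -expr2.
      rewrite -exprMn -(real_normK (num_real (2 ^+ k * h k x))) normrM.
      rewrite ger0_norm ?ltW //; nra.
    have -> : s ^~ x = (fun k => series (fun k => h k x) k + s 0%N x).
      apply/funext => k; have := telescopeK (s ^~ x) => /(congr1 (@^~ k)) /= E.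
      by rewrite /h -[X in X + _]/(series (telescope (s ^~ x)) k) E subrK.
    by apply: is_cvgD => //; exact: is_cvg_cst.
  have /cvg_limn_einf_sup[_ E] : (s k x)%:E @[k --> \oo] --> (limn (s ^~ x))%:E.
    by apply: cvg_EFin => //; exact: nearW.
  by rewrite /g E.
exists g => // r B mr Lr lB.
have mgr : measurable_fun `[a, b[ (fun x => g x - r x).
  by apply: measurable_funTS; exact: measurable_funB.
(* Fatou's lemma for [(s j - r)^2], whose lower limit is almost everywhere [(g - r)^2]. *)
have F : (\int[mu]_(x in `[a, b[) ((g x - r x) ^+ 2)%:E <= B%:E)%E.
  pose F j x := ((s j x - r x) ^+ 2)%:E.
  have mF j : measurable_fun `[a, b[ (F j).
    apply: measurable_funTS; apply/measurable_EFinP; apply: measurable_funX.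
    exact: measurable_funB.
  have F0 j x : `[a, b[%classic x -> (0 <= F j x)%E by rewrite lee_fin sqr_ge0.
  have iF j : (\int[mu]_(x in `[a, b[) F j x)%E = (ig a b (fun x => (s j x - r x) ^+ 2))%:E.
    rewrite EFin_ig //; have [_] := L2_axpy (-1) (Ls j) Lr.
    by apply: eq_intg => x _; rewrite mulN1r.
  have -> : (\int[mu]_(x in `[a, b[) ((g x - r x) ^+ 2)%:E =
             \int[mu]_(x in `[a, b[) limn_einf (F ^~ x))%E.
    apply: ae_eq_integral => //.
    - by apply/measurable_EFinP; exact: measurable_funX.
    - rewrite (_ : (fun x => _) = (fun x => - limn_esup (fun k => - F k x))%E).
        apply: measurableT_comp => //; apply: measurable_fun_limn_esup => k.
        exact: (measurableT_comp _ (mF k)).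
      by apply/funext => x; rewrite -limn_einfN; congr limn_einf;
        apply/funext => k; rewrite /comp oppeK.
    apply: (@filterS _ _ (ae_filter_ringOfSetsType mu) _ _ _ aeg) => x sg /sg {}sg.
    have /cvg_limn_einf_sup[-> _] // : (F k x) @[k --> \oo] --> ((g x - r x) ^+ 2)%:E.
    apply: cvg_EFin; first exact: nearW.
    by apply: cvg_sqr; apply: cvgB => //; exact: cvg_cst.
  apply: (le_trans (@fatou _ _ _ mu _ (measurable_itv `[a, b[) F mF F0)).
  by apply: limn_einf_le; apply: filterS lB => j; rewrite iF lee_fin.
have Fi : intg a b (fun x => (g x - r x) ^+ 2).
  apply/integrableP; split; first by apply/measurable_EFinP; exact: measurable_funX.
  under eq_integral do rewrite gee0_abs ?lee_fin ?sqr_ge0 //.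
  exact: le_lt_trans F (ltry _).
by split; [split|rewrite -lee_fin -EFin_ig].
Qed.
End L2Completeness.

(** * From bounded dyadic energies to a square integrable derivative *)

Section Primitives.
Variable R : realType.
Local Notation mu := (@lebesgue_measure R).
Implicit Types (a b c s t : R) (f g h : R -> R).

Definition prim a b f g : Prop :=
  forall s t, a <= s -> s <= t -> t <= b -> f t - f s = ig s t g.

Lemma prim_sub a b c d f g : a <= c -> d <= b -> prim a b f g -> prim c d f g.
Proof. by move=> ac db P s t cs st td; apply: P => //; lra. Qed.

(** Cauchy-Schwarz on each dyadic cell. *)
Lemma prim_dyE n a b f g : a < b -> L2 a b g -> prim a b f g ->
  dyE n a b f <= ig a b (fun x => g x ^+ 2).
Proof.
elim: n a b => [|n IH] a b ab Lg P /=.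
  by rewrite P //; [exact: ig_CS|exact: ltW].
set c := (a + b) / 2; have ac : a < c by rewrite /c; lra.
have cb : c < b by rewrite /c; lra.
rewrite (ig_split (ltW ac) (ltW cb)); last by case: Lg.
apply: lerD; apply: IH => //.
- by apply: L2_sub Lg => //; exact: ltW.
- by apply: prim_sub P => //; exact: ltW.
- by apply: L2_sub Lg => //; exact: ltW.
- by apply: prim_sub P => //; exact: ltW.
Qed.

(** The derivative of the piecewise linear interpolation of [f] at the dyadic points of depth
    [n]. *)
Fixpoint dyS n a b f (x : R) : R :=
  if n is m.+1 then
    if x < (a + b) / 2 then dyS m a ((a + b) / 2) f x
    else dyS m ((a + b) / 2) b f x
  else (f b - f a) / (b - a).

Lemma measurable_dyS n a b f : measurable_fun setT (dyS n a b f).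
Proof.
elim: n a b => [|n IH] a b /=; first exact: measurable_cst.
by apply: measurable_fun_ifT => //; exact: measurable_fun_ltr.
Qed.

Lemma bounded_dyS n a b f : exists M, forall x, `|dyS n a b f x| <= M.
Proof.
elim: n a b => [|n IH] a b /=; first by exists `|(f b - f a) / (b - a)|.
have [M HM] := IH a ((a + b) / 2); have [N HN] := IH ((a + b) / 2) b.
exists (Num.max M N) => x; case: ifP => _; first by rewrite le_max HM.
by rewrite le_max HN orbT.
Qed.

Lemma L2_dyS n a b f c d : L2 c d (dyS n a b f).
Proof.
have [M HM] := bounded_dyS n a b f.
by apply: (L2_bounded (M := M)) => //; apply: measurable_funTS; exact: measurable_dyS.
Qed.

Lemma ig_dyS n a b f : a < b -> ig a b (dyS n a b f) = f b - f a.
Proof.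
elim: n a b => [|n IH] a b ab.
  by rewrite /= ig_cst ?ltW // divfK // gt_eqF // subr_gt0.
set c := (a + b) / 2; have ac : a < c by rewrite /c; lra.
have cb : c < b by rewrite /c; lra.
rewrite (ig_split (ltW ac) (ltW cb)); last exact/L2_intg/L2_dyS.
rewrite (@eq_ig _ a c _ (dyS n a c f)); last by move=> x /andP[_ xc] /=; rewrite xc.
rewrite (@eq_ig _ c b _ (dyS n c b f)); last first.
  by move=> x /andP[cx _] /=; rewrite ltNge cx.
by rewrite !IH //; ring.
Qed.

(** The slopes form a martingale: averaging the finer slope over a coarse cell gives the coarse
    slope. *)
Lemma ig_dyS_mul n m a b f : a < b -> (n <= m)%N ->
  ig a b (fun x => dyS m a b f x * dyS n a b f x) = dyE n a b f.
Proof.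
elim: n m a b => [|n IH] m a b ab nm.
  rewrite /= (@eq_ig _ _ _ _ (fun x => (f b - f a) / (b - a) * dyS m a b f x)); last first.
    by move=> x _; rewrite mulrC.
  rewrite igZ; last exact/L2_intg/L2_dyS.
  by rewrite ig_dyS // mulrAC.
case: m nm => // m nm.
set c := (a + b) / 2; have ac : a < c by rewrite /c; lra.
have cb : c < b by rewrite /c; lra.
rewrite (ig_split (ltW ac) (ltW cb)); last by apply: intg_mul; exact: L2_dyS.
rewrite (@eq_ig _ a c _ (fun x => dyS m a c f x * dyS n a c f x)); last first.
  by move=> x /andP[_ xc] /=; rewrite xc.
rewrite (@eq_ig _ c b _ (fun x => dyS m c b f x * dyS n c b f x)); last first.
  by move=> x /andP[cx _] /=; rewrite ltNge cx.
by rewrite !IH.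
Qed.

Lemma ig_dyS_sqr n a b f : a < b ->
  ig a b (fun x => dyS n a b f x ^+ 2) = dyE n a b f.
Proof.
move=> ab; rewrite -(ig_dyS_mul f ab (leqnn n)).
by apply: eq_ig => x _; rewrite expr2.
Qed.

(** Pythagoras in L^2: bounded energies make the sequence of slopes Cauchy. *)
Lemma ig_dyS_subsqr n m a b f : a < b -> (n <= m)%N ->
  ig a b (fun x => (dyS m a b f x - dyS n a b f x) ^+ 2) =
  dyE m a b f - dyE n a b f.
Proof.
move=> ab nm; have := ig_axpy_sqr (-1) (L2_dyS m a b f a b) (L2_dyS n a b f a b).
rewrite !ig_dyS_sqr // ig_dyS_mul // => E.
transitivity (ig a b (fun x => (dyS m a b f x + -1 * dyS n a b f x) ^+ 2)).
  by apply: eq_ig => x _; rewrite mulN1r.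
by rewrite E; ring.
Qed.

(** The primitive of the slopes agrees with [f] at the dyadic points, so only the cell of [t]
    contributes: one [e] for the interpolation and one for [f]. *)
Lemma ig_dyS_approx n a b f t e : a < b -> a <= t <= b ->
  (forall x y, a <= x <= b -> a <= y <= b -> `|x - y| <= (b - a) / 2 ^+ n ->
     `|f x - f y| <= e) ->
  `|ig a t (dyS n a b f) - (f t - f a)| <= 2 * e.
Proof.
elim: n a b => [|n IH] a b ab tI H.
  rewrite /= ig_cst; last by case/andP: tI.
  have {}H x y : a <= x <= b -> a <= y <= b -> `|f x - f y| <= e.
    by move=> xI yI; apply: H => //; rewrite expr0 divr1 ler_norml; lra.
  apply: (le_trans (ler_normB _ _)); rewrite mulr_natl; apply: lerD; last by apply: H; lra.
  apply: (@le_trans _ _ `|f b - f a|); last by apply: H; lra.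
  rewrite -mulrA normrM ler_piMr // ger0_norm ?mulr_ge0 ?invr_ge0 //; [|lra|lra].
  by rewrite mulrC ler_pdivrMr; lra.
set c := (a + b) / 2; have ac : a < c by rewrite /c; lra.
have cb : c < b by rewrite /c; lra.
have w : (b - a) / 2 ^+ n.+1 = (c - a) / 2 ^+ n.
  by rewrite /c exprS invfM; lra.
have w' : (b - a) / 2 ^+ n.+1 = (b - c) / 2 ^+ n.
  by rewrite /c exprS invfM; lra.
have [tc|ct] := leP t c.
  rewrite (@eq_ig _ a t _ (dyS n a c f)); last first.
    by move=> x /andP[_ xt] /=; rewrite (lt_le_trans xt tc).
  apply: IH => //; first by lra.
  by move=> x y xI yI xy; apply: H; rewrite ?w //; lra.
rewrite (ig_split (ltW ac) (ltW ct)); last exact/L2_intg/L2_dyS.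
rewrite (@eq_ig _ a c _ (dyS n a c f)); last by move=> x /andP[_ xc] /=; rewrite xc.
rewrite (@eq_ig _ c t _ (dyS n c b f)); last first.
  by move=> x /andP[cx _] /=; rewrite ltNge cx.
have E : f c - f a + ig c t (dyS n c b f) - (f t - f a) =
    ig c t (dyS n c b f) - (f t - f c) by ring.
rewrite ig_dyS // E.
apply: IH => //; first by lra.
by move=> x y xI yI xy; apply: H; rewrite ?w' //; lra.
Qed.

Lemma heine_segment a b f e : continuous f -> 0 < e ->
  exists2 d, 0 < d & forall x y, a <= x <= b -> a <= y <= b -> `|x - y| <= d ->
    `|f x - f y| <= e.
Proof.
move=> cf e0.
have /compact_near_coveringP NC := @segment_compact R a b.
have [x _|d /= d0 dP] := NC _ (0^'+ : set_system R)
    (fun d x => forall y, `|x - y| <= d -> `|f x - f y| <= e) _.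
  have /cvgrPdist_lt/(_ (e / 2)) : f @ x --> f x by exact: cf.
  rewrite divr_gt0 // => /(_ isT) /nbhs_ballP[r /= r0 fr].
  exists (ball x (r / 2), [set d | d < r / 2]).
    split; first by apply: nbhsx_ballx; rewrite divr_gt0.
    by apply: nbhs_right_lt; rewrite divr_gt0.
  move=> [x' d] /= [xx' dr] y x'y.
  have h1 : `|f x - f x'| < e / 2 by apply: fr; apply: le_ball xx'; lra.
  have h2 : `|f x - f y| < e / 2.
    apply: fr; rewrite /ball /= in xx' *.
    by have := ler_distD x' x y; lra.
  by have := ler_distD (f x) (f x') (f y); rewrite (distrC (f x') (f x)); lra.
exists (d / 2); first by rewrite divr_gt0.
move=> x y xI yI xy; apply: (dP (d / 2)) => //=.
by rewrite sub0r normrN ger0_norm; lra.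
by rewrite divr_gt0.
Qed.

Lemma exists_half_pow (C d : R) : 0 < d -> exists k, C * 2^-1 ^+ k <= d.
Proof.
move=> d0; have : geometric C 2^-1 @ \oo --> (0 : R).
  by apply: cvg_geometric; rewrite ger0_norm ?invr_ge0 // invf_lt1 // ltr1n.
move=> /cvgrPdist_le/(_ _ d0)[k _ /(_ k (leqnn k))] /=.
by rewrite sub0r normrN => H; exists k; exact: le_trans (ler_norm _) H.
Qed.

(** The slopes converge in L^2 because their increments are orthogonal and their energies bounded;
    the limit is the derivative, and Fatou's lemma transfers the bound [C] to it. *)
Theorem prim_of_dyE a b f C : a < b -> continuous f ->
  (forall n, dyE n a b f <= C) ->
  exists g, [/\ measurable_fun setT g, L2 a b g, prim a b f g &
               ig a b (fun x => g x ^+ 2) <= C].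
Proof.
move=> ab cf EC.
pose E n := dyE n a b f.
have EN (k : nat) : exists N, forall m, (N <= m)%N -> E m - E N <= 4^-1 ^+ k.
  have hs : has_sup (range E).
    by split; [exists (E 0%N); exists 0%N|exists C => _ [n _ <-]; exact: EC].
  have e0 : 0 < (4^-1 : R) ^+ k by rewrite exprn_gt0 // invr_gt0.
  have [_ [N _ <-] NE] := sup_adherent e0 hs.
  exists N => m _; rewrite lerBlDr addrC.
  have : E m <= sup (range E) by apply: ub_le_sup; [case: hs|exists m].
  by move: NE; lra.
have {EN} [N HN] := choice EN.
(* Depths that increase with [k], exceed [N k], and are at least [k], so that the mesh is at most
   [(b - a) / 2^k]. *)
pose nu k := (\sum_(j < k.+1) (N j).+1)%N.
have nuS k : (nu k <= nu k.+1)%N by rewrite /nu [leqRHS]big_ord_recr leq_addr.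
have nuN k : (N k <= nu k)%N.
  by rewrite /nu big_ord_recr /= (leq_trans _ (leq_addl _ _)).
have nuk k : (k <= nu k)%N.
  elim: k => // k IH; rewrite /nu big_ord_recr /= -/(nu k) addnS ltnS.
  exact: leq_trans IH (leq_addr _ _).
have numono k j : (k <= j)%N -> (nu k <= nu j)%N.
  by move=> /subnK <-; elim: (j - k)%N => // i IH; exact: leq_trans IH (nuS _).
have Enu k m : (nu k <= m)%N -> E m - E (nu k) <= 4^-1 ^+ k.
  move=> km; apply: le_trans (HN k m (leq_trans (nuN k) km)).
  by rewrite lerB // dyE_mono.
pose s k := dyS (nu k) a b f.
have ms k : measurable_fun setT (s k) by exact: measurable_dyS.
have Ls k : L2 a b (s k) by exact: L2_dyS.
have [k|g mg gP] := L2_fast_cauchy ms Ls; first by rewrite ig_dyS_subsqr // Enu.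
have [Lg gC] : L2 a b g /\ ig a b (fun x => g x ^+ 2) <= C.
  have [|L1 L2] := gP (cst 0) C (measurable_cst _) (L2_cst a b 0).
    apply: nearW => j; rewrite (@eq_ig _ _ _ _ (fun x => s j x ^+ 2)) ?ig_dyS_sqr //.
    by move=> x _; rewrite subr0.
  split; first by apply: eq_L2 L1 => x _; rewrite subr0.
  by apply: le_trans L2; rewrite le_eqVlt; apply/orP; left; apply/eqP;
    apply: eq_ig => x _; rewrite subr0.
exists g; split => //.
have gs k : L2 a b (fun x => g x - s k x) /\
    ig a b (fun x => (g x - s k x) ^+ 2) <= 4^-1 ^+ k.
  apply: gP => //; exists k => // j kj.
  by rewrite /= ig_dyS_subsqr ?numono // Enu // numono.
have aprim t : a <= t <= b -> ig a t g = f t - f a.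
  move=> /andP[at_ tb]; apply/eqP; rewrite -subr_eq0 -normr_le0.
  apply/ler_addgt0Pr => e e0; rewrite add0r.
  have [d d0 fd] := heine_segment a b cf (divr_gt0 e0 (ltr0n _ 4)).
  (* One [k] serves both errors: the mesh has to be below [d], and by Cauchy-Schwarz the square of
     the integral of [g - s k] is at most [4^-k (b - a)]. *)
  have de0 : 0 < Num.min d ((e / 2) ^+ 2) by rewrite lt_min d0 exprn_gt0 // divr_gt0.
  have [k hk] := exists_half_pow (b - a) de0.
  move: hk; rewrite le_min => /andP[kd ke].
  have [Lk gk] := gs k.
  have Lat : L2 a t (fun x => g x - s k x) by exact: L2_sub (lexx _) tb Lk.
  have gi : intg a t g by exact: intg_sub (lexx _) tb (L2_intg Lg).
  have si : intg a t (s k) by exact/L2_intg/L2_dyS.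
  have h1 : `|ig a t (fun x => g x - s k x)| <= e / 2.
    move: at_; rewrite le_eqVlt => /predU1P[<-|at_].
      by rewrite igxx normr0 divr_ge0 // ltW.
    have := ig_CS at_ Lat; rewrite ler_pdivrMr ?subr_gt0 // => CS.
    have e2 : 0 <= e / 2 by rewrite divr_ge0 // ltW.
    suff : `|ig a t (fun x => g x - s k x)| ^+ 2 <= (e / 2) ^+ 2.
      by rewrite ler_sqr // nnegrE.
    rewrite real_normK ?num_real //; apply: (le_trans CS); apply: le_trans ke.
    rewrite [leRHS]mulrC; apply: ler_pM; [|by rewrite subr_ge0 ltW| |by lra].
      by apply: ig_ge0 => x _; exact: sqr_ge0.
    apply: (@le_trans _ _ (4^-1 ^+ k)); last first.
      by rewrite lerXn2r ?nnegrE ?invr_ge0 // lef_pV2 ?posrE // ler_nat.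
    apply: le_trans gk.
    rewrite (ig_split (ltW at_) tb); last by case: Lk.
    by rewrite lerDl; apply: ig_ge0 => x _; exact: sqr_ge0.
  have h2 : `|ig a t (s k) - (f t - f a)| <= 2 * (e / 4).
    apply: ig_dyS_approx => //; first by rewrite at_.
    move=> x y xI yI xy; apply: fd => //; apply: le_trans kd; apply: le_trans xy _.
    rewrite exprVn ler_pM2l ?subr_gt0 // lef_pV2 ?posrE ?exprn_gt0 //.
    by rewrite ler_eXn2l ?ltr1n.
  rewrite igB // in h1.
  have := ler_normD (ig a t g - ig a t (s k)) (ig a t (s k) - (f t - f a)).
  by rewrite addrA subrK; lra.
move=> s0 t as0 st tb.
have := aprim t; have := aprim s0.
rewrite (@ig_split _ a s0 t) //; last exact: intg_sub (lexx _) tb (L2_intg Lg).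
move=> -> //; last by rewrite as0 (le_trans st).
move=> /(_ _)/eqP; rewrite (le_trans as0 st) tb => /(_ isT) H.
by move/eqP: H; lra.
Qed.
End Primitives.

(** * C^1 steps as test functions *)

Section WeakDerivatives.
Variable R : realType.
Local Notation mu := (@lebesgue_measure R).
Implicit Types (a b c s t x y : R) (f g h phi : R -> R).

Lemma ftc_C1 phi (psi : R -> R) s t : (forall x, is_derive x 1 phi (psi x)) ->
  continuous psi -> s <= t -> phi t - phi s = ig s t psi.
Proof.
move=> dphi cpsi; rewrite le_eqVlt => /predU1P[->|st]; first by rewrite igxx subrr.
have cphi : continuous phi.
  by move=> x; apply: differentiable_continuous; apply/derivable1_diffP.
have := @continuous_FTC2 R psi phi s t st (continuous_subspaceT cpsi).
have D : derivable_oo_LRcontinuous phi s t.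
  split; [by move=> x _ | exact/cvg_at_right_filter/cphi | exact/cvg_at_left_filter/cphi].
move=> /(_ D) E; apply: EFin_inj; rewrite EFinB -E.
  rewrite -EFin_ig; last exact: intg_continuous.
  rewrite integral_itv_bndo_bndc //; apply: measurable_funTS.
  by apply/measurable_EFinP; exact: continuous_measurable_fun.
by move=> x _; rewrite derive1E; exact: derive_val.
Qed.

Lemma is_derive_sqbound f x (d C : R) : (forall h : R, `|f (h + x) - f x - d * h| <= C * h ^+ 2) ->
  is_derive x 1 f d.
Proof.
move=> fC.
have C0 : 0 <= C by have := fC 1; rewrite expr1n (mulr1 C); apply: le_trans.
have cv : h^-1 *: (f (h *: 1 + x) - f x) @[h --> (0 : R)^'] --> d.
  apply/cvgrPdist_le => e e0; near=> h.
  have h0 : h != 0 by near: h; exact: nbhs_dnbhs_neq.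
  have he : `|h| <= e / (C + 1).
    by near: h; apply: dnbhs0_le => //; rewrite divr_gt0 // ltr_wpDl.
  rewrite /GRing.scale /= mulr1.
  have -> : d - h^-1 * (f (h + x) - f x) = - (f (h + x) - f x - d * h) / h by field.
  rewrite normrM normfV normrN ler_pdivrMr ?normr_gt0 //; apply: (le_trans (fC h)).
  rewrite -(real_normK (num_real h)) expr2 mulrA ler_pM2r ?normr_gt0 //.
  apply: (@le_trans _ _ ((C + 1) * `|h|)); first by rewrite ler_wpM2r // lerDl.
  by rewrite mulrC -ler_pdivlMr // ltr_wpDl.
apply: DeriveDef; first by apply/cvg_ex; eexists; exact: cv.
exact: cvg_lim cv.
Unshelve. all: by end_near. Qed.

Definition ramp x : R := Num.max x 0.

Lemma continuous_ramp : continuous ramp.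
Proof. by move=> x; apply: continuous_max; [exact: cvg_id|exact: cvg_cst]. Qed.

Lemma ramp_le0 x : x <= 0 -> ramp x = 0.
Proof. by move=> x0; rewrite /ramp max_r. Qed.

Lemma ramp_ge0 x : 0 <= x -> ramp x = x.
Proof. by move=> x0; rewrite /ramp max_l. Qed.

Lemma ramp_sqr_taylor x y : `|ramp (y + x) ^+ 2 - ramp x ^+ 2 - 2 * ramp x * y| <= y ^+ 2.
Proof.
by rewrite ler_norml /ramp /Num.max; case: ifPn => A; case: ifPn => B; apply/andP; split; nra.
Qed.

(* A C^1 step from 0 (left of 0) to 1 (right of 2), with a tent as derivative. *)
Definition bstep x : R := (ramp x ^+ 2 - 2 * ramp (x - 1) ^+ 2 + ramp (x - 2) ^+ 2) / 2.
Definition btent x : R := ramp x - 2 * ramp (x - 1) + ramp (x - 2).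

Lemma bstep_le0 x : x <= 0 -> bstep x = 0.
Proof.
move=> x0; rewrite /bstep !ramp_le0; [|lra|lra|lra].
by rewrite expr0n /=; lra.
Qed.

Lemma bstep_ge2 x : 2 <= x -> bstep x = 1.
Proof.
move=> x0; rewrite /bstep !ramp_ge0; [|lra|lra|lra].
by field.
Qed.

Lemma bstep_itv x : 0 <= bstep x <= 1.
Proof.
rewrite /bstep /ramp /Num.max; case: ifPn => A; case: ifPn => B; case: ifPn => C;
  apply/andP; split; nra.
Qed.

Lemma btent_ge0 x : 0 <= btent x.
Proof.
rewrite /btent /ramp /Num.max; case: ifPn => A; case: ifPn => B; case: ifPn => C; lra.
Qed.

Lemma btent_supp x : x <= 0 \/ 2 <= x -> btent x = 0.
Proof.
rewrite /btent /ramp /Num.max => - [H|H];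
  case: ifPn => A; case: ifPn => B; case: ifPn => C; lra.
Qed.

Lemma continuous_btent : continuous btent.
Proof.
have c d : continuous (fun x : R => ramp (x - d)).
  move=> x; apply: (@continuous_comp _ _ _ (fun x => x - d) ramp); last exact: continuous_ramp.
  by apply: cvgB; [exact: cvg_id|exact: cvg_cst].
move=> x; apply: cvgD; last exact: c.
apply: cvgB; first exact: continuous_ramp.
by apply: cvgM; [exact: cvg_cst|exact: c].
Qed.

Lemma bstep_taylor x y : `|bstep (y + x) - bstep x - btent x * y| <= 2 * y ^+ 2.
Proof.
have := ramp_sqr_taylor x y; have := ramp_sqr_taylor (x - 1) y.
have := ramp_sqr_taylor (x - 2) y; rewrite !addrA /bstep /btent.
by rewrite !ler_norml; nra.
Qed.

Definition stepat k s x : R := bstep (k * (x - s)).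

Lemma is_derive_stepat k s x : is_derive x 1 (stepat k s) (k * btent (k * (x - s))).
Proof.
apply: (@is_derive_sqbound _ _ _ (2 * k ^+ 2)) => h.
have := bstep_taylor (k * (x - s)) (k * h).
have -> : k * h + k * (x - s) = k * (h + x - s) by ring.
have -> : btent (k * (x - s)) * (k * h) = k * btent (k * (x - s)) * h by ring.
by have -> : 2 * (k * h) ^+ 2 = 2 * k ^+ 2 * h ^+ 2 by ring.
Qed.

Lemma continuous_stepat_tent k s : continuous (fun x => k * btent (k * (x - s))).
Proof.
move=> x; apply: cvgM; first exact: cvg_cst.
apply: (@continuous_comp _ _ _ (fun x => k * (x - s)) btent); last exact: continuous_btent.
by apply: cvgM; [exact: cvg_cst|apply: cvgB; [exact: cvg_id|exact: cvg_cst]].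
Qed.

(** Absolute continuity of the integral with an explicit modulus: by Cauchy-Schwarz the squared
    integral over [[s, t]] is at most [C (t - s)]. *)
Lemma ig_small a b g e : L2 a b g -> 0 < e -> exists2 d, 0 < d &
  forall s t, a <= s -> s <= t -> t <= b -> t - s <= d -> ig s t (fun x => `|g x|) <= e.
Proof.
move=> Lg e0; set C := ig a b (fun x => g x ^+ 2).
have C0 : 0 <= C by apply: ig_ge0 => x _; exact: sqr_ge0.
exists (e ^+ 2 / (C + 1)); first by rewrite divr_gt0 ?exprn_gt0 // ltr_wpDl.
move=> s t as0 + tb td; rewrite le_eqVlt => /predU1P[->|st]; first by rewrite igxx ltW.
have Lst := L2_sub as0 tb Lg.
have Ln : L2 s t (fun x => `|g x|).
  case: Lst => mg gi; split; first exact: measurableT_comp.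
  by apply: eq_intg gi => x _ /=; rewrite real_normK ?num_real.
have En : ig s t (fun x => `|g x| ^+ 2) = ig s t (fun x => g x ^+ 2).
  by apply: eq_ig => x _; rewrite real_normK ?num_real.
have := ig_CS st Ln; rewrite En.
rewrite ler_pdivrMr ?subr_gt0 // => H.
have h0 : 0 <= ig s t (fun x => `|g x|) by apply: ig_ge0.
suff : ig s t (fun x => `|g x|) ^+ 2 <= e ^+ 2 by rewrite ler_sqr ?nnegrE // ltW.
apply: (le_trans H); have Cst : ig s t (fun x => g x ^+ 2) <= C.
  have [_ gi] := Lg; have at_ := le_trans as0 (ltW st).
  have sgi := intg_sub as0 (lexx b) gi.
  have sb : s <= b by exact: le_trans (ltW st) tb.
  rewrite /C (ig_split as0 sb gi) (ig_split (ltW st) tb sgi).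
  have p u v : 0 <= ig u v (fun x => g x ^+ 2) by apply: ig_ge0 => x _; exact: sqr_ge0.
  by have := p a s; have := p t b; lra.
apply: (@le_trans _ _ (C * (e ^+ 2 / (C + 1)))).
  apply: ler_pM => //; last by rewrite subr_ge0 ltW.
  by apply: ig_ge0 => x _; exact: sqr_ge0.
rewrite mulrCA ler_piMr ?sqr_ge0 // ler_pdivrMr ?ltr_wpDl //; lra.
Qed.

Lemma le_ig_norm s t f g : L2 s t g -> measurable_fun `[s, t[ f ->
  (forall x, s <= x < t -> `|f x| <= `|g x|) -> `|ig s t f| <= ig s t (fun x => `|g x|).
Proof.
move=> Lg mf fg; have gi := intg_norm (L2_intg Lg).
have fi : intg s t f by exact: intg_le mf fg gi.
apply: le_trans (le_norm_ig fi) _; apply: le_ig => //; exact: intg_norm.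
Qed.

End WeakDerivatives.

(** * Weak derivatives are the integrands of primitives *)

Section WeakDerivativePrimitive.
Variable R : realType.
Local Notation mu := (@lebesgue_measure R).
Implicit Types (a b c s t x y : R) (f g h phi : R -> R).

Lemma in_L2_itv a b g : in_L2 `]a, b[ g <-> L2 a b g.
Proof.
have I2 : measurable_fun `]a, b[ g -> (\int[mu]_(x in `]a, b[) (g x ^+ 2)%:E =
    \int[mu]_(x in `[a, b[) (g x ^+ 2)%:E)%E.
  move=> mg; apply: integral_itv_obnd_cbnd.
  by apply/measurable_EFinP; exact: measurable_funX.
have E : (\int[mu]_(x in `[a, b[) `|(g x ^+ 2)%:E| = \int[mu]_(x in `[a, b[) (g x ^+ 2)%:E)%E.
  by apply: eq_integral => x _; rewrite gee0_abs // lee_fin sqr_ge0.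
split=> [[mg gi]|[mg /integrableP[_ gi]]].
  rewrite I2 // in gi; move/measurable_fun_itv_obnd_cbndP : mg => mg.
  split => //; apply/integrableP; split; last by rewrite E.
  by apply/measurable_EFinP; exact: measurable_funX.
move/measurable_fun_itv_obnd_cbndP : mg => mg; split => //.
by rewrite I2 // -E.
Qed.

Lemma ig_oo a b g : intg a b g -> \int[mu]_(x in `]a, b[) g x = ig a b g.
Proof.
move=> gi; apply: Rintegral_itv_obnd_cbnd; apply: integrableS gi => //.
exact: subset_itvW.
Qed.

(** The weight has integral 1 and vanishes outside [[s, s + 2 / k]], so it averages [f] near [s]. *)
Lemma ig_stepat_tent a b k s f e : continuous f -> 0 < k -> a <= s -> s + 2 / k <= b ->
  (forall x, s <= x <= s + 2 / k -> `|f x - f s| <= e) ->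
  `|ig a b (fun x => f x * (k * btent (k * (x - s)))) - f s| <= e.
Proof.
move=> cf k0 as_ sb fe; set w := fun x => k * btent (k * (x - s)).
have k2 : k * (2 / k) = 2 by field; rewrite gt_eqF.
have sk : 0 < 2 / k by rewrite divr_gt0.
have cw : continuous w by exact: continuous_stepat_tent.
have w0 x : 0 <= w x by rewrite mulr_ge0 ?btent_ge0 // ltW.
have w1 : ig a b w = 1.
  rewrite -(ftc_C1 (is_derive_stepat k s) cw); last by lra.
  rewrite /stepat bstep_ge2; last by rewrite -k2 ler_pM2l //; lra.
  by rewrite bstep_le0 ?subr0 // (mulr_ge0_le0 (ltW k0)) //; lra.
have cfw : continuous (fun x => f x * w x) by move=> x; apply: cvgM; [exact: cf|exact: cw].
have cfs : continuous (fun x => f s * w x) by move=> x; apply: cvgM; [exact: cvg_cst|exact: cw].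
have -> : f s = ig a b (fun x => f s * w x).
  by rewrite igZ ?w1 ?mulr1 //; exact: intg_continuous.
rewrite -igB; [|exact: intg_continuous|exact: intg_continuous].
have ci : intg a b (fun x => f x * w x - f s * w x).
  by apply: intgB; exact: intg_continuous.
apply: le_trans (le_norm_ig ci) _.
have <- : ig a b (fun x => e * w x) = e.
  by rewrite igZ ?w1 ?mulr1 //; exact: intg_continuous.
apply: le_ig; [exact: intg_norm|by apply: intgZ; exact: intg_continuous|].
move=> x xab; rewrite -mulrBl normrM (ger0_norm (w0 x)).
have [xs|] := boolP (s <= x <= s + 2 / k); first by rewrite ler_wpM2r ?fe.
rewrite negb_and -!ltNge => xs; suff -> : w x = 0 by rewrite !mulr0.
rewrite /w btent_supp ?mulr0 //; case/orP: xs => xs; [left|right].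
  by rewrite (mulr_ge0_le0 (ltW k0)) //; lra.
by rewrite -k2 ler_pM2l //; lra.
Qed.

Lemma ig_eq0 a b f : a <= b -> (forall x, a <= x < b -> f x = 0) -> ig a b f = 0.
Proof. by move=> ab f0; rewrite (eq_ig f0) ig_cst // mul0r. Qed.

(** Tests against a C^1 approximation of the indicator of [[s, t]]: a step at [s] minus a step at
    [t]. Its derivative is a difference of two narrow tents, which pick out [f s] and [f t]. *)
Lemma weak_derivative_oo a b f g s t : continuous f ->
  weak_derivative `]a, b[ f g -> a < s -> s < t -> t < b -> f t - f s = ig s t g.
Proof.
move=> cf [/in_L2_itv Lg wd] as_ st tb; apply/eqP; rewrite -subr_eq0 -normr_le0.
apply/ler_addgt0Pr => e0 e00; rewrite add0r.
(* Five errors: the two averages of [f], the integrals of [g * phi] over the two ramps, and the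
   integral of [g] over the first ramp. *)
have [e eE e_gt0] : exists2 e, e0 = 5 * e & 0 < e by exists (e0 / 5); [field|rewrite divr_gt0].
have [d d0 fd] := heine_segment a b cf e_gt0.
have [d' d'0 gd] := ig_small Lg e_gt0.
have [r r0 [rd rd' rst rtb]] : exists2 r, 0 < r &
    [/\ r <= d, r <= d', r <= (t - s) / 2 & r <= (b - t) / 2].
  exists (Num.min (Num.min d d') (Num.min ((t - s) / 2) ((b - t) / 2))).
    by rewrite !lt_min d0 d'0 !divr_gt0 ?subr_gt0.
  by split; rewrite !ge_min lexx ?orbT.
have [las lsr lsrt ltr ltrb] : [/\ a <= s, s <= s + r, s + r <= t, t <= t + r & t + r <= b].
  by clear - as_ st tb r0 rst rtb; split; lra.
have [lsb lsrb ltb] : [/\ s <= b, s + r <= b & t <= b] by clear - tb lsrt ltrb lsr ltr; split; lra.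
have [lat lasr latr] : [/\ a <= t, a <= s + r & a <= t + r] by clear - las lsr lsrt ltr; split; lra.
have tb' : t + r < b by clear - tb r0 rtb; lra.
have srs : s + r - s <= r by rewrite addrAC subrr add0r.
have trt : t + r - t <= r by rewrite addrAC subrr add0r.
have near c x : c <= x <= c + r -> `|x - c| <= d.
  by clear - rd; rewrite ler_norml; lra.
have [k k0 [rE kr]] : exists2 k, 0 < k & 2 / k = r /\ k * r = 2.
  by exists (2 / r); [rewrite divr_gt0|split; field; rewrite gt_eqF].
pose ps x := k * btent (k * (x - s)); pose pt x := k * btent (k * (x - t)).
pose phi x := stepat k s x - stepat k t x.
have dphi x : is_derive x 1 phi (ps x - pt x).
  by apply: is_deriveB; exact: is_derive_stepat.
have cps : continuous ps by exact: continuous_stepat_tent.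
have cpt : continuous pt by exact: continuous_stepat_tent.
have D1 : derive1 phi = (fun x => ps x - pt x).
  by apply/funext => x; rewrite derive1E; exact: derive_val.
have st0 c x : x <= c -> stepat k c x = 0.
  by move=> xc; rewrite /stepat bstep_le0 // (mulr_ge0_le0 (ltW k0)) // subr_le0.
have st1 c x : c + r <= x -> stepat k c x = 1.
  by move=> xc; rewrite /stepat bstep_ge2 // -kr ler_pM2l // lerBrDl.
have stI c x : 0 <= stepat k c x <= 1 by exact: bstep_itv.
have phil x : x <= s -> phi x = 0.
  by move=> xs; rewrite /phi !st0 ?subrr // (le_trans xs) // ltW.
have phir x : t + r <= x -> phi x = 0.
  by move=> xt; rewrite /phi !st1 ?subrr // (le_trans lsrt) // (le_trans ltr).
have tphi : test_function `]a, b[ phi.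
  split; first by move=> x.
    by rewrite D1 => x; apply: cvgB; [exact: cps|exact: cpt].
  exists `[s, t + r]%classic; split; first exact: segment_compact.
    by move=> x /=; rewrite !in_itv/= => /andP[sx xt]; rewrite (lt_le_trans as_ sx) (le_lt_trans xt).
  by move=> x /= /negP; rewrite in_itv/= negb_and -!ltNge => /orP[/ltW/phil|/ltW/phir].
have cphi : continuous phi.
  by move=> x; apply: differentiable_continuous; apply/derivable1_diffP.
have mphi c d1 : measurable_fun `[c, d1[ phi.
  by apply: measurable_funTS; exact: continuous_measurable_fun.
have gphi : intg a b (fun x => g x * phi x).
  by apply: intg_mul => //; exact: L2_continuous.
have fs : continuous (fun x => f x * ps x) by move=> x; apply: cvgM; [exact: cf|exact: cps].
have ft : continuous (fun x => f x * pt x) by move=> x; apply: cvgM; [exact: cf|exact: cpt].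
have := wd _ tphi; rewrite D1 !ig_oo //; last first.
  by apply: intg_continuous => x; apply: cvgM; [exact: cf|apply: cvgB; [exact: cps|exact: cpt]].
have -> : ig a b (fun x => f x * (ps x - pt x)) =
    ig a b (fun x => f x * ps x) - ig a b (fun x => f x * pt x).
  rewrite -igB; [|exact: intg_continuous|exact: intg_continuous].
  by apply: eq_ig => x _; ring.
have Hs : `|ig a b (fun x => f x * ps x) - f s| <= e.
  apply: ig_stepat_tent; rewrite ?rE //.
  by move=> x /andP[sx xs]; apply: fd; [rewrite (le_trans las) ?(le_trans xs)|rewrite las|apply: near; rewrite sx].
have Ht : `|ig a b (fun x => f x * pt x) - f t| <= e.
  apply: ig_stepat_tent; rewrite ?rE //.
  by move=> x /andP[sx xs]; apply: fd; [rewrite (le_trans lat) ?(le_trans xs)|rewrite lat|apply: near; rewrite sx].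
have gi := L2_intg Lg.
have S u v : a <= u -> v <= b -> intg u v (fun x => g x * phi x).
  by move=> au vb; exact: intg_sub gphi.
rewrite (ig_split las lsb gphi) (ig_split lsr lsrb (S _ _ las (lexx _))).
rewrite (ig_split lsrt ltb (S _ _ lasr (lexx _))) (ig_split ltr ltrb (S _ _ lat (lexx _))).
rewrite (ig_eq0 las); last first.
  by move=> x /andP[ax /ltW/phil ->]; rewrite mulr0.
rewrite (ig_eq0 ltrb); last first.
  by move=> x /andP[/phir -> _]; rewrite mulr0.
have -> : ig (s + r) t (fun x => g x * phi x) = ig (s + r) t g.
  by apply: eq_ig => x /andP[xs xt]; rewrite /phi st1 // st0 ?subr0 ?mulr1 // ltW.
rewrite (ig_split lsr lsrt (intg_sub las ltb gi)).
have phi1 x : `|phi x| <= 1.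
  have bd (y z : R) : 0 <= y <= 1 -> 0 <= z <= 1 -> `|y - z| <= 1.
    by clear; rewrite ler_norml; lra.
  exact: bd.
have small u v : a <= u -> u <= v -> v <= b -> v - u <= r -> ig u v (fun x => `|g x|) <= e.
  by move=> au uv vb vur; apply: gd => //; exact: le_trans rd'.
have B1 u v : a <= u -> u <= v -> v <= b -> v - u <= r ->
    `|ig u v (fun x => g x * phi x)| <= e.
  move=> au uv vb vur; apply: le_trans (small u v au uv vb vur).
  apply: le_ig_norm; first exact: L2_sub Lg.
    apply: measurable_funM => //; apply: intg_measurable; exact: intg_sub gi.
  by move=> x _; rewrite normrM ler_piMr.
have B2 : `|ig s (s + r) g| <= e.
  have gsi : intg s (s + r) g by exact: (intg_sub las lsrb gi).
  by apply: le_trans (le_norm_ig gsi) _; apply: small.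
have Bs := B1 s (s + r) las lsr lsrb srs; have Bt := B1 t (t + r) lat ltr ltrb trt.
move: Hs Ht B2 Bs Bt; rewrite !ler_norml.
rewrite eE.
move: (ig a b _) (ig a b _) (ig s _ _) (ig t _ _) (ig _ t _) (ig s _ g); clear => *; lra.
Qed.

(** Test functions have compact support in the open interval; the endpoints are reached by
    continuity of [f] and of the integral of [g]. *)
Lemma weak_derivative_prim a b f g : a < b -> continuous f ->
  weak_derivative `]a, b[ f g -> L2 a b g /\ prim a b f g.
Proof.
move=> ab cf wd; have Lg : L2 a b g by case: wd => /in_L2_itv.
split => // s t as_; rewrite le_eqVlt => /predU1P[-> _|st tb].
  by rewrite igxx subrr.
apply/eqP; rewrite -subr_eq0 -normr_le0.
apply/ler_addgt0Pr => e0 e00; rewrite add0r.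
have [e eE e_gt0] : exists2 e, e0 = 5 * e & 0 < e by exists (e0 / 5); [field|rewrite divr_gt0].
have [d d0 fd] := heine_segment a b cf e_gt0.
have [d' d'0 gd] := ig_small Lg e_gt0.
have [r r0 [rd rd' rst]] : exists2 r, 0 < r & [/\ r <= d, r <= d' & r <= (t - s) / 3].
  exists (Num.min (Num.min d d') ((t - s) / 3)).
    by rewrite !lt_min d0 d'0 !divr_gt0 ?subr_gt0.
  by split; rewrite !ge_min lexx ?orbT.
have [asr srt trb] : [/\ a < s + r, s + r < t - r & t - r < b].
  by clear - as_ st tb r0 rst; split; lra.
have [h1 h2 h3 h4 h5] : [/\ s <= s + r, s + r <= t, s + r <= t - r, t - r <= t & a <= s + r].
  by clear - as_ st tb r0 rst; split; lra.
have [h6 h7 h8] : [/\ s + r <= b, a <= t - r & a <= t] by clear - as_ st tb r0 rst; split; lra.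
have srs : s + r - s <= r by rewrite addrAC subrr add0r.
have trt : t - (t - r) <= r by rewrite opprB addrC subrK.
have P : f (t - r) - f (s + r) = ig (s + r) (t - r) g.
  exact: weak_derivative_oo wd _ _ _.
have sm u v : a <= u -> u <= v -> v <= b -> v - u <= r -> `|ig u v g| <= e.
  move=> au uv vb vur.
  apply: le_trans (le_norm_ig (intg_sub au vb (L2_intg Lg))) _.
  by apply: gd => //; exact: le_trans rd'.
rewrite (ig_split h1 h2 (intg_sub as_ tb (L2_intg Lg))).
rewrite (ig_split h3 h4 (intg_sub h5 tb (L2_intg Lg))) -P.
have A1 : `|ig s (s + r) g| <= e by exact: sm.
have A2 : `|ig (t - r) t g| <= e by exact: sm.
have near x y : x <= y -> y - x <= r -> a <= x -> y <= b -> `|f y - f x| <= e.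
  move=> xy yxr ax yb; apply: fd; [by rewrite (le_trans ax)|by rewrite ax (le_trans xy)|].
  by rewrite ger0_norm ?subr_ge0 // (le_trans yxr).
have A3 : `|f t - f (t - r)| <= e by exact: near.
have A4 : `|f (s + r) - f s| <= e by exact: near.
move: A1 A2 A3 A4; rewrite !ler_norml eE.
by move: (ig s _ g) (ig _ t g) (f t) (f s) (f (t - r)) (f (s + r)); clear => *; lra.
Qed.

(** Bisection: [Phi] and [nu] are additive over adjacent intervals, so a bound on short intervals
    adds up. It replaces the product rule for a function that is a primitive only in the integral
    sense. *)
Lemma interval_fun_bound (Phi nu : R -> R -> R) d e n a b : a < b ->
  (forall s c t, a <= s -> s < c -> c < t -> t <= b ->
     Phi s t = Phi s c + Phi c t /\ nu s t = nu s c + nu c t) ->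
  (forall s t, a <= s -> s < t -> t <= b -> t - s <= d -> `|Phi s t| <= e * nu s t) ->
  (b - a) / 2 ^+ n <= d -> `|Phi a b| <= e * nu a b.
Proof.
elim: n a b => [|n IH] a b ab add small; first by rewrite divr1 => ?; apply: small.
move=> bd; set c := (a + b) / 2; have ac : a < c by rewrite /c; lra.
have cb : c < b by rewrite /c; lra.
have [-> ->] := add a c b (lexx a) ac cb (lexx b).
rewrite mulrDr; apply: le_trans (ler_normD _ _) _.
have w : (c - a) / 2 ^+ n = (b - a) / 2 ^+ n.+1 by rewrite /c exprS invfM; lra.
have w' : (b - c) / 2 ^+ n = (b - a) / 2 ^+ n.+1 by rewrite /c exprS invfM; lra.
apply: lerD; apply: IH; rewrite ?w ?w' //.
- by move=> s u t as_ su ut tc; apply: add => //; lra.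
- by move=> s t as_ st tc; apply: small => //; lra.
- by move=> s u t as_ su ut tc; apply: add => //; lra.
- by move=> s t as_ st tc; apply: small => //; lra.
Qed.

(** Integration by parts. The defect [Phi] of the product rule is additive and on short intervals at
    most [e * nu], for every [e > 0]; hence it vanishes on [[a, b]]. *)
Lemma prim_weak_derivative a b f g : a < b -> continuous f -> L2 a b g ->
  prim a b f g -> weak_derivative `]a, b[ f g.
Proof.
move=> ab cf Lg P; split; first exact/in_L2_itv.
move=> phi [dphi cphi' [K [cK Kab phiK]]]; set psi := derive1 phi in cphi' *.
have isd x : is_derive x 1 phi (psi x) by rewrite /psi derive1E; apply: derivableP.
have cphi : continuous phi.
  by move=> x; apply: differentiable_continuous; apply/derivable1_diffP.
have gi := L2_intg Lg.
have cfp : continuous (fun x => f x * psi x) by move=> x; apply: cvgM; [exact: cf|exact: cphi'].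
have fpi u v : intg u v (fun x => f x * psi x) by exact: intg_continuous.
have gpi : intg a b (fun x => g x * phi x) by apply: intg_mul => //; exact: L2_continuous.
have phi0 : phi a = 0 /\ phi b = 0.
  by split; apply: phiK => /Kab /=; rewrite in_itv/= ltxx ?andbF.
have [M psiM] : exists M, forall x, a <= x <= b -> `|psi x| <= M.
  have cpab : {within `[a, b], continuous psi} by exact: continuous_subspaceT.
  have [x _ xM] := EVT_max (ltW ab) (continuous_subspaceT (fun x => continuous_comp (cphi' x) (@norm_continuous _ _ (psi x)))).
  by exists `|psi x| => y yab; apply: xM; rewrite in_itv.
have M0 : 0 <= M by apply: le_trans (psiM a _) => //; rewrite lexx ltW.
rewrite !ig_oo //; apply/eqP; rewrite -subr_eq0 opprK -igD // -normr_le0.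
pose F x := f x * psi x + g x * phi x.
have Fi : intg a b F by apply: intgD.
pose Phi s t := f t * phi t - f s * phi s - ig s t F.
pose nu s t := M * (t - s) + ig s t (fun x => `|g x|).
have nu0 : 0 <= nu a b.
  by rewrite addr_ge0 ?ig_ge0 // mulr_ge0 // subr_ge0 ltW.
have main e : 0 < e -> `|Phi a b| <= e * nu a b.
  move=> e0; have [d d0 fd] := heine_segment a b cf e0.
  have [d' d'0 phid] := heine_segment a b cphi e0.
  have dd0 : 0 < Num.min d d' by rewrite lt_min d0.
  have [n nd] := exists_half_pow (b - a) dd0; rewrite exprVn in nd.
  apply: interval_fun_bound nd => //.
    move=> s c t as_ sc ct tb.
    have Fst : intg s t F by exact: intg_sub Fi.
    have gst : intg s t (fun x => `|g x|) by apply: intg_norm; exact: intg_sub gi.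
    by rewrite /Phi /nu !(ig_split (ltW sc) (ltW ct)) //; split; ring.
  move=> s t as_ st tb; rewrite le_min => /andP[std std'].
  have gst : intg s t g by exact: intg_sub gi.
  have Lst : L2 s t g by exact: L2_sub Lg.
  have i1 : intg s t (fun x => (f s - f x) * psi x).
    apply: intg_continuous => x; apply: cvgM; last exact: cphi'.
    by apply: cvgB; [exact: cvg_cst|exact: cf].
  have i2 : intg s t (fun x => g x * (phi t - phi x)).
    apply: intg_mul => //; apply: L2_continuous => x.
    by apply: cvgB; [exact: cvg_cst|exact: cphi].
  (* Freezing [f] at [s] and [phi] at [t] leaves only differences that are small by uniform
     continuity. *)
  have -> : Phi s t = ig s t (fun x => (f s - f x) * psi x) +
      ig s t (fun x => g x * (phi t - phi x)).
    have -> : Phi s t = f s * (phi t - phi s) + phi t * (f t - f s) - ig s t F.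
      by rewrite /Phi; ring.
    have Fst : intg s t F by exact: intg_sub Fi.
    have psii : intg s t psi by exact: intg_continuous.
    rewrite (ftc_C1 isd cphi' (ltW st)) (P s t as_ (ltW st) tb) -(igZ _ psii) -(igZ _ gst).
    have c1 := intgZ (f s) psii; have c2 := intgZ (phi t) gst.
    rewrite -(igD c1 c2) -(igB (intgD c1 c2) Fst) -(igD i1 i2).
    by apply: eq_ig => x _; rewrite /F; ring.
  apply: le_trans (ler_normD _ _) _; rewrite /nu mulrDr; apply: lerD.
    apply: le_trans (le_norm_ig i1) _.
    apply: (@le_trans _ _ (ig s t (fun=> e * M))).
      apply: le_ig; [exact: intg_norm|exact: (intg_cst s t (e * M))|].
      move=> x /andP[sx xt]; rewrite normrM; apply: ler_pM => //.
        by apply: fd; rewrite ?ler_norml; lra.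
      by apply: psiM; lra.
    by rewrite ig_cst ?mulrA // ltW.
  apply: le_trans (le_norm_ig i2) _.
  rewrite -igZ; last exact: intg_norm.
  apply: le_ig; [exact: intg_norm|by apply: intgZ; exact: intg_norm|].
  move=> x /andP[sx xt]; rewrite normrM mulrC ler_wpM2r //.
  by apply: phid; rewrite ?ler_norml; lra.
have PhiE : `|Phi a b| = `|ig a b F|.
  by rewrite /Phi phi0.1 phi0.2 !mulr0 subrr sub0r normrN.
rewrite -/F -PhiE; apply/ler_addgt0Pr => e e0; rewrite add0r.
apply: (le_trans (main (e / (nu a b + 1)) _)); first by rewrite divr_gt0 // ltr_wpDl.
by rewrite mulrAC ler_pdivrMr ?ltr_wpDl // ler_wpM2l ?ltW //; lra.
Qed.

End WeakDerivativePrimitive.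

(** * The Dirichlet energy of an interval and its piecewise linear variations *)

Section DirichletEnergy.
Variable R : realType.
Local Notation mu := (@lebesgue_measure R).
Implicit Types (a b c l s t x y : R) (f g h k phi : R -> R).

(** All integrals of [g - h] over [[a, y]] vanish, so Lebesgue's differentiation theorem gives
    [g = h] almost everywhere. *)
Lemma prim_ae_unique a b f g h : L2 a b g -> L2 a b h -> prim a b f g -> prim a b f h ->
  {ae mu, forall x, a < x < b -> g x = h x}.
Proof.
move=> Lg Lh Pg Ph; have gi := L2_intg Lg; have hi := L2_intg Lh.
pose d := (fun x => g x - h x) \_ `[a, b[.
have di : intg a b (fun x => g x - h x) by exact: intgB.
have dT : mu.-integrable setT (EFin \o d).
  rewrite /d -restrict_EFin; apply/integrable_restrict => //.
  by rewrite setTI.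
have locd : locally_integrable [set: R] d.
  exact: open_integrable_locally openT dT.
have dI y : mu.-integrable `]-oo, y] (EFin \o d).
  exact: integrableS dT.
have := FTC1Ny dI locd.
apply: (@filterS _ _ (ae_filter_ringOfSetsType mu)) => x [_] H /andP[ax xb]; move: H.
have -> : d x = g x - h x by rewrite /d patchE mem_set //= in_itv/= ltW.
move=> E; apply/eqP; rewrite -subr_eq0 -E; apply/eqP.
have xab : x \in `]a, b[ by rewrite in_itv/= ax.
rewrite derive1E (@near_eq_derive _ _ _ _ (cst 0)) ?derive_cst //.
near=> y.
have : y \in `]a, b[ by near: y; exact: near_in_itvoo.
rewrite in_itv/= => /andP[ay yb].
rewrite -Rintegral_itv_bndo_bndc; last by apply: integrableS dT.
have -> : \int[mu]_(t in `]-oo, y[) d t = ig a y (fun x => g x - h x).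
  rewrite /ig Rintegral_mkcond [RHS]Rintegral_mkcond; congr Rintegral.
  apply/funext => z; rewrite /d !patchE !mem_setE !in_itv/= ?in_itv/=.
  by case: (ltP z y) => zy; rewrite ?andbF ?andbT // (lt_trans zy yb) andbT.
have lay := ltW ay; have lyb := ltW yb.
rewrite igB; [|exact: intg_sub gi|exact: intg_sub hi].
by rewrite -(Pg a y (lexx _) lay lyb) -(Ph a y (lexx _) lay lyb) subrr.
Unshelve. all: by end_near. Qed.

Lemma prim_unique a b f g h : L2 a b g -> L2 a b h -> prim a b f g -> prim a b f h ->
  ig a b (fun x => g x ^+ 2) = ig a b (fun x => h x ^+ 2).
Proof.
move=> Lg Lh Pg Ph; apply: EFin_inj.
rewrite -EFin_ig; last by case: Lg.
rewrite -EFin_ig; last by case: Lh.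
have [[mg _] [mh _]] := (Lg, Lh).
have mg2 : measurable_fun `[a, b[ (fun x => (g x ^+ 2)%:E).
  by apply/measurable_EFinP; exact: measurable_funX.
have mh2 : measurable_fun `[a, b[ (fun x => (h x ^+ 2)%:E).
  by apply/measurable_EFinP; exact: measurable_funX.
rewrite -!integral_itv_obnd_cbnd; [|exact/emeasurable_fun_itv_obnd_cbndP
  |exact/emeasurable_fun_itv_obnd_cbndP].
apply: ae_eq_integral => //; [exact/emeasurable_fun_itv_obnd_cbndP
  |exact/emeasurable_fun_itv_obnd_cbndP|].
apply: (@filterS _ _ (ae_filter_ringOfSetsType mu) _ _ _ (prim_ae_unique Lg Lh Pg Ph)).
by move=> x H /=; rewrite in_itv/= => /H ->.
Qed.

Definition Den l f : \bar R := ereal_sup (range (fun n => (dyE n 0 l f)%:E)).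

Lemma Den_ge0 l f : 0 < l -> (0 <= Den l f)%E.
Proof.
move=> l0; apply: (@le_trans _ _ (dyE 0 0 l f)%:E); first by rewrite lee_fin dyE_ge0.
by apply: ereal_sup_ubound; exists 0%N.
Qed.

Lemma dyE_le_Den n l f : ((dyE n 0 l f)%:E <= Den l f)%E.
Proof. by apply: ereal_sup_ubound; exists n. Qed.

Lemma Den_le l f C : (forall n, dyE n 0 l f <= C) -> (Den l f <= C%:E)%E.
Proof. by move=> H; apply: ge_ereal_sup => _ [n _ <-]; rewrite lee_fin. Qed.

Lemma Den_ltyP l f : 0 < l -> (Den l f < +oo)%E ->
  exists2 C, Den l f = C%:E & forall n, dyE n 0 l f <= C.
Proof.
move=> l0 fy; exists (fine (Den l f)).
  by rewrite fineK // ge0_fin_numE ?Den_ge0.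
by move=> n; rewrite -lee_fin fineK ?dyE_le_Den // ge0_fin_numE ?Den_ge0.
Qed.

Lemma Den_prim l f : 0 < l -> continuous f -> (Den l f < +oo)%E ->
  exists g, [/\ measurable_fun setT g, L2 0 l g, prim 0 l f g &
    Den l f = (ig 0 l (fun x => g x ^+ 2))%:E].
Proof.
move=> l0 cf /(Den_ltyP l0)[C DC EC].
have [g [mg Lg Pg gC]] := prim_of_dyE l0 cf EC.
exists g; split => //; apply/eqP; rewrite eq_le; apply/andP; split.
  by apply: Den_le => n; exact: prim_dyE.
by rewrite DC lee_fin.
Qed.

Lemma prim_Den l f g : 0 < l -> continuous f -> L2 0 l g -> prim 0 l f g ->
  Den l f = (ig 0 l (fun x => g x ^+ 2))%:E.
Proof.
move=> l0 cf Lg Pg; have fy : (Den l f < +oo)%E.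
  apply: le_lt_trans (ltry (ig 0 l (fun x => g x ^+ 2))).
  by apply: Den_le => n; exact: prim_dyE.
have [h [_ Lh Ph ->]] := Den_prim l0 cf fy.
by rewrite (prim_unique Lg Lh Pg Ph).
Qed.

Lemma in_H1_Den l f : 0 < l -> continuous f -> in_H1 `]0, l[ f <-> (Den l f < +oo)%E.
Proof.
move=> l0 cf; split=> [[_ [g wd]]|fy].
  have [Lg Pg] := weak_derivative_prim l0 cf wd.
  by rewrite (prim_Den l0 cf Lg Pg) ltry.
have [g [_ Lg Pg _]] := Den_prim l0 cf fy.
split; first by apply/in_L2_itv; exact: L2_continuous.
by exists g; exact: prim_weak_derivative.
Qed.

(** The bridge to weak derivatives: [wderiv] is an arbitrary choice, but every choice is the
    integrand of the same primitive and so has the same square integral. *)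
Lemma wderiv_Den l f : 0 < l -> continuous f -> in_H1 `]0, l[ f ->
  (\int[mu]_(t in `]0%R, l[) ((wderiv `]0%R, l[ f t) ^+ 2)%:E)%E = Den l f.
Proof.
move=> l0 cf [_ [g0 wd0]]; set g := wderiv _ _.
have wd : weak_derivative `]0, l[ f g by rewrite /g /wderiv; exact: (xgetPex (cst 0) (ex_intro _ g0 wd0)).
have [Lg Pg] := weak_derivative_prim l0 cf wd.
rewrite (prim_Den l0 cf Lg Pg) -EFin_ig; last by case: Lg.
apply: integral_itv_obnd_cbnd; apply/measurable_EFinP; apply: measurable_funX.
by case: Lg => /measurable_fun_itv_obnd_cbndP.
Qed.

(** By Cauchy-Schwarz, functions of bounded energy are uniformly 1/2-Hölder; this is the source of
    compactness on each edge. *)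
Lemma Den_hoelder l f C s t : 0 < l -> continuous f -> (Den l f <= C%:E)%E ->
  0 <= s -> s <= t -> t <= l -> (f t - f s) ^+ 2 <= C * (t - s).
Proof.
move=> l0 cf fC s0; rewrite le_eqVlt => /predU1P[-> _|st tl].
  by rewrite !subrr expr0n mulr0.
have [g [_ Lg Pg E]] := Den_prim l0 cf (le_lt_trans fC (ltry _)).
have gi := Lg.2; have Ls := L2_sub s0 tl Lg.
rewrite (Pg s t s0 (ltW st) tl) -ler_pdivrMr ?subr_gt0 //.
apply: le_trans (ig_CS st Ls) _; rewrite E lee_fin in fC; apply: le_trans fC.
have sl := le_trans (ltW st) tl.
rewrite (ig_split s0 sl gi) (ig_split (ltW st) tl (intg_sub s0 (lexx _) gi)).
have p u v : 0 <= ig u v (fun x => g x ^+ 2) by apply: ig_ge0 => x _; exact: sqr_ge0.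
by have := p 0 s; have := p t l; lra.
Qed.

Lemma prim_axpy a b c f g h k : L2 a b g -> L2 a b k -> prim a b f g -> prim a b h k ->
  prim a b (fun x => f x + c * h x) (fun x => g x + c * k x).
Proof.
move=> Lg Lk Pg Pk s t as_ st tb.
have gi := intg_sub as_ tb (L2_intg Lg); have ki := intg_sub as_ tb (L2_intg Lk).
rewrite (igD gi (intgZ c ki)) (igZ c ki) -Pg // -Pk //; ring.
Qed.

Lemma prim_cst a b c : prim a b (fun=> c) (fun=> 0).
Proof. by move=> s t _ st _; rewrite subrr ig_cst // mul0r. Qed.

Definition step c x : R := (x < c)%R%:R.

Lemma L2_step a b c : L2 a b (step c).
Proof.
apply: (L2_bounded (M := 1)); last by move=> x _; rewrite /step; case: ltP; rewrite ?normr1 ?normr0.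
apply: measurable_funTS.
rewrite (_ : step c = fun x => if x < c then 1 else 0); last by apply/funext => x; rewrite /step; case: ltP.
by apply: measurable_fun_ifT => //; exact: measurable_fun_ltr.
Qed.

Lemma ig_step_mul a b c g : a <= c -> c <= b -> intg a b g ->
  ig a b (fun x => g x * step c x) = ig a c g.
Proof.
move=> ac cb gi.
have i1 : intg a c (fun x => g x * step c x).
  by apply: eq_intg (intg_sub (lexx _) cb gi) => x /andP[_ xc]; rewrite /step xc mulr1.
have i2 : intg c b (fun x => g x * step c x).
  by apply: eq_intg (intg_cst c b 0) => x /andP[cx _]; rewrite /step ltNge cx mulr0.
have i : intg a b (fun x => g x * step c x).
  apply: intg_le (intg_norm gi).
    apply: measurable_funM; first exact: intg_measurable.
    by case: (L2_step a b c).
  by move=> x _; rewrite normrM /step; case: ltP => _; rewrite ?normr1 ?normr0 ?mulr1 ?mulr0.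
rewrite (ig_split ac cb i) [X in _ + X](@ig_eq0 _ c b) //; last first.
  by move=> x /andP[cx _]; rewrite /step ltNge cx mulr0.
by rewrite addr0; apply: eq_ig => x /andP[_ xc]; rewrite /step xc mulr1.
Qed.

Lemma prim_min a b c : prim a b (fun x => Num.min x c) (step c).
Proof.
move=> s t as_ st tb.
have one u v g : intg u v g -> ig u v g = ig u v (fun x => 1 * g x).
  by move=> _; apply: eq_ig => x _; rewrite mul1r.
have [tc|ct] := leP t c.
  have -> : Num.min s c = s by rewrite min_l // (le_trans st).
  rewrite (@eq_ig _ s t (step c) (fun=> 1)) ?ig_cst // ?mul1r //.
  by move=> x /andP[_ xt]; rewrite /step (lt_le_trans xt tc).
have [cs|sc] := leP c s.
  by rewrite subrr ig_eq0 // => x /andP[sx _]; rewrite /step ltNge (le_trans cs).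
rewrite one; last exact/L2_intg/L2_step.
by rewrite (ig_step_mul (ltW sc) (ltW ct) (intg_cst _ _ _)) ig_cst ?mul1r // ltW.
Qed.

Implicit Type qs : seq (R * R).

(** A pair [q] lowers the slope by [q.1] at the point [q.2]. In this encoding the derivative is a
    sum of steps, and integrating a derivative against a step gives a difference of two values. *)
Definition pwl qs c t : R := c + \sum_(q <- qs) q.1 * Num.min t q.2.
Definition pws qs t : R := \sum_(q <- qs) q.1 * step q.2 t.

Lemma continuous_pwl qs c : continuous (pwl qs c).
Proof.
move=> x; apply: cvgD; first exact: cvg_cst.
elim: qs => [|q qs IH]; first by under eq_fun do rewrite big_nil; rewrite big_nil; exact: cvg_cst.
under eq_fun do rewrite big_cons; rewrite big_cons.
apply: cvgD => //; apply: cvgM; first exact: cvg_cst.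
have cm : continuous (fun y : R => Num.min y q.2).
  move=> y; apply: (@continuous_min _ _ (fun y => y) (cst q.2)); [exact: cvg_id|exact: cvg_cst].
exact: cm.
Qed.

Lemma pwl_prim a b qs c : L2 a b (pws qs) /\ prim a b (pwl qs c) (pws qs).
Proof.
elim: qs => [|q qs [L P]].
  rewrite (_ : pws [::] = cst 0); last by apply/funext => x; rewrite /pws big_nil.
  rewrite (_ : pwl [::] c = cst c); last by apply/funext => x; rewrite /pwl big_nil addr0.
  by split; [exact: L2_cst|exact: prim_cst].
have -> : pws (q :: qs) = fun x => pws qs x + q.1 * step q.2 x.
  by apply/funext => x; rewrite /pws big_cons addrC.
have -> : pwl (q :: qs) c = fun x => pwl qs c x + q.1 * Num.min x q.2.
  by apply/funext => x; rewrite /pwl big_cons; ring.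
have Ls := L2_step a b q.2.
by split; [exact: L2_axpy|exact: (prim_axpy q.1 L Ls P (@prim_min a b q.2))].
Qed.

Lemma ig_pws l f g qs : L2 0 l g -> prim 0 l f g ->
  (forall q, q \in qs -> 0 <= q.2 <= l) ->
  ig 0 l (fun x => g x * pws qs x) = \sum_(q <- qs) q.1 * (f q.2 - f 0).
Proof.
move=> Lg Pg; elim: qs => [|q qs IH] qI.
  rewrite big_nil (@eq_ig _ _ _ _ (fun x => 0 * g x)); last first.
    by move=> x _; rewrite /pws big_nil mulr0 mul0r.
  by rewrite igZ ?mul0r //; exact: L2_intg.
have /andP[q0 ql] := qI q (mem_head _ _).
rewrite big_cons -IH; last by move=> r rq; apply: qI; rewrite inE rq orbT.
have i1 := intg_mul Lg (L2_step 0 l q.2).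
have i2 := intg_mul Lg (pwl_prim 0 l qs 0).1.
rewrite (Pg 0 q.2 (lexx _) q0 ql) -(ig_step_mul q0 ql (L2_intg Lg)) -(igZ _ i1).
rewrite -(igD (intgZ q.1 i1) i2).
by apply: eq_ig => x _; rewrite /pws big_cons; ring.
Qed.

(* The first variation of the Dirichlet energy in a piecewise linear direction
   only involves the values of [f] at the break points. *)
Lemma Den_pwl_expand l f qs c e : 0 < l -> continuous f -> (Den l f < +oo)%E ->
  (forall q, q \in qs -> 0 <= q.2 <= l) ->
  Den l (fun t => f t + e * pwl qs c t) =
    (Den l f + (2 * e * \sum_(q <- qs) q.1 * (f q.2 - f 0))%:E
     + (e ^+ 2)%:E * Den l (pwl qs c))%E.
Proof.
move=> l0 cf fy qI; have [g [_ Lg Pg ->]] := Den_prim l0 cf fy.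
have [Lk Pk] := pwl_prim 0 l qs c.
rewrite (prim_Den l0 (@continuous_pwl qs c) Lk Pk).
rewrite (prim_Den l0 _ (L2_axpy e Lg Lk) (prim_axpy e Lg Lk Pg Pk)); last first.
  move=> x; apply: cvgD; first exact: cf.
  by apply: cvgM; [exact: cvg_cst|exact: continuous_pwl].
by rewrite ig_axpy_sqr // (ig_pws Lg Pg qI) -EFinM -!EFinD.
Qed.

Lemma Den_pwl_lty l qs c : 0 < l -> (Den l (pwl qs c) < +oo)%E.
Proof.
move=> l0; have [Lk Pk] := pwl_prim 0 l qs c.
by rewrite (prim_Den l0 (@continuous_pwl qs c) Lk Pk) ltry.
Qed.

End DirichletEnergy.

(** * Energies on the graph *)

Section ESum.
Variables (R : realType) (T : choiceType).
Implicit Types (a b : T -> \bar R).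

Lemma esumZ (c : R) a : 0 <= c -> (forall i, (0 <= a i)%E) ->
  (\esum_(i in setT) (c%:E * a i) = c%:E * \esum_(i in setT) a i)%E.
Proof.
rewrite le_eqVlt => /predU1P[<-|c0] a0.
  by rewrite mul0e esum1 // => i _; rewrite mul0e.
have H (d : R) b : 0 < d -> (forall i, 0 <= b i)%E ->
    (\esum_(i in setT) (d%:E * b i) <= d%:E * \esum_(i in setT) b i)%E.
  move=> d0 b0; apply: ge_ereal_sup => _ [A [finA _] <-].
  rewrite !fsbig_finite // -ge0_sume_distrr // -fsbig_finite //.
  rewrite lee_pmul2l //; apply: ereal_sup_ubound; exists A => //.
apply/eqP; rewrite eq_le H //= -(@lee_pmul2l _ (c^-1)%:E) ?lte_fin ?invr_gt0 // muleA -EFinM.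
rewrite mulVf ?gt_eqF // mul1e.
apply: (le_trans _ (H c^-1 (fun i => c%:E * a i)%E _ _)); rewrite ?invr_gt0 //.
  by apply: le_esum => i _; rewrite muleA -EFinM mulVf ?gt_eqF // mul1e.
by move=> i; rewrite mule_ge0 // lee_fin ltW.
Qed.

Lemma sum_le_esum (s : seq T) a : uniq s -> (forall i, 0 <= a i)%E ->
  (\sum_(i <- s) a i <= \esum_(i in setT) a i)%E.
Proof.
move=> us a0; apply: esum_ge; exists [set` s]; first by split.
have P : perm_eq s (fset_set [set` s]).
  by apply: uniq_perm => // i; rewrite in_fset_set // mem_setE.
by rewrite fsbig_finite //= (perm_big _ P).
Qed.

Lemma esum_le_sums a (C : \bar R) : (forall s : seq T, uniq s -> (\sum_(i <- s) a i <= C)%E) ->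
  (\esum_(i in setT) a i <= C)%E.
Proof.
move=> H; apply: ge_ereal_sup => _ [A [finA _] <-].
by rewrite fsbig_finite //; apply: H.
Qed.

Lemma le_esum1 a i : (forall i, 0 <= a i)%E -> (a i <= \esum_(j in setT) a j)%E.
Proof. by move=> a0; have := @sum_le_esum [:: i] a isT a0; rewrite big_seq1. Qed.

(** Markov's inequality: infinitely many terms above [c] would exceed any finite total. *)
Lemma esum_lt_finite a (c : R) : (forall i, 0 <= a i)%E -> 0 < c ->
  (\esum_(i in setT) a i < +oo)%E -> finite_set [set i | (c%:E <= a i)%E].
Proof.
move=> a0 c0 ay; apply: contrapT => inf.
have [C EC] : exists C, \esum_(i in setT) a i = C%:E.
  by exists (fine (\esum_(i in setT) a i)); rewrite fineK // ge0_fin_numE // esum_ge0.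
have C0 : 0 <= C by rewrite -lee_fin -EC esum_ge0.
pose n := (Num.truncn (C / c)).+1.
have [A Asub nA] := infinite_set_fset n inf.
have := @sum_le_esum A a (fset_uniq A) a0; rewrite EC.
apply/negP; rewrite -ltNge.
apply: (@lt_le_trans _ _ (\sum_(i <- A) c%:E)%E); last first.
  rewrite big_seq [leRHS]big_seq; apply: lee_sum => i iA; exact: Asub.
rewrite sumEFin lte_fin big_const_seq count_predT iter_addr_0.
rewrite -mulr_natr mulrC -ltr_pdivrMr //; apply: lt_le_trans (truncnS_gt _) _.
by rewrite ler_nat.
Qed.

End ESum.

Section EdgeEnergy.
Variable R : realType.
Local Notation mu := (@lebesgue_measure R).
Implicit Types (l s t c : R) (f h : R -> R).

Lemma ig_rev l f : 0 < l -> continuous f -> ig 0 l (fun t => f (l - t)) = ig 0 l f.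
Proof.
move=> l0 cf; pose F := fun x : R => l - x.
have dF (x : R) : is_derive x (1 : R) F (-1).
  have -> : -1 = 0 - 1 :> R by rewrite sub0r.
  by apply: is_deriveB.
have DF : F^`()%classic = cst (-1) by apply/funext => x; rewrite derive1E; exact: derive_val.
have cF : continuous F by move=> x; apply: cvgB; [exact: cvg_cst|exact: cvg_id].
have cfF : continuous (f \o F) by move=> x; apply: continuous_comp; [exact: cF|exact: cf].
have := @integration_by_substitution_decreasing R F f 0 l (ltW l0).
rewrite DF.
have H1 : {in `[0, l] &, {homo F : x y /~ (x < y)%R}} by move=> x y _ _ xy; rewrite /F ltrD2l ltrN2.
have H2 : {in `]0, l[, continuous (cst (-1) : R -> R)} by move=> x _; exact: cvg_cst.
have H3 : cvg ((cst (-1) : R -> R) x @[x --> 0^'+]) by exact: is_cvg_cst.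
have H4 : cvg ((cst (-1) : R -> R) x @[x --> l^'-]) by exact: is_cvg_cst.
have H5 : derivable_oo_LRcontinuous F 0 l.
  split; [move=> x _; have [] := dF x; by []|exact: cvg_at_right_filter (cF 0)|exact: cvg_at_left_filter (cF l)].
have H6 : {within `[F l, F 0], continuous f} by exact: continuous_subspaceT.
move=> /(_ H1 H2 H3 H4 H5 H6); rewrite {1}/F subrr {1}/F subr0 => E.
apply: EFin_inj; rewrite -!EFin_ig; [|exact: intg_continuous|exact: intg_continuous].
have m (g : R -> R) : continuous g -> measurable_fun `[0, l[ (fun x => (g x)%:E).
  by move=> cg; apply: measurable_funTS; apply/measurable_EFinP; exact: continuous_measurable_fun.
rewrite !integral_itv_bndo_bndc; [|exact: m|exact: m].
rewrite E; apply: eq_integral => x _ /=.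
by rewrite /GRing.mul /= opprK mulr1.
Qed.

Lemma cvg_dyE_Den l f : 0 < l -> (dyE n 0 l f)%:E @[n --> \oo] --> Den l f.
Proof.
move=> l0; apply: ereal_nondecreasing_cvgn => n m nm.
by rewrite lee_fin dyE_mono.
Qed.

(** Two weights, so that [(1, lam)], [(1, 0)] and [(0, 1)] share all lemmas; [qe] is the version of
    finite depth, which is a real number. *)
Definition ee al be l f : \bar R := (al%:E * Den l f + (be * ig 0 l (fun t => f t ^+ 2))%:E)%E.
Definition qe al be k l f : R := al * dyE k 0 l f + be * ig 0 l (fun t => f t ^+ 2).

Section NonnegativeWeights.
Variables (al be : R).
Hypotheses (al0 : 0 <= al) (be0 : 0 <= be).

Lemma igsq_ge0 l f : 0 <= ig 0 l (fun t => f t ^+ 2).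
Proof. by apply: ig_ge0 => x _; exact: sqr_ge0. Qed.

Lemma ee_ge0 l f : 0 < l -> (0 <= ee al be l f)%E.
Proof.
by move=> l0; rewrite adde_ge0 ?mule_ge0 ?lee_fin ?Den_ge0 // mulr_ge0 // igsq_ge0.
Qed.

Lemma cvg_qe_ee l f : 0 < l -> (qe al be k l f)%:E @[k --> \oo] --> ee al be l f.
Proof.
move=> l0; rewrite /qe /ee; under eq_fun do rewrite EFinD EFinM.
apply: cvgeD; last exact: cvg_cst.
  by rewrite fin_num_adde_defl.
by apply: cvgeZl => //; exact: cvg_dyE_Den.
Qed.

Lemma qe_le_ee k l f : 0 < l -> ((qe al be k l f)%:E <= ee al be l f)%E.
Proof.
move=> l0; rewrite /qe EFinD leeD2r // EFinM.
by rewrite lee_wpmul2l ?lee_fin // dyE_le_Den.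
Qed.

Lemma cvg_comb l (c d : R) f h : 0 < l -> 0 <= c -> 0 <= d ->
  (c * qe al be k l f + d * qe al be k l h)%:E @[k --> \oo] -->
  (c%:E * ee al be l f + d%:E * ee al be l h)%E.
Proof.
move=> l0 c0 d0; under eq_fun do rewrite EFinD !EFinM.
apply: cvgeD; last by apply: cvgeZl => //; exact: cvg_qe_ee.
  by apply: ge0_adde_def; rewrite inE mule_ge0 ?ee_ge0 // lee_fin.
by apply: cvgeZl => //; exact: cvg_qe_ee.
Qed.

(** Inequalities between energies are proved at each finite depth, where all terms are real, and
    pass to the limit; identities are obtained by using this in both directions. *)
Lemma ee_comb_le l (c d c' d' : R) f h f' h' : 0 < l ->
  0 <= c -> 0 <= d -> 0 <= c' -> 0 <= d' ->
  (forall k, c * qe al be k l f + d * qe al be k l h <=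
             c' * qe al be k l f' + d' * qe al be k l h') ->
  (c%:E * ee al be l f + d%:E * ee al be l h <=
   c'%:E * ee al be l f' + d'%:E * ee al be l h')%E.
Proof.
move=> l0 c0 d0 c'0 d'0 H.
have A := @cvg_comb l c d f h l0 c0 d0; have B := @cvg_comb l c' d' f' h' l0 c'0 d'0.
rewrite -(cvg_lim _ A) // -(cvg_lim _ B) //; apply: lee_lim.
- by apply/cvg_ex; eexists; exact: A.
- by apply/cvg_ex; eexists; exact: B.
- by apply: nearW => k; rewrite lee_fin.
Qed.

Lemma ee_le l (c c' : R) f h : 0 < l -> 0 <= c -> 0 <= c' ->
  (forall k, c * qe al be k l f <= c' * qe al be k l h) ->
  (c%:E * ee al be l f <= c'%:E * ee al be l h)%E.
Proof.
move=> l0 c0 c'0 fh.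
have := @ee_comb_le l c 0 c' 0 f f h h l0 c0 (lexx 0) c'0 (lexx 0).
by rewrite !mul0e !adde0; apply => k; rewrite !mul0r !addr0.
Qed.

Lemma ee_parallelogram l s f h : 0 < l -> 0 < s -> continuous f -> continuous h ->
  (1%:E * ee al be l (fun t => f t - h t)%R + s^-1%:E * ee al be l (fun t => f t + s * h t)%R =
  (1 + s^-1)%:E * ee al be l f + (1 + s)%:E * ee al be l h)%E.
Proof.
move=> l0 s0 cf ch; have si0 : 0 <= s^-1 by rewrite invr_ge0 ltW.
have E k : 1 * qe al be k l (fun t => f t - h t) + s^-1 * qe al be k l (fun t => f t + s * h t) =
    (1 + s^-1) * qe al be k l f + (1 + s) * qe al be k l h.
  have Lf : L2 0 l f by exact: L2_continuous.
  have Lh : L2 0 l h by exact: L2_continuous.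
  have D := dyE_parallelogram k 0 l f h s0.
  have A1 := ig_axpy_sqr (-1) Lf Lh; have A2 := ig_axpy_sqr s Lf Lh.
  have A3 : ig 0 l (fun t => (f t - h t) ^+ 2) = ig 0 l (fun x => (f x + -1 * h x) ^+ 2).
    by apply: eq_ig => x _; rewrite mulN1r.
  rewrite /qe A3 A1 A2.
  transitivity (al * (dyE k 0 l (fun t => f t - h t) + s^-1 * dyE k 0 l (fun t => f t + s * h t))
    + be * (ig 0 l (fun x => f x ^+ 2) * (1 + s^-1) + ig 0 l (fun x => h x ^+ 2) * (1 + s^-1 * s * s)
         + 2 * ig 0 l (fun x => f x * h x) * (s^-1 * s - 1))); first by ring.
  by rewrite D mulVf ?gt_eqF //; ring.
apply/eqP; rewrite eq_le; apply/andP; split.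
  by apply: ee_comb_le => //; [rewrite addr_ge0|rewrite addr_ge0 // ltW|move=> k; rewrite E].
by apply: ee_comb_le => //; [rewrite addr_ge0|rewrite addr_ge0 // ltW|move=> k; rewrite E].
Qed.

Lemma ee_scale l c f : 0 < l -> continuous f ->
  ee al be l (fun t => c * f t) = ((c ^+ 2)%:E * ee al be l f)%E.
Proof.
move=> l0 cf.
have E k : 1 * qe al be k l (fun t => c * f t) = c ^+ 2 * qe al be k l f.
  rewrite mul1r /qe dyE_scale mulrDr; congr (_ + _); first by ring.
  have [_ fi] := L2_continuous 0 l cf.
  by rewrite mulrCA -(igZ _ fi); congr (_ * _); apply: eq_ig => x _; rewrite exprMn.
rewrite -[LHS]mul1e; apply/eqP; rewrite eq_le; apply/andP; split.
  by apply: ee_le => // [|k]; rewrite ?sqr_ge0 ?E.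
by apply: ee_le => // [|k]; rewrite ?sqr_ge0 ?E.
Qed.

Lemma ee_contract l f h : 0 < l -> continuous f -> continuous h ->
  (forall s t, 0 <= s <= l -> 0 <= t <= l -> `|f s - f t| <= `|h s - h t|) ->
  (forall t, 0 <= t <= l -> `|f t| <= `|h t|) ->
  (ee al be l f <= ee al be l h)%E.
Proof.
move=> l0 cf ch H1 H2; rewrite -[leLHS]mul1e -[leRHS]mul1e.
apply: ee_le => // k; rewrite !mul1r /qe lerD // ler_wpM2l //; first exact: dyE_contract.
have [_ fi] := L2_continuous 0 l cf; have [_ hi] := L2_continuous 0 l ch.
apply: le_ig => // x /andP[x0 xl].
rewrite -(real_normK (num_real (f x))) -(real_normK (num_real (h x))).
by rewrite lerXn2r ?nnegrE // H2 // x0 ltW.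
Qed.

Lemma eq_ee l f h : 0 < l -> (forall t, 0 <= t <= l -> f t = h t) ->
  ee al be l f = ee al be l h.
Proof.
move=> l0 fh; rewrite /ee (@eq_ig _ _ _ _ (fun t => h t ^+ 2)); last first.
  by move=> x /andP[x0 xl]; rewrite fh // x0 ltW.
congr (_ * _ + _)%E; congr ereal_sup; apply/seteqP; split=> [_ [n _ <-]|_ [n _ <-]];
  exists n => //; congr EFin; apply: eq_dyE => // t tI; by rewrite fh.
Qed.

Lemma continuous_posp f : continuous f -> continuous (fun t => Num.max (f t) 0).
Proof. by move=> cf x; apply: (@continuous_max _ _ f (cst 0)); [exact: cf|exact: cvg_cst]. Qed.

Lemma continuous_negp f : continuous f -> continuous (fun t => Num.min (f t) 0).
Proof. by move=> cf x; apply: (@continuous_min _ _ f (cst 0)); [exact: cf|exact: cvg_cst]. Qed.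

Lemma ee_pos_neg l f : 0 < l -> continuous f ->
  (ee al be l (fun t => Num.max (f t) 0%R) + ee al be l (fun t => Num.min (f t) 0%R)
   <= ee al be l f)%E.
Proof.
move=> l0 cf; have := @ee_comb_le l 1 1 1 0 (fun t => Num.max (f t) 0)
  (fun t => Num.min (f t) 0) f f l0 ler01 ler01 ler01 (lexx 0).
rewrite mul0e adde0 !mul1e; apply => k; rewrite !mul1r mul0r addr0 /qe addrACA -!mulrDr.
rewrite lerD // ler_wpM2l //; first exact: dyE_pos_neg.
have [_ pi] := L2_continuous 0 l (continuous_posp cf).
have [_ ni] := L2_continuous 0 l (continuous_negp cf).
rewrite -(igD pi ni) le_eqVlt; apply/orP; left; apply/eqP; apply: eq_ig => x _.
by rewrite /Num.max /Num.min; case: ifPn => H; ring.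
Qed.

Lemma ee_rev l f : 0 < l -> continuous f -> ee al be l (fun t => f (l - t)) = ee al be l f.
Proof.
move=> l0 cf.
have cf2 : continuous (fun t => f t ^+ 2) by move=> x; apply: cvg_sqr; exact: cf.
have E k : 1 * qe al be k l (fun t => f (l - t)) = 1 * qe al be k l f.
  by rewrite !mul1r /qe dyE_rev subrr subr0 (ig_rev l0 cf2).
rewrite -[LHS]mul1e -[RHS]mul1e; apply/eqP; rewrite eq_le; apply/andP; split;
  by apply: ee_le => // k; rewrite E.
Qed.

End NonnegativeWeights.
End EdgeEnergy.

(** * Edge parametrizations and functions glued from edges *)

Section GraphPoints.
Variables (R : realType) (G : metricGraph R).
Hypothesis bdd : forall e : edge G, (len e < +oo)%E.
Implicit Types (e : edge G) (v : vertex G) (t : R) (x : gpoint G) (u : gpoint G -> R).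

Definition elen e : R := fine (len e).

Lemma len_elen e : len e = (elen e)%:E.
Proof. by rewrite /elen fineK // ge0_fin_numE // ltW // len_gt0. Qed.

Lemma elen_gt0 e : 0 < elen e.
Proof. by rewrite -lte_fin -len_elen len_gt0. Qed.

Lemma elen_lb : class_G G -> exists2 l0, 0 < l0 & forall e, l0 <= elen e.
Proof.
case=> _ _ _ _; set i := ereal_inf _ => i0.
have H e : (i <= (elen e)%:E)%E by apply: ereal_inf_lbound; exists e => //; exact: len_elen.
case: i i0 H => [r r0 H|_ H|//]; last by exists 1 => // e; have := H e; rewrite leye_eq.
by exists r => // e; have := H e; rewrite lee_fin.
Qed.

Lemma edge_itvE e : edge_itv e = `]0, elen e[%classic.
Proof. by apply/seteqP; split=> t; rewrite /edge_itv /= in_itv/= len_elen lte_fin. Qed.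

Definition vhead e : vertex G := odflt (src e) (tgt e).

Lemma tgt_head e : tgt e = Some (vhead e).
Proof.
rewrite /vhead; case E : (tgt e) => [//|]; have := bdd e.
by rewrite (tgt_None e).1.
Qed.

Lemma ep_src e t : t <= 0 -> edge_point e t = Vert (src e).
Proof.
move=> t0; rewrite /edge_point insubF; first by rewrite t0.
by rewrite ltNge t0.
Qed.

Lemma ep_head e t : elen e <= t -> edge_point e t = Vert (vhead e).
Proof.
move=> lt; rewrite /edge_point insubF; last by rewrite len_elen lte_fin [t < _]ltNge lt andbF.
by rewrite leNgt (lt_le_trans (elen_gt0 e) lt).
Qed.

Lemma ep_in e t (H : (0 < t) && (t%:E < len e)%E) : edge_point e t = Inner e (exist _ t H).
Proof.
rewrite /edge_point; case: insubP => [s _ E|]; last by rewrite H.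
by congr Inner; exact: val_inj.
Qed.

Lemma ep_inner e (s : {t : R | (0 < t) && (t%:E < len e)%E}) :
  Inner e s = edge_point e (val s).
Proof. by case: s => t H; rewrite /= (ep_in H). Qed.

Lemma in_open_edge e t : 0 < t < elen e -> (0 < t) && (t%:E < len e)%E.
Proof. by rewrite len_elen lte_fin. Qed.

(** The retraction of the line onto [[0, l]], through which [edge_point] factors. *)
Definition clamp (l t : R) : R := Num.max 0 (Num.min t l).

Lemma clamp_itv l t : 0 < l -> 0 <= clamp l t <= l.
Proof.
by move=> l0; rewrite /clamp; case: (leP t l) => A; [case: (leP 0 t)|case: (leP 0 l)] => B; lra.
Qed.

Lemma clamp_id l t : 0 <= t <= l -> clamp l t = t.
Proof.
by move=> tI; rewrite /clamp; case: (leP t l) => A; [case: (leP 0 t)|case: (leP 0 l)] => B; lra.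
Qed.

Lemma continuous_clamp l : continuous (clamp l).
Proof.
move=> x; apply: (@continuous_max _ _ (cst 0) (fun t => Num.min t l)); first exact: cvg_cst.
by apply: (@continuous_min _ _ (fun t => t) (cst l)); [exact: cvg_id|exact: cvg_cst].
Qed.

Lemma ep_clamp e t : edge_point e t = edge_point e (clamp (elen e) t).
Proof.
have [t0|t0] := leP t 0.
  by rewrite (ep_src e t0) ep_src // /clamp ge_max lexx ge_min t0.
have [lt|tl] := leP (elen e) t; last by rewrite clamp_id // !ltW.
by rewrite (ep_head lt) ep_head // /clamp min_r // le_max lexx orbT.
Qed.

Lemma ep_vert e t v : edge_point e t = Vert v -> src e = v \/ vhead e = v.
Proof.
have [t0|t0] := leP t 0; first by rewrite ep_src // => -[]; left.
have [lt|tl] := leP (elen e) t; first by rewrite ep_head // => -[]; right.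
have H : 0 < t < elen e by rewrite t0.
by rewrite (ep_in (in_open_edge H)).
Qed.

Lemma ep_Inner e t e' s : edge_point e t = Inner e' s -> e = e' /\ t = val s.
Proof.
have [t0|t0] := leP t 0; first by rewrite ep_src.
have [lt|tl] := leP (elen e) t; first by rewrite ep_head.
have H : 0 < t < elen e by rewrite t0.
rewrite (ep_in (in_open_edge H)).
by move=> /(congr1 (fun x => if x is Inner e s then Some (e, val s) else None)) [].
Qed.

(** A vertex without edges would be an open and closed point, yet the graph also contains the points
    of [e0]. *)
Lemma vertex_incident : connected [set: gpoint G] -> edge G -> forall v,
  exists e, src e = v \/ vhead e = v.
Proof.
move=> cG e0 v; apply: contrapT => noe.
have nv e t : edge_point e t <> Vert v by move=> /ep_vert ?; apply: noe; exists e.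
have ov : open [set Vert v : gpoint G].
  move=> e; rewrite (_ : _ @^-1` _ = set0); first exact: open0.
  by apply/seteqP; split=> t //= /nv.
have onv : open (~` [set Vert v : gpoint G]).
  move=> e; rewrite (_ : _ @^-1` _ = setT); first exact: openT.
  by apply/seteqP; split=> t //= _ /nv.
have E : [set Vert v : gpoint G] = setT.
  apply: cG; first by exists (Vert v).
    by exists [set Vert v] => //; rewrite setTI.
  by exists [set Vert v]; rewrite ?setTI // -openC.
have : [set: gpoint G] (edge_point e0 0) by [].
by rewrite -E => /nv.
Qed.

Lemma ep_cover : connected [set: gpoint G] -> edge G -> forall x,
  exists e t, 0 <= t <= elen e /\ x = edge_point e t.
Proof.
move=> cG e0 [v|e s].
  have [e [<-|<-]] := vertex_incident cG e0 v.
    exists e, 0; rewrite lexx ep_src // ltW ?elen_gt0 //.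
  by exists e, (elen e); rewrite lexx ep_head // ltW ?elen_gt0.
exists e, (val s); rewrite ep_inner; split => //.
by case: s => t /=; rewrite len_elen lte_fin => /andP[t0 tl]; rewrite !ltW.
Qed.

Lemma continuous_ep e : continuous (edge_point e : R -> gpoint G).
Proof. by apply/continuousP => A; apply. Qed.

Lemma continuous_on_edge u e : continuous u -> continuous (on_edge u e).
Proof. by move=> cu t; apply: continuous_comp; [exact: continuous_ep|exact: cu]. Qed.

Lemma continuous_graph u : (forall e, continuous (on_edge u e)) -> continuous u.
Proof.
move=> cu; apply/continuousP => A oA.
suff : graph_open (u @^-1` A) by [].
by move=> e; move: (cu e) => /continuousP H; exact: H.
Qed.

Definition edge_glue (fV : vertex G -> R) (fE : edge G -> R -> R) x : R :=
  match x with Vert v => fV v | Inner e s => fE e (val s) end.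

Lemma on_edge_glue fV fE e t : fE e 0 = fV (src e) -> fE e (elen e) = fV (vhead e) ->
  on_edge (edge_glue fV fE) e t = fE e (clamp (elen e) t).
Proof.
move=> f0 fl; rewrite /on_edge ep_clamp; set s := clamp _ _.
have /andP[] := clamp_itv t (elen_gt0 e); rewrite -/s.
rewrite le_eqVlt => /predU1P[<- _|s0]; first by rewrite ep_src //= f0.
rewrite le_eqVlt => /predU1P[->|sl]; first by rewrite ep_head //= fl.
have H : 0 < s < elen e by rewrite s0.
by rewrite (ep_in (in_open_edge H)).
Qed.

Lemma continuous_glue fV fE : (forall e, fE e 0 = fV (src e)) ->
  (forall e, fE e (elen e) = fV (vhead e)) -> (forall e, continuous (fE e)) ->
  continuous (edge_glue fV fE).
Proof.
move=> f0 fl cf; apply: continuous_graph => e.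
rewrite (_ : on_edge _ _ = fE e \o clamp (elen e)); last first.
  by apply/funext => t; rewrite on_edge_glue.
by move=> t; apply: continuous_comp; [exact: continuous_clamp|exact: cf].
Qed.

End GraphPoints.

(** * The lattice action on vertices and edges *)

Section PeriodicGraphs.
Variables (R : realType) (G : metricGraph R) (n : nat).
Variable act : 'rV[int]_n -> gpoint G -> gpoint G.
Hypothesis per : periodic_graph act.
Hypothesis cG : class_G G.
Implicit Types (e : edge G) (v : vertex G) (t : R) (x : gpoint G) (k : 'rV[int]_n).

Lemma per_len e : (len e < +oo)%E.
Proof. exact: per_bounded per e. Qed.

Let bdd := per_len.

Lemma per_edge : inhabited (edge G).
Proof.
apply: contrapT => H; apply: (per_edges per).
by rewrite (_ : [set: _] = set0) //; apply/seteqP; split=> e //= _; apply: H; constructor.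
Qed.

Lemma actK k : cancel (act k) (act (- k)).
Proof. by move=> x; rewrite -(per_actD per) addNr (per_act0 per). Qed.

Lemma actVK k : cancel (act (- k)) (act k).
Proof. by move=> x; rewrite -(per_actD per) addrN (per_act0 per). Qed.

Lemma open_edge_ep e t : 0 < t < elen e -> open_edge e (edge_point e t).
Proof. by move=> H; rewrite (ep_in (in_open_edge bdd H)); eexists; reflexivity. Qed.

Lemma open_edge_inj e e' : open_edge e = open_edge e' -> e = e'.
Proof.
move=> E; have H : 0 < elen e / 2 < elen e by have := elen_gt0 bdd e; lra.
have := open_edge_ep H.
by rewrite E => -[s] /(ep_Inner bdd)[].
Qed.

Lemma incidentE v e : incident v e <-> v = src e \/ v = vhead e.
Proof.
rewrite /incident (tgt_head bdd); split=> [[->|[->]]|[->|->]]; by [left|right].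
Qed.

(* The homeomorphism [act k] need not be isometric on the edges; [gshift] is the
   isometry inducing the same graph automorphism. *)
Record gshift k := GShift {
  shiftV : vertex G -> vertex G;
  shiftE : edge G -> edge G;
  flip : edge G -> bool;
  shiftP : gpoint G -> gpoint G;
  shiftV_act : forall v, act k (Vert v) = Vert (shiftV v);
  shiftE_act : forall e, act k @` open_edge e = open_edge (shiftE e);
  shiftE_bij : set_bij setT setT shiftE;
  shiftE_len : forall e, elen (shiftE e) = elen e;
  shift_src : forall e, src (shiftE e) = shiftV (src e) \/ src (shiftE e) = shiftV (vhead e);
  shiftP_vert : forall v, shiftP (Vert v) = Vert (shiftV v);
  shiftP_edge : forall e t, shiftP (edge_point e t) =
    edge_point (shiftE e) (if flip e then elen (shiftE e) - t else t) }.

Lemma shift_exists k : inhabited (gshift k).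
Proof.
have [fV [fE [fVP fEP inc flen]]] := per_graph per k.
have [gV [gE [gVP gEP _ _]]] := per_graph per (- k).
have fgV v : fV (gV v) = v.
  by have := actVK k (Vert v); rewrite gVP fVP => -[].
have fVinj : injective fV.
  move=> v w E; have := congr1 (act (- k)) (fVP v); rewrite E -fVP !actK.
  by move=> [].
have fgE e : fE (gE e) = e.
  apply: open_edge_inj; rewrite -fEP -gEP image_comp.
  rewrite (_ : act k \o act (- k) = id) ?image_id //.
  by apply/funext => x; exact: actVK.
have fEinj : injective fE.
  move=> e e' E; apply: open_edge_inj.
  have : act (- k) @` (act k @` open_edge e) = act (- k) @` (act k @` open_edge e').
    by rewrite !fEP E.
  rewrite !image_comp (_ : act (- k) \o act k = id) ?image_id //.
  by apply/funext => x; exact: actK.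
have fElen e : elen (fE e) = elen e by rewrite /elen flen.
have inc' e w : (w = src (fE e) \/ w = vhead (fE e)) <->
    (w = fV (src e) \/ w = fV (vhead e)).
  rewrite -incidentE -{1}(fgV w) -inc incidentE; split=> -[H|H].
  - by left; rewrite -H fgV.
  - by right; rewrite -H fgV.
  - by left; apply: fVinj; rewrite fgV.
  - by right; apply: fVinj; rewrite fgV.
(* Incidence only says that the ends of [e] go to the ends of [fE e] in some order; [fl] records
   whether they are exchanged. A loop is never flipped. *)
pose fl e := fV (src e) != src (fE e).
have ends_e e : if fl e then fV (src e) = vhead (fE e) /\ fV (vhead e) = src (fE e)
    else fV (src e) = src (fE e) /\ fV (vhead e) = vhead (fE e).
  rewrite /fl; case: eqVneq => /= [E|N].
    split => //; have := (inc' e (fV (vhead e))).2 (or_intror erefl).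
    case=> // H; have := (inc' e (vhead (fE e))).1 (or_intror erefl).
    by case=> -> //; rewrite E -H.
  split.
    by have := (inc' e (fV (src e))).2 (or_introl erefl); case=> // /eqP; rewrite (negPf N).
  by have := (inc' e (src (fE e))).1 (or_introl erefl); case=> // /esym /eqP; rewrite (negPf N).
pose T x := match x with Vert v => Vert (fV v)
  | Inner e s => edge_point (fE e) (if fl e then elen (fE e) - val s else val s) end.
constructor; apply: (@GShift k fV fE fl T) => //.
- by split=> // [e e' _ _ /fEinj|e _] //; exists (gE e); rewrite ?fgE.
- move=> e; have := (inc' e (src (fE e))).1 (or_introl erefl).
  by case=> ->; [left|right].
- move=> e t; have l0 := elen_gt0 bdd e; have := ends_e e.
  have [t0|t0] := leP t 0.
    rewrite (ep_src e t0) /=; case: ifP => _ [-> _].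
      by rewrite ep_head //; lra.
    by rewrite ep_src.
  have [lt|tl] := leP (elen e) t.
    rewrite (ep_head bdd lt) /=; case: ifP => _ [_ ->].
      by rewrite ep_src // fElen; lra.
    by rewrite ep_head // fElen.
  have H : 0 < t < elen e by rewrite t0.
  by rewrite (ep_in (in_open_edge bdd H)).
Qed.

Lemma shift_headsrc k (S : gshift k) e :
  exists w, (w = src e \/ w = vhead e) /\ src (shiftE S e) = shiftV S w.
Proof. by case: (shift_src S e) => ->; [exists (src e)|exists (vhead e)]; split => //; [left|right]. Qed.

(** With one inner point of [W] chosen on each such edge, every set of chosen points is closed, so
    infinitely many of them could not cluster in [W]. *)
Lemma finite_edges_compact (W : set (gpoint G)) : compact W ->
  finite_set [set e | exists2 t, 0 < t < elen e & W (edge_point e t)].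
Proof.
set F := [set e | _] => cW.
have [c cP] : exists c : edge G -> R, forall e, F e ->
    0 < c e < elen e /\ W (edge_point e (c e)).
  have H e : exists t, F e -> 0 < t < elen e /\ W (edge_point e t).
    by have [[t tI Wt]|nF] := pselect (F e); [exists t|exists 0].
  by have [c cP] := choice H; exists c.
have cI e e' t : F e' -> edge_point e t = edge_point e' (c e') -> e = e' /\ t = c e'.
  move=> /cP[/(in_open_edge bdd) H _].
  by rewrite [RHS](ep_in H) => /(ep_Inner bdd)[-> ->].
have oU (P : set (edge G)) : P `<=` F ->
    open (~` [set x | exists2 e', P e' & x = edge_point e' (c e')]).
  move=> PF; set U := ~` _; suff : graph_open U by [].
  move=> e1; rewrite /U preimage_setC openC.
  set S : set R := (X in closed X).
  have [Pe1|N] := pselect (P e1).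
    have -> : S = [set c e1]; last exact: closed_eq.
    apply/seteqP; split=> t /=; first by case=> e' Pe' /(cI _ _ _ (PF _ Pe'))[-> ->].
    by move=> ->; exists e1.
  have -> : S = set0; last exact: closed0.
  apply/seteqP; split=> t //= [e' Pe' /(cI _ _ _ (PF _ Pe'))[E _]].
  by apply: N; rewrite E.
apply: contrapT => infF.
pose X e := edge_point e (c e).
(* The cofinite filter on the chosen points. *)
pose Fil : set_system (gpoint G) := [set A | finite_set [set e | F e /\ ~ A (X e)]].
have PFil : ProperFilter Fil.
  apply: Build_ProperFilter; last constructor.
  - by move=> fin0; apply: infF; apply: sub_finite_set fin0 => e Fe; split.
  - by rewrite /Fil /= (_ : [set e | _] = set0) //; apply/seteqP; split=> e // [_]; apply.
  - move=> A B fA fB; have : finite_set ([set e | F e /\ ~ A (X e)] `|` [set e | F e /\ ~ B (X e)]).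
      by rewrite finite_setU.
    apply: sub_finite_set => e [Fe /not_andP[nA|nB]]; [by left|by right].
  - move=> A B AB; apply: sub_finite_set => e [Fe nB]; split => // AX; exact/nB/AB.
have FW : Fil W.
  rewrite /Fil /= (_ : [set e | _] = set0) //; apply/seteqP; split=> e // [Fe]; apply.
  by case: (cP _ Fe).
have [p [Wp clp]] := cW Fil PFil FW.
(* A neighbourhood of [p] that contains no chosen point except possibly [p] itself. *)
pose U := ~` [set x | exists2 e', F e' /\ X e' <> p & x = edge_point e' (c e')].
have Up : nbhs p U.
  apply: open_nbhs_nbhs; split; first by apply: oU => e [].
  by move=> [e [_ ne] pe]; exact: ne.
have [|x [[e [Fe nep] xe] Ux]] :=
    clp [set x | exists2 e', F e' /\ X e' <> p & x = edge_point e' (c e')] U _ Up.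
  rewrite /Fil /=; have [[e0 Fe0 e0p]|N] := pselect (exists2 e0, F e0 & X e0 = p).
    apply: sub_finite_set (finite_set1 e0) => e [Fe nX] /=.
    have ep : X e = p by apply: contrapT => ne; apply: nX; exists e.
    by move: ep; rewrite -e0p => /(cI _ _ _ Fe0)[].
  rewrite (_ : [set e | _] = set0) //; apply/seteqP; split=> e // [Fe]; apply.
  by exists e => //; split => // ep; apply: N; exists e.
by apply: Ux; exists e.
Qed.

(** The midpoint of an edge lies in a copy of [W], so it is a translate of an inner point in [W],
    and only finitely many edges have one. *)
Lemma edge_orbits : exists F : set (edge G), finite_set F /\
  forall e, exists k (S : gshift k) e', F e' /\ shiftE S e' = e.
Proof.
have [W [cW Wcov _]] := per_cocompact per.
exists [set e | exists2 t, 0 < t < elen e & W (edge_point e t)]; split.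
  exact: finite_edges_compact.
move=> e; have H : 0 < elen e / 2 < elen e by have := elen_gt0 bdd e; lra.
have : [set: gpoint G] (edge_point e (elen e / 2)) by [].
rewrite -Wcov => -[k _ [w Ww wE]].
have [S'] := shift_exists (- k); have [S] := shift_exists k.
have oe := open_edge_ep H.
have : open_edge (shiftE S' e) w.
  by rewrite -(shiftE_act S'); exists (edge_point e (elen e / 2)); rewrite // -wE actK.
case=> s ws; exists k, S, (shiftE S' e); split => //.
  exists (val s); last by rewrite -ep_inner // -ws.
  by case: (s) => t /=; rewrite (len_elen bdd) lte_fin.
apply: open_edge_inj; rewrite -(shiftE_act S) -(shiftE_act S') image_comp.
rewrite (_ : act k \o act (- k) = id) ?image_id //.
by apply/funext => x; exact: actVK.
Qed.

Lemma infinite_lattice : (0 < n)%N -> infinite_set [set: 'rV[int]_n].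
Proof.
case: n => // m _ fin.
have : finite_set (range (fun j : nat => (const_mx j%:Z : 'rV[int]_m.+1))).
  exact: sub_finite_set fin.
move=> /(@finite_image _ _ _ (fun M : 'rV[int]_m.+1 => absz (M ord0 ord0))).
rewrite image_comp (_ : _ \o _ = id); last by apply/funext => j /=; rewrite mxE.
by rewrite image_id; exact: infinite_nat.
Qed.

(** By freeness at most one [k] sends a given vertex to another given one. Hence only finitely many
    [k] can bring an edge of [F] back into [F], while the lattice is infinite. *)
Lemma shift_escape (F : set (edge G)) : (0 < n)%N -> finite_set F ->
  exists k (S : gshift k), forall e, F e -> ~ F (shiftE S e).
Proof.
move=> n0 finF.
pose VF := (@src R G @` F) `|` (@vhead R G @` F).
have finVF : finite_set VF by rewrite finite_setU; split; exact: finite_image.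
pose bad (vw : vertex G * vertex G) := [set k | act k (Vert vw.1) = Vert vw.2].
have badfin vw : finite_set (bad vw).
  have [[k0 k0P]|N] := pselect (bad vw !=set0); last first.
    by rewrite (_ : bad vw = set0) //; apply/seteqP; split=> k // kP; case: N; exists k.
  apply: sub_finite_set (finite_set1 k0) => k kP /=.
  have E : act (- k0 + k) (Vert vw.1) = Vert vw.1.
    by rewrite (per_actD per) kP -k0P actK.
  by have := per_free per E; move/eqP; rewrite addrC subr_eq0 => /eqP.
have finbad : finite_set (\bigcup_(vw in VF `*` VF) bad vw).
  by apply: bigcup_finite => //; exact: finite_setX.
have [k nk] : exists k, ~ (\bigcup_(vw in VF `*` VF) bad vw) k.
  apply: contrapT => H; apply: (infinite_lattice n0).
  apply: sub_finite_set finbad => k _; apply: contrapT => nk.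
  by apply: H; exists k.
have [S] := shift_exists k; exists k, S => e Fe FSe; apply: nk.
have [w [we Sw]] := shift_headsrc S e.
exists (w, src (shiftE S e)); last by rewrite /bad /= (shiftV_act S) Sw.
split=> /=; last by left; exists (shiftE S e).
by case: we => ->; [left|right]; exists e.
Qed.

End PeriodicGraphs.

Section PowerIntegrals.
Variable R : realType.
Local Notation mu := (@lebesgue_measure R).
Implicit Types (f h : R -> R) (l q M : R).

Lemma cbounded f l : continuous f -> exists2 M, 0 <= M & forall t, 0 <= t <= l -> `|f t| <= M.
Proof.
move=> cf; have [l0|l0] := leP 0 l; last by exists 0 => // t /andP[A B]; lra.
have cn : {within `[0, l], continuous (fun t => `|f t|)}.
  by apply: continuous_subspaceT => x; apply: continuous_comp; [exact: cf|exact: norm_continuous].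
have [x _ xM] := EVT_max l0 cn.
by exists `|f x| => // t tI; apply: xM; rewrite in_itv.
Qed.

Lemma measurable_pow q f : continuous f -> measurable_fun setT (fun t => `|f t| `^ q).
Proof.
move=> cf; apply: (measurableT_comp (measurable_powR q)).
by apply: measurableT_comp => //; exact: continuous_measurable_fun.
Qed.

Lemma intg_pow q l f : 0 <= q -> continuous f -> intg 0 l (fun t => `|f t| `^ q).
Proof.
move=> q0 cf; have [M M0 fM] := cbounded l cf.
apply: intg_le (intg_cst 0 l (M `^ q)).
  by apply: measurable_funTS; exact: measurable_pow.
move=> x /andP[x0 xl]; rewrite ger0_norm ?powR_ge0 //.
by rewrite ge0_ler_powR ?nnegrE // fM // x0 ltW.
Qed.

Lemma ig_pow2 l f : ig 0 l (fun t => `|f t| `^ 2) = ig 0 l (fun t => f t ^+ 2).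
Proof. by apply: eq_ig => x _; rewrite powR_mulrn // real_normK ?num_real. Qed.

Lemma int_pow_oo q l f : 0 <= q -> continuous f ->
  (\int[mu]_(t in `]0%R, l[) (`|f t| `^ q)%:E)%E = (ig 0 l (fun t => `|f t| `^ q))%:E.
Proof.
move=> q0 cf; rewrite -EFin_ig; last exact: intg_pow.
apply: integral_itv_obnd_cbnd; apply: measurable_funTS; apply/measurable_EFinP.
exact: measurable_pow.
Qed.

End PowerIntegrals.

(** * The energies of functions on the graph *)

Section Functionals.
Variables (R : realType) (G : metricGraph R).
Hypothesis bdd : forall e : edge G, (len e < +oo)%E.
Implicit Types (e : edge G) (u v : gpoint G -> R) (al be : R).

Let L0 e : 0 < elen e := elen_gt0 bdd e.

(* [al ||u'||^2 + be ||u||^2], and [||u||_p^p] below *)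
Definition En al be u : \bar R := \esum_(e in [set: edge G]) ee al be (elen e) (on_edge u e).
Definition Pw p u : \bar R :=
  \esum_(e in [set: edge G]) (ig 0 (elen e) (fun t => `|on_edge u e t| `^ p))%:E.

Lemma Lq_pow_Pw q u : 0 <= q -> continuous u -> Lq_pow q u = Pw q u.
Proof.
move=> q0 cu; apply: eq_esum => e _; rewrite (edge_itvE bdd) int_pow_oo //.
exact: continuous_on_edge.
Qed.

Lemma Lq_pow2 u : continuous u -> Lq_pow 2 u = En 0 1 u.
Proof.
move=> cu; rewrite Lq_pow_Pw //; apply: eq_esum => e _.
by rewrite ig_pow2 /ee mul0e add0e mul1r.
Qed.

Lemma Pw_ge0 p u : (0 <= Pw p u)%E.
Proof. by apply: esum_ge0 => e _; rewrite lee_fin ig_ge0 // => x _; exact: powR_ge0. Qed.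

Lemma En_ge0 al be u : 0 <= al -> 0 <= be -> (0 <= En al be u)%E.
Proof. by move=> a0 b0; apply: esum_ge0 => e _; apply: ee_ge0. Qed.

Lemma En_split al be u : 0 <= al -> 0 <= be ->
  En al be u = (al%:E * En 1 0 u + be%:E * En 0 1 u)%E.
Proof.
move=> a0 b0; rewrite -!esumZ //; [|by move=> e; exact: ee_ge0|by move=> e; exact: ee_ge0].
rewrite -esumD; [|by move=> e _; rewrite mule_ge0 ?ee_ge0 ?lee_fin
  |by move=> e _; rewrite mule_ge0 ?ee_ge0 ?lee_fin].
by apply: eq_esum => e _; rewrite /ee mul0r !adde0 mul0e add0e mul1e mul1r EFinM.
Qed.

Lemma dirichlet_En u : continuous u -> (forall e, in_H1 (edge_itv e) (on_edge u e)) ->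
  dirichlet u = En 1 0 u.
Proof.
move=> cu Hu; apply: eq_esum => e _; have := Hu e; rewrite (edge_itvE bdd) => He.
by rewrite wderiv_Den //; [rewrite /ee mul0r adde0 mul1e|exact: continuous_on_edge].
Qed.

Lemma En_lty1 al be u e : 0 < al -> 0 <= be -> (En al be u < +oo)%E ->
  (Den (elen e) (on_edge u e) < +oo)%E.
Proof.
move=> a0 b0 H.
have : (ee al be (elen e) (on_edge u e) < +oo)%E.
  apply: le_lt_trans H; apply: (@le_esum1 _ _ (fun e => ee al be (elen e) (on_edge u e))).
  by move=> i; apply: ee_ge0 => //; exact: ltW.
rewrite /ee; case: (Den _ _) (Den_ge0 (on_edge u e) (L0 e)) => [r _ _|_|//]; first exact: ltry.
by rewrite gt0_muley ?lte_fin // addye.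
Qed.

Lemma En11 (lam : R) u : 0 < lam -> (En 1 1 u < +oo)%E <-> (En 1 lam u < +oo)%E.
Proof.
move=> l0; have l0' := ltW l0.
rewrite (@En_split 1 1) // (@En_split 1 lam) // !mul1e.
have D0 : (0 <= En 1 0 u)%E by exact: En_ge0.
have N0 : (0 <= En 0 1 u)%E by exact: En_ge0.
have yD (x : \bar R) : (0 <= x -> +oo + x = +oo)%E by case: x.
case: (En 1 0 u) D0 => [d _|_|//]; last by rewrite !yD ?mule_ge0.
case: (En 0 1 u) N0 => [m _|_|//]; first by rewrite -EFinM -!EFinD !ltry.
by rewrite gt0_muley ?lte_fin.
Qed.

Lemma H1_En (lam : R) u : 0 < lam -> H1 u <-> continuous u /\ (En 1 lam u < +oo)%E.
Proof.
move=> l0; rewrite -(En11 u l0); split.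
  move=> [cu Hu]; rewrite (dirichlet_En cu Hu) (Lq_pow2 cu) => H; split => //.
  by rewrite (@En_split 1 1) // !mul1e.
move=> [cu H].
have Hu e : in_H1 (edge_itv e) (on_edge u e).
  rewrite (edge_itvE bdd) in_H1_Den //; last exact: continuous_on_edge.
  by apply: En_lty1 H.
split => //; rewrite (dirichlet_En cu Hu) (Lq_pow2 cu).
by move: H; rewrite (@En_split 1 1) // !mul1e.
Qed.

Lemma H1_dirichlet u : H1 u -> dirichlet u = En 1 0 u.
Proof. by case=> cu Hu _; exact: dirichlet_En. Qed.

Section Weights.
Variables (al be : R).
Hypotheses (al0 : 0 <= al) (be0 : 0 <= be).

Let eeP u e : (0 <= ee al be (elen e) (on_edge u e))%E.
Proof. exact: ee_ge0. Qed.

Lemma En_parallelogram s u v : 0 < s -> continuous u -> continuous v ->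
  (En al be (fun x => u x - v x)%R + s^-1%:E * En al be (fun x => u x + s * v x)%R =
  (1 + s^-1)%:E * En al be u + (1 + s)%:E * En al be v)%E.
Proof.
move=> s0 cu cv; have si : 0 <= s^-1 by rewrite invr_ge0 ltW.
have s1 : 0 <= 1 + s by rewrite addr_ge0 // ltW.
have si1 : 0 <= 1 + s^-1 by rewrite addr_ge0.
rewrite -!esumZ //.
rewrite -!esumD; try by move=> e _; rewrite ?mule_ge0 ?eeP.
apply: eq_esum => e _.
have := @ee_parallelogram _ _ _ al0 be0 (elen e) s (on_edge u e) (on_edge v e) (L0 e) s0
  (continuous_on_edge cu) (continuous_on_edge cv).
by rewrite mul1e.
Qed.

Lemma En_scale c u : continuous u -> En al be (fun x => c * u x) = ((c ^+ 2)%:E * En al be u)%E.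
Proof.
move=> cu; rewrite -esumZ ?sqr_ge0 //; apply: eq_esum => e _.
by rewrite -ee_scale //; exact: continuous_on_edge.
Qed.

Lemma En_contract u v : continuous u -> continuous v ->
  (forall x y, `|u x - u y| <= `|v x - v y|) -> (forall x, `|u x| <= `|v x|) ->
  (En al be u <= En al be v)%E.
Proof.
move=> cu cv H1 H2; apply: le_esum => e _.
by apply: ee_contract => //; try exact: continuous_on_edge; move=> *; rewrite ?H1 ?H2.
Qed.

Lemma En_pos_neg u : continuous u ->
  (En al be (pos_part u) + En al be (neg_part u) <= En al be u)%E.
Proof.
move=> cu; rewrite -esumD; [|by move=> e _|by move=> e _].
apply: le_esum => e _; apply: ee_pos_neg => //; exact: continuous_on_edge.
Qed.

(** Finitely many edges at a finite depth: a real number that depends continuously on [u], whereas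
    [En] is only the supremum of these. *)
Definition Qe (s : seq (edge G)) k u : R := \sum_(e <- s) qe al be k (elen e) (on_edge u e).

Lemma Qe_le_En s k u : uniq s -> ((Qe s k u)%:E <= En al be u)%E.
Proof.
move=> us; apply: le_trans (sum_le_esum us _); last by move=> e; exact: eeP.
by rewrite /Qe -sumEFin; apply: lee_sum => e _; exact: qe_le_ee.
Qed.

Lemma En_le_Qe u (C : R) : (forall s k, uniq s -> Qe s k u <= C) -> (En al be u <= C%:E)%E.
Proof.
move=> H; apply: esum_le_sums => s us.
have cv : (\sum_(e <- s) (qe al be k (elen e) (on_edge u e))%:E)%E @[k --> \oo] -->
    (\sum_(e <- s) ee al be (elen e) (on_edge u e))%E.
  elim: (s) => [|e r IH]; first by under eq_fun do rewrite big_nil; rewrite big_nil; exact: cvg_cst.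
  under eq_fun do rewrite big_cons; rewrite big_cons; apply: cvgeD => //.
    by apply: ge0_adde_def; rewrite inE ?eeP // sume_ge0.
  exact: cvg_qe_ee.
rewrite -(cvg_lim _ cv) //; apply: lime_le; first by apply/cvg_ex; eexists; exact: cv.
by apply: nearW => k; rewrite sumEFin lee_fin; exact: H.
Qed.

Lemma En_gt_Qe u (c : R) : (c%:E < En al be u)%E -> exists s k, uniq s /\ c < Qe s k u.
Proof.
move=> cu; apply: contrapT => N; move: cu; apply/negP; rewrite -leNgt.
apply: En_le_Qe => s k us; rewrite leNgt; apply/negP => cQ; apply: N.
by exists s, k.
Qed.

End Weights.

Lemma Pw_scale p c u : 0 <= p -> continuous u ->
  Pw p (fun x => c * u x) = ((`|c| `^ p)%:E * Pw p u)%E.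
Proof.
move=> p0 cu; rewrite -esumZ ?powR_ge0 //; last first.
  by move=> e; rewrite lee_fin ig_ge0 // => x _; exact: powR_ge0.
apply: eq_esum => e _; rewrite -EFinM -igZ; last first.
  by apply: intg_pow => //; exact: continuous_on_edge.
by congr EFin; apply: eq_ig => x _; rewrite /on_edge normrM powRM.
Qed.

Lemma Pw_le p u v : 0 <= p -> continuous u -> continuous v ->
  (forall x, `|u x| <= `|v x|) -> (Pw p u <= Pw p v)%E.
Proof.
move=> p0 cu cv uv; apply: le_esum => e _; rewrite lee_fin.
apply: le_ig; [by apply: intg_pow => //; exact: continuous_on_edge
  |by apply: intg_pow => //; exact: continuous_on_edge|].
by move=> x _; rewrite ge0_ler_powR ?nnegrE //; exact: uv.
Qed.

Lemma Pw_pos_neg p u : 0 < p -> continuous u ->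
  Pw p u = (Pw p (pos_part u) + Pw p (neg_part u))%E.
Proof.
move=> p0 cu; have pge : forall v e, (0 <= (ig 0 (elen e) (fun t => `|on_edge v e t| `^ p))%:E)%E.
  by move=> v e; rewrite lee_fin ig_ge0 // => x _; exact: powR_ge0.
rewrite -esumD; [|by move=> e _|by move=> e _].
apply: eq_esum => e _; rewrite -EFinD; congr EFin.
have ce := continuous_on_edge (e := e) cu.
have cp : continuous (on_edge (pos_part u) e) by exact: continuous_posp.
have cn : continuous (on_edge (neg_part u) e) by exact: continuous_negp.
rewrite -igD; [|exact: intg_pow (ltW p0) cp|exact: intg_pow (ltW p0) cn].
apply: eq_ig => x _; rewrite /on_edge /pos_part /neg_part /Num.max /Num.min.
by case: ifPn => _; rewrite normr0 powR0 ?gt_eqF // ?add0r ?addr0.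
Qed.

End Functionals.

(** * Pointwise bounds by the energy *)

Section SobolevBounds.
Variable R : realType.
Implicit Types (f : R -> R) (l w lam : R).

(** On a window of width [w] containing [t] one has [f t^2 <= 2 f x^2 + 2 D w], with [D] the
    Dirichlet energy; averaging over [x] gives [f t^2 <= 2 N / w + 2 D w], with [N] the square
    integral. Only a lower bound on the length enters the constant. *)
Lemma edge_sup_bound w lam l f t : 0 < w -> w <= l -> 0 < lam -> continuous f ->
  0 <= t <= l ->
  ((f t ^+ 2)%:E <= (2 / (w * lam) + 2 * w)%:E * ee 1 lam l f)%E.
Proof.
move=> w0 wl lam0 cf /andP[t0 tl]; have l0 : 0 < l by exact: lt_le_trans wl.
have C0 : 0 < 2 / (w * lam) + 2 * w by rewrite addr_gt0 ?divr_gt0 ?mulr_gt0.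
rewrite /ee mul1e; have [D0 Dy] := (Den_ge0 f l0, dyE_le_Den 0 l f).
case E : (Den l f) => [D| |]; last 2 first.
- by rewrite addye // gt0_muley ?leey.
- by rewrite E in D0.
have DH := @Den_hoelder _ l f D _ _ l0 cf.
have {}DH s t' : 0 <= s -> s <= t' -> t' <= l -> (f t' - f s) ^+ 2 <= D * (t' - s).
  by apply: DH; rewrite E.
rewrite E lee_fin in D0.
rewrite -EFinD -EFinM lee_fin.
have [_ fi] := L2_continuous 0 l cf.
set N := ig 0 l _; have N0 : 0 <= N by exact: igsq_ge0.
(* The left end of a window that contains [t] and stays inside [[0, l]]. *)
pose s := Num.min t (l - w).
have s0 : 0 <= s by rewrite le_min t0 subr_ge0.
have st : s <= t by rewrite ge_min lexx.
have sl : s + w <= l by rewrite -lerBrDr ge_min lexx orbT.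
have tsw : t <= s + w.
  by rewrite /s; case: (leP t (l - w)) => _; lra.
have sw : s <= s + w by rewrite lerDl ltW.
have H x : s <= x < s + w -> f t ^+ 2 <= 2 * f x ^+ 2 + 2 * (D * w).
  move=> /andP[sx xs].
  have h : (f t - f x) ^+ 2 <= D * w.
    have [tx|xt] := leP t x.
      rewrite -sqrrN opprB; apply: le_trans (DH t x t0 tx _) _; first by lra.
      by rewrite ler_wpM2l //; lra.
    apply: le_trans (DH x t _ (ltW xt) tl) _; first by lra.
    by rewrite ler_wpM2l //; lra.
  have := sqr_ge0 (f t - 2 * f x); nra.
have I : w * f t ^+ 2 <= 2 * N + 2 * D * w ^+ 2.
  have -> : w * f t ^+ 2 = ig s (s + w) (fun=> f t ^+ 2).
    by rewrite ig_cst // mulrC; congr (_ * _); ring.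
  have i1 : intg s (s + w) (fun x => f x ^+ 2) by exact: intg_sub fi.
  apply: (@le_trans _ _ (ig s (s + w) (fun x => 2 * f x ^+ 2 + 2 * (D * w)))).
    apply: le_ig => //; first exact: intg_cst.
    by apply: intgD; [exact: intgZ|exact: (intg_cst _ _ (2 * (D * w)))].
  rewrite igD; [|exact: intgZ|exact: (intg_cst _ _ (2 * (D * w)))].
  rewrite igZ // ig_cst // lerD //.
    rewrite ler_pM2l // /N (ig_split s0 (le_trans sw sl) fi).
    rewrite (ig_split sw sl (intg_sub s0 (lexx _) fi)).
    have p a b : 0 <= ig a b (fun x => f x ^+ 2) by apply: ig_ge0 => x _; exact: sqr_ge0.
    by have := p 0 s; have := p (s + w) l; lra.
  by rewrite le_eqVlt; apply/orP; left; apply/eqP; ring.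
rewrite -(ler_pM2l w0); apply: (le_trans I).
have -> : w * ((2 / (w * lam) + 2 * w) * (D + lam * N)) =
    2 * N + 2 * D * w ^+ 2 + (2 * D / lam + 2 * w ^+ 2 * (lam * N)).
  by field; rewrite !gt_eqF.
by rewrite lerDl addr_ge0 ?mulr_ge0 ?invr_ge0 ?sqr_ge0 // ltW.
Qed.

End SobolevBounds.

Section SobolevSpace.
Variables (R : realType) (p lam : R) (G : metricGraph R) (Z : set (vertex G)).
Hypothesis bdd : forall e : edge G, (len e < +oo)%E.
Hypothesis cG : class_G G.
Hypothesis e0 : inhabited (edge G).
Hypothesis p2 : 2 < p.
Hypothesis lam0 : 0 < lam.
Implicit Types (e : edge G) (u v w : gpoint G -> R).

(* [H1_Z] in terms of the dyadic energy, see [H1_ZP]. *)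
Definition H1dy : set (gpoint G -> R) := [set u | [/\ continuous u, (En 1 lam u < +oo)%E &
  forall v : vertex G, Z v -> u (Vert v) = 0]].
Local Notation HZ := H1dy.

Lemma H1_ZP u : H1_Z Z u <-> HZ u.
Proof.
by rewrite /H1_Z /H1dy /= (H1_En bdd u lam0); split=> [[[? ?] ?]|[? ? ?]].
Qed.

Definition h1form u : R := fine (En 1 lam u).
Definition lpow u : R := fine (Pw p u).
Definition l2pow u : R := fine (En 0 1 u).
Local Notation A := h1form.
Local Notation P := lpow.
Local Notation N2 := l2pow.

Let lam_ge0 : 0 <= lam := ltW lam0.

Lemma En1_ge0 u : (0 <= En 1 lam u)%E. Proof. exact: En_ge0. Qed.
Lemma En0_ge0 u : (0 <= En 0 1 u)%E. Proof. exact: En_ge0. Qed.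

Lemma AE u : HZ u -> En 1 lam u = (A u)%:E.
Proof. by case=> _ uy _; rewrite /h1form fineK // ge0_fin_numE // En1_ge0. Qed.

Lemma A_ge0 u : 0 <= A u.
Proof. by rewrite fine_ge0 // En1_ge0. Qed.

Lemma N2E u : HZ u -> En 0 1 u = (N2 u)%:E.
Proof.
move=> [_ uy _]; rewrite /l2pow fineK // ge0_fin_numE ?En0_ge0 //.
have := uy; rewrite (@En_split _ _ bdd 1 lam) // mul1e.
have : (0 <= En 1 0 u)%E by exact: En_ge0.
have := En0_ge0 u; case: (En 0 1 u) => [m _ _ _|_ D0|//]; first exact: ltry.
by rewrite gt0_muley ?lte_fin // addey //; case: (En 1 0 u) D0.
Qed.

Lemma lamN2_le u : HZ u -> lam * N2 u <= A u.
Proof.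
move=> Hu; rewrite -lee_fin -AE // EFinM -N2E // (@En_split _ _ bdd 1 lam) // mul1e.
by rewrite leeDr // En_ge0.
Qed.

(* The constant of [edge_sup_bound] for edges of length at least [l0]. *)
Definition csup : R := let l0 := xget 1 [set l0 : R | 0 < l0 /\ forall e, l0 <= elen e] in
  2 / (l0 * lam) + 2 * l0.

Lemma csupP : 0 < csup /\ forall u e t, continuous u -> 0 <= t <= elen e ->
  ((on_edge u e t ^+ 2)%:E <= csup%:E * ee 1 lam (elen e) (on_edge u e))%E.
Proof.
rewrite /csup; set l0 := xget _ _.
have [l00 l0e] : 0 < l0 /\ forall e, l0 <= elen e.
  have [l1 l10 l1e] := elen_lb bdd cG.
  exact: (xgetPex 1 (ex_intro (fun l0 : R => 0 < l0 /\ forall e, l0 <= elen e) l1 (conj l10 l1e))).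
split; first by rewrite addr_gt0 ?divr_gt0 ?mulr_gt0.
by move=> u e t cu tI; apply: edge_sup_bound => //; exact: continuous_on_edge.
Qed.

Lemma gcover x : exists e t, 0 <= t <= elen e /\ x = edge_point e t.
Proof. by case: e0 => e; apply: ep_cover => //; case: cG. Qed.

Lemma sup_bound u x : HZ u -> u x ^+ 2 <= csup * A u.
Proof.
move=> Hu; have [cu _ _] := Hu; have [e [t [tI ->]]] := gcover x.
have [c0 /(_ u e t cu tI) H] := csupP.
rewrite -lee_fin [leRHS]EFinM -AE //; apply: le_trans H _.
rewrite lee_pmul2l ?lte_fin //; apply: (@le_esum1 _ _ (fun e => ee 1 lam (elen e) (on_edge u e))).
by move=> i; apply: ee_ge0 => //; exact: elen_gt0.
Qed.

Lemma A_edge_Den u e : HZ u -> (Den (elen e) (on_edge u e) <= (A u)%:E)%E.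
Proof.
move=> Hu; rewrite -AE //.
apply: (@le_trans _ _ (ee 1 lam (elen e) (on_edge u e))); last first.
  apply: (@le_esum1 _ _ (fun e => ee 1 lam (elen e) (on_edge u e))) => i.
  by apply: ee_ge0 => //; exact: elen_gt0.
by rewrite /ee mul1e leeDl // lee_fin mulr_ge0 // igsq_ge0.
Qed.

Lemma hoelder_edge u e s t : HZ u -> 0 <= s <= elen e -> 0 <= t <= elen e ->
  (on_edge u e t - on_edge u e s) ^+ 2 <= A u * `|t - s|.
Proof.
move=> Hu /andP[s0 sl] /andP[t0 tl]; have [cu _ _] := Hu.
have H := @Den_hoelder _ _ _ _ _ _ (elen_gt0 bdd e) (continuous_on_edge cu) (A_edge_Den e Hu).
have [st|ts] := leP s t; first by rewrite ger0_norm ?subr_ge0 // H.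
by rewrite -sqrrN opprB ltr0_norm ?subr_lt0 // opprB H // ltW.
Qed.

Lemma Pw_le_sup u M : 0 <= M -> continuous u ->
  (forall e t, 0 <= t <= elen e -> `|on_edge u e t| <= M) ->
  (Pw p u <= (M `^ (p - 2))%:E * En 0 1 u)%E.
Proof.
move=> M0 cu uM; rewrite -esumZ ?powR_ge0 //; last first.
  by move=> i; apply: ee_ge0 => //; exact: elen_gt0.
apply: le_esum => e _; rewrite /ee mul0e add0e mul1r -EFinM lee_fin.
have ce := continuous_on_edge (e := e) cu; have [_ ei] := L2_continuous 0 (elen e) ce.
have p0 : 0 <= p by apply: ltW; apply: lt_trans p2.
rewrite -igZ //; apply: le_ig; first exact: intg_pow.
  exact: intgZ.
move=> x /andP[x0 xl]; rewrite -[in leRHS](real_normK (num_real _)).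
have p20 : 0 <= p - 2 by rewrite subr_ge0 ltW.
have E (y : R) : y `^ p = y `^ (p - 2) * y `^ 2.
  by rewrite -powRD subrK // gt_eqF // (lt_trans _ p2).
rewrite E.
rewrite powR_mulrn // ler_wpM2r ?sqr_ge0 //.
by rewrite ge0_ler_powR ?nnegrE // uM // x0 ltW.
Qed.

Lemma P_fin u : HZ u -> Pw p u = (P u)%:E.
Proof.
move=> Hu; have [cu _ _] := Hu; rewrite /lpow fineK // ge0_fin_numE ?Pw_ge0 //.
apply: le_lt_trans (@Pw_le_sup u (Num.sqrt (csup * A u)) (sqrtr_ge0 _) cu _) _.
  move=> e t tI; rewrite -sqrtr_sqr ler_wsqrtr //; exact: sup_bound.
by rewrite N2E // -EFinM ltry.
Qed.

(** This is what excludes vanishing: if [sup |u|] is small, [P u] is a small multiple of [A u]. *)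
Lemma P_le_sup u M : HZ u -> 0 <= M -> (forall e t, 0 <= t <= elen e -> `|on_edge u e t| <= M) ->
  P u <= M `^ (p - 2) / lam * A u.
Proof.
move=> Hu M0 uM; have [cu _ _] := Hu; have := Pw_le_sup M0 cu uM.
rewrite P_fin // N2E // -EFinM lee_fin => H; apply: (le_trans H).
rewrite -mulrA ler_wpM2l ?powR_ge0 // mulrC ler_pdivlMr // mulrC.
exact: lamN2_le.
Qed.

End SobolevSpace.

Lemma max0_contract (R : realType) (a b : R) : `|Num.max a 0 - Num.max b 0| <= `|a - b|.
Proof.
have := ler_norm (a - b); have := ler_norm (b - a); rewrite (distrC b) ler_norml.
by rewrite /Num.max; case: ifPn => A; case: ifPn => B; lra.
Qed.

Lemma continuous_norm_powR (R : realType) (q : R) : 0 < q -> continuous (fun y : R => `|y| `^ q).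
Proof.
move=> q0 y; have [->|y0] := eqVneq y 0; last first.
  apply: (@continuous_comp _ _ _ (@Num.norm _ R) (fun z => z `^ q)); first exact: norm_continuous.
  apply: differentiable_continuous; apply/derivable1_diffP; apply: derivable_powR.
  by rewrite in_itv/= andbT normr_gt0.
rewrite /continuous_at normr0 powR0 ?gt_eqF //; apply/cvgrPdist_lt => e e0.
near=> z; rewrite sub0r normrN ger0_norm ?powR_ge0 //.
have ze : `|z| < e `^ q^-1.
  near: z; apply/nbhs_ballP; exists (e `^ q^-1) => /=; first by rewrite powR_gt0.
  by move=> z; rewrite /ball /= sub0r normrN.
have -> : e = (e `^ q^-1) `^ q by rewrite -powRrM mulVf ?gt_eqF // powRr1 // ltW.
by rewrite gt0_ltr_powR // nnegrE ?powR_ge0.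
Unshelve. all: by end_near. Qed.

Lemma continuous_pow (R : realType) (q : R) (f : R -> R) : 0 < q -> continuous f ->
  continuous (fun t => `|f t| `^ q).
Proof.
move=> q0 cf t; apply: (@continuous_comp _ _ _ f (fun y => `|y| `^ q)); first exact: cf.
exact: continuous_norm_powR.
Qed.

Lemma ig_pow_rev (R : realType) (q l : R) (f : R -> R) : 0 < l -> 0 < q -> continuous f ->
  ig 0 l (fun t => `|f (l - t)| `^ q) = ig 0 l (fun t => `|f t| `^ q).
Proof. by move=> l0 q0 cf; apply: (ig_rev l0 (continuous_pow q0 cf)). Qed.

(** * Invariance of the energies under translations *)

Section Translations.
Variables (R : realType) (p lam : R) (G : metricGraph R) (n : nat).
Variables (act : 'rV[int]_n -> gpoint G -> gpoint G) (Z : set (vertex G)).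
Hypothesis per : periodic_graph act.
Hypothesis perZ : periodic_vertices act Z.
Hypothesis lam0 : 0 < lam.
Implicit Types (u : gpoint G -> R).

Local Notation HZ := (@H1dy R lam G Z).
Let bdd := per_len per.

Variables (k : 'rV[int]_n) (S : gshift act k).

Lemma on_edge_shift u e t : on_edge (u \o shiftP S) e t =
  on_edge u (shiftE S e) (if flip S e then elen (shiftE S e) - t else t).
Proof. by rewrite /on_edge /= (shiftP_edge S). Qed.

Lemma continuous_shift u : continuous u -> continuous (u \o shiftP S).
Proof.
move=> cu; apply: continuous_graph => e.
have ce := continuous_on_edge (e := shiftE S e) cu.
rewrite (_ : on_edge _ _ = fun t =>
  on_edge u (shiftE S e) (if flip S e then elen (shiftE S e) - t else t)); last first.
  by apply/funext => t; rewrite on_edge_shift.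
case: (flip S e) => // x.
apply: (@continuous_comp _ _ _ (fun t : R => elen (shiftE S e) - t)); last exact: ce.
by apply: cvgB; [exact: cvg_cst|exact: cvg_id].
Qed.

Lemma En_shift al be u : 0 <= al -> 0 <= be -> continuous u ->
  En al be (u \o shiftP S) = En al be u.
Proof.
move=> a0 b0 cu; rewrite /En [RHS](reindex_esum _ _ _ _ (shiftE_bij S)).
apply: eq_esum => e _.
have ce := continuous_on_edge (e := shiftE S e) cu.
rewrite (_ : on_edge _ _ = fun t =>
  on_edge u (shiftE S e) (if flip S e then elen (shiftE S e) - t else t)); last first.
  by apply/funext => t; rewrite on_edge_shift.
rewrite (shiftE_len S); case: (flip S e) => //.
by rewrite ee_rev // (elen_gt0 bdd).
Qed.

Lemma Pw_shift u : 0 < p -> continuous u -> Pw p (u \o shiftP S) = Pw p u.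
Proof.
move=> p0 cu; rewrite /Pw [RHS](reindex_esum _ _ _ _ (shiftE_bij S)).
apply: eq_esum => e _; rewrite (shiftE_len S).
have ce := continuous_on_edge (e := shiftE S e) cu.
have le0 := elen_gt0 bdd e.
have E := ig_pow_rev le0 p0 ce.
case F : (flip S e); last first.
  by apply: congr1; apply: eq_ig => x _; rewrite on_edge_shift F.
rewrite -E; apply: congr1; apply: eq_ig => x _.
by rewrite on_edge_shift F (shiftE_len S).
Qed.

End Translations.

Section EdgeLowerBounds.
Variables (R : realType) (G : metricGraph R).
Hypothesis bdd : forall e : edge G, (len e < +oo)%E.

Lemma Pw_ge_edge p (u : gpoint G -> R) e :
  ((ig 0 (elen e) (fun t => `|on_edge u e t| `^ p))%:E <= Pw p u)%E.
Proof.
apply: (@le_esum1 _ _ (fun e => (ig 0 (elen e) (fun t => `|on_edge u e t| `^ p))%:E)).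
by move=> i; rewrite lee_fin ig_ge0 // => y _; exact: powR_ge0.
Qed.

Lemma En_ge_edge (al be : R) (u : gpoint G -> R) e : 0 <= al -> 0 <= be ->
  (ee al be (elen e) (on_edge u e) <= En al be u)%E.
Proof.
move=> a0 b0; apply: (@le_esum1 _ _ (fun e => ee al be (elen e) (on_edge u e))).
by move=> i; apply: ee_ge0 => //; exact: elen_gt0.
Qed.

Lemma Pw_abs p (u : gpoint G -> R) : Pw p (fun x => `|u x|) = Pw p u.
Proof.
apply: eq_esum => e _; apply: congr1; apply: eq_ig => x _.
by rewrite /on_edge normr_id.
Qed.

End EdgeLowerBounds.

Lemma EnE (R : realType) (G : metricGraph R) (al be : R) (u : gpoint G -> R) :
  En al be u = \esum_(e in [set: edge G]) ee al be (elen e) (on_edge u e).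
Proof. by []. Qed.

Lemma PwE (R : realType) (G : metricGraph R) (p : R) (u : gpoint G -> R) :
  Pw p u = \esum_(e in [set: edge G]) (ig 0 (elen e) (fun t => `|on_edge u e t| `^ p))%:E.
Proof. by []. Qed.

(* Prevents unification from comparing two energies by unfolding them. *)
Opaque En Pw.

Section SobolevSpaceOps.
Variables (R : realType) (p lam : R) (G : metricGraph R) (Z : set (vertex G)).
Hypothesis bdd : forall e : edge G, (len e < +oo)%E.
Hypothesis cG : class_G G.
Hypothesis e0 : inhabited (edge G).
Hypothesis p2 : 2 < p.
Hypothesis lam0 : 0 < lam.
Implicit Types (e : edge G) (u v w : gpoint G -> R).

Local Notation HZ := (@H1dy R lam G Z).
Local Notation A := (@h1form R lam G).
Local Notation P := (@lpow R p G).
Local Notation N2 := (@l2pow R G).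

Let lam_ge0 : 0 <= lam := ltW lam0.
Let L0 e : 0 < elen e := elen_gt0 bdd e.

Lemma p_gt0 : 0 < p. Proof. by apply: lt_trans p2. Qed.
Lemma p_ge0 : 0 <= p. Proof. exact/ltW/p_gt0. Qed.

Lemma continuous_gcomb c u v : continuous u -> continuous v -> continuous (fun x => u x + c * v x).
Proof.
move=> cu cv; apply: continuous_graph => e t.
apply: cvgD; first exact: (continuous_on_edge cu).
by apply: cvgM; [exact: cvg_cst|exact: (continuous_on_edge cv)].
Qed.

Lemma continuous_gsub u v : continuous u -> continuous v -> continuous (fun x => u x - v x).
Proof.
move=> cu cv; apply: continuous_graph => e t.
by apply: cvgB; [exact: (continuous_on_edge cu)|exact: (continuous_on_edge cv)].
Qed.

Lemma continuous_gscale c u : continuous u -> continuous (fun x => c * u x).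
Proof.
move=> cu; apply: continuous_graph => e t.
by apply: cvgM; [exact: cvg_cst|exact: (continuous_on_edge cu)].
Qed.

Lemma continuous_gabs u : continuous u -> continuous (fun x => `|u x|).
Proof.
move=> cu; apply: continuous_graph => e t.
apply: (@continuous_comp _ _ _ (on_edge u e)); first exact: (continuous_on_edge cu).
exact: norm_continuous.
Qed.

(** Both terms on the left of the parallelogram identity are non-negative and their weighted sum is
    finite. *)
Lemma HZ_comb s u v : 0 < s -> HZ u -> HZ v ->
  HZ (fun x => u x - v x) /\ HZ (fun x => u x + s * v x).
Proof.
move=> s0 Hu Hv; have [cu _ Zu] := Hu; have [cv _ Zv] := Hv.
have E := En_parallelogram bdd (ler01 : (0 : R) <= 1) lam_ge0 s0 cu cv.
have fin : (En 1 lam (fun x => u x - v x)%R + s^-1%:E * En 1 lam (fun x => u x + s * v x)%R < +oo)%E.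
  by rewrite E (AE bdd lam0 Hu) (AE bdd lam0 Hv) -!EFinM -EFinD ltry.
have g1 : (0 <= En 1 lam (fun x => u x - v x)%R)%E by exact: En_ge0.
have g2 : (0 <= En 1 lam (fun x => u x + s * v x)%R)%E by exact: En_ge0.
split; split.
- exact: continuous_gsub.
- apply: le_lt_trans fin; rewrite leeDl // mule_ge0 // lee_fin invr_ge0 ltW //.
- by move=> x Zx; rewrite Zu // Zv // subr0.
- exact: continuous_gcomb.
- case: (En _ _ _) g2 fin => [r _ _|_|//]; first exact: ltry.
  by rewrite gt0_muley ?lte_fin ?invr_gt0 // addey //; case: (En _ _ _) g1.
- by move=> x Zx; rewrite Zu // Zv // mulr0 addr0.
Qed.

Lemma A_parallelogram s u v : 0 < s -> HZ u -> HZ v ->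
  A (fun x => u x - v x) + s^-1 * A (fun x => u x + s * v x) = (1 + s^-1) * A u + (1 + s) * A v.
Proof.
move=> s0 Hu Hv; have [cu _ _] := Hu; have [cv _ _] := Hv.
have [H1 H2] := HZ_comb s0 Hu Hv.
have := En_parallelogram bdd (ler01 : (0 : R) <= 1) lam_ge0 s0 cu cv.
by rewrite (AE bdd lam0 H1) (AE bdd lam0 H2) (AE bdd lam0 Hu) (AE bdd lam0 Hv) -!EFinM -!EFinD => -[].
Qed.

Lemma HZ_scale c u : HZ u -> HZ (fun x => c * u x).
Proof.
move=> Hu; have [cu _ Zu] := Hu; split.
- exact: continuous_gscale.
- by rewrite En_scale // (AE bdd lam0 Hu) -EFinM ltry.
- by move=> x Zx; rewrite Zu // mulr0.
Qed.

Lemma A_scale c u : HZ u -> A (fun x => c * u x) = c ^+ 2 * A u.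
Proof.
move=> Hu; have [cu _ Zu] := Hu; apply: EFin_inj.
rewrite -(AE bdd lam0 (HZ_scale c Hu)) En_scale // (AE bdd lam0 Hu) -EFinM //.
Qed.

Lemma P_scale c u : HZ u -> P (fun x => c * u x) = `|c| `^ p * P u.
Proof.
move=> Hu; have [cu _ Zu] := Hu; apply: EFin_inj.
rewrite -(P_fin bdd cG e0 p2 lam0 (HZ_scale c Hu)) Pw_scale //; last exact: p_ge0.
by rewrite (P_fin bdd cG e0 p2 lam0 Hu) // -EFinM.
Qed.

Lemma HZ_contract u v : HZ v -> continuous u ->
  (forall x y, `|u x - u y| <= `|v x - v y|) -> (forall x, `|u x| <= `|v x|) ->
  HZ u /\ A u <= A v.
Proof.
move=> Hv cu H1 H2; have [cv fv Zv] := Hv.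
have L := En_contract bdd (ler01 : (0 : R) <= 1) lam_ge0 cu cv H1 H2.
have Hu : HZ u.
  split => //; first exact: le_lt_trans L fv.
  by move=> x Zx; apply/eqP; rewrite -normr_le0; apply: le_trans (H2 _) _; rewrite Zv // normr0.
by split => //; rewrite -lee_fin -(AE bdd lam0 Hu) -(AE bdd lam0 Hv).
Qed.

Lemma HZ_abs u : HZ u -> HZ (fun x => `|u x|) /\ A (fun x => `|u x|) <= A u.
Proof.
move=> Hu; have [cu _ _] := Hu; apply: HZ_contract => //.
- exact: continuous_gabs.
- by move=> x y; exact: ler_dist_dist.
- by move=> x; rewrite normr_id.
Qed.

Lemma P_abs u : P (fun x => `|u x|) = P u.
Proof. exact: (congr1 fine (Pw_abs p u)). Qed.

Lemma P_le u v : HZ u -> HZ v -> (forall x, `|u x| <= `|v x|) -> P u <= P v.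
Proof.
move=> Hu Hv uv; have [cu _ _] := Hu; have [cv _ _] := Hv.
have Fu : Pw p u \is a fin_num by rewrite (P_fin bdd cG e0 p2 lam0 Hu).
have Fv : Pw p v \is a fin_num by rewrite (P_fin bdd cG e0 p2 lam0 Hv).
exact: (fine_le Fu Fv (Pw_le p_ge0 cu cv uv)).
Qed.

Lemma ig_pow_gt0 q l (f : R -> R) t : 0 < l -> 0 <= q -> continuous f -> 0 <= t <= l ->
  f t != 0 -> 0 < ig 0 l (fun x => `|f x| `^ q).
Proof.
move=> l0 q0 cf /andP[t0 tl] ft.
have h0 : 0 < `|f t| / 2 by rewrite divr_gt0 // normr_gt0.
have [d d0 fd] := heine_segment 0 l cf h0.
pose w := Num.min d l; have w0 : 0 < w by rewrite lt_min d0.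
have wd : w <= d by rewrite ge_min lexx.
have wl : w <= l by rewrite ge_min lexx orbT.
pose s := Num.min t (l - w).
have s0 : 0 <= s by rewrite le_min t0 subr_ge0.
have st : s <= t by rewrite ge_min lexx.
have sl : s + w <= l by rewrite -lerBrDr ge_min lexx orbT.
have tsw : t <= s + w by rewrite /s; case: (leP t (l - w)) => _; lra.
have sw : s <= s + w by rewrite lerDl ltW.
have i := intg_pow l q0 cf.
have g a b : 0 <= ig a b (fun x => `|f x| `^ q) by apply: ig_ge0 => x _; exact: powR_ge0.
rewrite (ig_split s0 (le_trans sw sl) i) (ig_split sw sl (intg_sub s0 (lexx _) i)).
suff : 0 < ig s (s + w) (fun x => `|f x| `^ q).
  by have := g 0 s; have := g (s + w) l; lra.
apply: (@lt_le_trans _ _ (ig s (s + w) (fun=> (`|f t| / 2) `^ q))).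
  by rewrite ig_cst // mulr_gt0 ?powR_gt0 //; lra.
apply: le_ig; [exact: intg_cst|exact: intg_sub i|].
move=> x /andP[sx xs]; have h0' := ltW h0; apply: ge0_ler_powR; rewrite ?nnegrE //.
have : `|f t - f x| <= `|f t| / 2.
  apply: fd; rewrite ?t0 //; first by apply/andP; split; lra.
  by rewrite ler_norml; apply/andP; split; lra.
have := ler_normD (f t - f x) (f x); rewrite subrK; lra.
Qed.

Lemma HZ_nonzero u : HZ u -> u <> cst 0 -> [/\ 0 < P u, 0 < N2 u & 0 < A u].
Proof.
move=> Hu une; have [cu _ _] := Hu.
have [x ux] : exists x, u x != 0.
  apply: contrapT => N; apply: une; apply/funext => x /=; apply/eqP.
  by apply: contrapT => ux; apply: N; exists x; apply/negP.
have [e [t [tI xe]]] := gcover bdd cG e0 x.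
have ce := continuous_on_edge (e := e) cu.
have ft : on_edge u e t != 0 by rewrite /on_edge -xe.
have P0 : 0 < P u.
  rewrite -lte_fin -(P_fin bdd cG e0 p2 lam0 Hu).
  apply: lt_le_trans (Pw_ge_edge p u e).
  by rewrite lte_fin; apply: ig_pow_gt0 (L0 e) p_ge0 ce tI ft.
have N0 : 0 < N2 u.
  rewrite -lte_fin -(N2E bdd lam0 Hu).
  apply: lt_le_trans (En_ge_edge bdd u e (lexx 0) ler01).
  rewrite /ee mul0e add0e mul1r lte_fin -ig_pow2.
  exact: ig_pow_gt0 (L0 e) (ler0n _ 2) ce tI ft.
split => //; apply: lt_le_trans (lamN2_le bdd lam0 Hu).
exact: mulr_gt0.
Qed.

Lemma HZ_0 : HZ (cst 0) /\ A (cst 0) = 0.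
Proof.
have c0 : continuous (cst 0 : gpoint G -> R).
  by apply: continuous_graph => e t; exact: cvg_cst.
have E : En 1 lam (cst 0 : gpoint G -> R) = 0%E.
  have -> : (cst 0 : gpoint G -> R) = (fun x => 0 * cst 0 x) by apply/funext => x /=; rewrite mulr0.
  by rewrite En_scale // expr0n mul0e.
by split; [split => //; rewrite E|rewrite /h1form E].
Qed.

Lemma A_gt0_nonzero u : 0 < A u -> u <> cst 0.
Proof. by move=> A0 u0; move: A0; rewrite u0 HZ_0.2 ltxx. Qed.

End SobolevSpaceOps.

Section SpaceTranslations.
Variables (R : realType) (p lam : R) (G : metricGraph R) (n : nat).
Variables (act : 'rV[int]_n -> gpoint G -> gpoint G) (Z : set (vertex G)).
Hypothesis per : periodic_graph act.
Hypothesis perZ : periodic_vertices act Z.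
Hypothesis lam0 : 0 < lam.
Implicit Types (u : gpoint G -> R).

Local Notation HZ := (@H1dy R lam G Z).
Let bdd := per_len per.

Variables (k : 'rV[int]_n) (S : gshift act k).

Lemma HZ_shift u : HZ u -> HZ (u \o shiftP S) /\ h1form lam (u \o shiftP S) = h1form lam u.
Proof.
move=> [cu uy Zu]; rewrite /h1form En_shift ?ltW //; split => //; split.
- exact: continuous_shift.
- by rewrite En_shift // ltW.
- move=> v Zv; rewrite /= (shiftP_vert S); apply: Zu.
  have : (Vert @` Z) (act k (Vert v)).
    by rewrite -(perZ k); exists (Vert v) => //; exists v.
  by rewrite (shiftV_act S) => -[w Zw [<-]].
Qed.

Lemma P_shift u : 0 < p -> continuous u -> lpow p (u \o shiftP S) = lpow p u.
Proof. by move=> p0 cu; rewrite /lpow (Pw_shift per S p0 cu). Qed.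

End SpaceTranslations.

Opaque h1form lpow l2pow.

Lemma esum_seqID (R : realType) (T : choiceType) (F : seq T) (a : T -> \bar R) :
  uniq F -> (forall i, 0 <= a i)%E ->
  (\esum_(i in [set: T]) a i = \sum_(i <- F) a i + \esum_(i in ~` [set` F]) a i)%E.
Proof.
move=> uF a0; rewrite (esumID [set` F]) // !setTI; congr (_ + _)%E.
rewrite esum_fset //.
rewrite fsbig_finite //=.
apply: perm_big; apply: uniq_perm => // i.
by rewrite in_fset_set ?mem_setE //.
Qed.

(** Outside [F] the two sums coincide and are finite, so they cancel. *)
Lemma esum_sub_seq (R : realType) (T : choiceType) (F : seq T) (a b : T -> \bar R) (x y : R) :
  uniq F -> (forall i, 0 <= a i)%E -> (forall i, 0 <= b i)%E ->
  (forall i, i \notin F -> a i = b i) ->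
  \esum_(i in [set: T]) a i = x%:E -> \esum_(i in [set: T]) b i = y%:E ->
  x - y = \sum_(i <- F) (fine (a i) - fine (b i)).
Proof.
move=> uF a0 b0 ab; rewrite !(esum_seqID uF) // => ax by_.
have fa i : a i \is a fin_num.
  rewrite ge0_fin_numE //; apply: le_lt_trans (le_esum1 i a0) _.
  by rewrite (esum_seqID uF) // ax ltry.
have fb i : b i \is a fin_num.
  rewrite ge0_fin_numE //; apply: le_lt_trans (le_esum1 i b0) _.
  by rewrite (esum_seqID uF) // by_ ltry.
have E : \esum_(i in ~` [set` F]) b i = \esum_(i in ~` [set` F]) a i.
  by apply: eq_esum => i /= /negP iF; rewrite ab.
move: by_; rewrite E => by_.
have Sa : (\sum_(i <- F) a i)%E = (\sum_(i <- F) fine (a i))%:E.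
  by rewrite -sumEFin; apply: eq_bigr => i _; rewrite fineK.
have Sb : (\sum_(i <- F) b i)%E = (\sum_(i <- F) fine (b i))%:E.
  by rewrite -sumEFin; apply: eq_bigr => i _; rewrite fineK.
move: ax by_; rewrite Sa Sb sumrB.
have : (0 <= \esum_(i in ~` [set` F]) a i)%E by exact: esum_ge0.
case: (esum _ _) => [r _ []<- []<-|_|//]; last by [].
by ring.
Qed.

(** * First variation along piecewise linear functions *)

Section PiecewiseLinearTests.
Variables (R : realType) (p lam : R) (G : metricGraph R) (Z : set (vertex G)).
Hypothesis bdd : forall e : edge G, (len e < +oo)%E.
Hypothesis lam0 : 0 < lam.
Implicit Types (e : edge G) (u v w : gpoint G -> R).

Local Notation HZ := (@H1dy R lam G Z).
Local Notation A := (@h1form R lam G).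

Variables (fV : vertex G -> R) (qs : edge G -> seq (R * R)) (c : edge G -> R).
Variable F : seq (edge G).
Hypothesis uF : uniq F.
Hypothesis bpt : forall e q, q \in qs e -> 0 <= q.2 <= elen e.
Hypothesis psrc : forall e, pwl (qs e) (c e) 0 = fV (src e).
Hypothesis phead : forall e, pwl (qs e) (c e) (elen e) = fV (vhead e).
Hypothesis poff : forall e t, e \notin F -> 0 <= t <= elen e -> pwl (qs e) (c e) t = 0.
Hypothesis pZ : forall v : vertex G, Z v -> fV v = 0.

Definition pwtest : gpoint G -> R := edge_glue fV (fun e => pwl (qs e) (c e)).

Let lam_ge0 : 0 <= lam := ltW lam0.
Let L0 e : 0 < elen e := elen_gt0 bdd e.

Lemma on_edge_pwtest e t : 0 <= t <= elen e -> on_edge pwtest e t = pwl (qs e) (c e) t.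
Proof. by move=> tI; rewrite /pwtest on_edge_glue // clamp_id. Qed.

Lemma continuous_pwtest : continuous pwtest.
Proof. by apply: continuous_glue => // e; exact: continuous_pwl. Qed.

Lemma ee_pwtest_lty e : (ee 1 lam (elen e) (on_edge pwtest e) < +oo)%E.
Proof.
rewrite (@eq_ee _ _ _ _ _ (pwl (qs e) (c e))) // => [|t tI]; last exact: on_edge_pwtest.
rewrite /ee mul1e; have := Den_pwl_lty (qs e) (c e) (L0 e).
have := Den_ge0 (pwl (qs e) (c e)) (L0 e).
by case: (Den _ _) => [d _ _|_|//]; [rewrite -EFinD ltry|rewrite ltxx].
Qed.

Lemma ee_pwtest_off e : e \notin F -> ee 1 lam (elen e) (on_edge pwtest e) = 0%E.
Proof.
move=> eF; rewrite (@eq_ee _ _ _ _ _ (fun t => 0 * 0)) //; last first.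
  by move=> t tI; rewrite on_edge_pwtest // poff // mulr0.
rewrite (@ee_scale _ _ _ _ _ _ 0 (cst 0)) ?expr0n ?mul0e //.
by move=> x; exact: cvg_cst.
Qed.

Lemma HZ_pwtest : HZ pwtest.
Proof.
split; [exact: continuous_pwtest| |by move=> v Zv; exact: pZ].
have -> : En 1 lam pwtest = \esum_(e in [set: edge G]) ee 1 lam (elen e) (on_edge pwtest e).
  exact: EnE.
rewrite (esum_seqID uF); last by move=> e; exact: ee_ge0.
rewrite [X in (_ + X)%E]esum1 ?adde0; last first.
  by move=> e /= /negP eF; exact: ee_pwtest_off.
elim: (F) => [|e s IH]; first by rewrite big_nil ltry.
by rewrite big_cons lte_add_pinfty // ee_pwtest_lty.
Qed.

(** The increment of [A] is [2 s B + s^2 C], where [B] is the sum in the conclusion. Minimality is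
    known for [s > 0] only, whence an inequality. *)
Lemma first_variation v : HZ v ->
  (forall s, 0 < s -> A v <= A (fun x => v x + s * pwtest x)) ->
  0 <= \sum_(e <- F) (\sum_(q <- qs e) q.1 * (on_edge v e q.2 - on_edge v e 0) +
    lam * ig 0 (elen e) (fun t => on_edge v e t * pwl (qs e) (c e) t)).
Proof.
move=> Hv min; set B := \sum_(e <- F) _; have [cv _ _] := Hv.
pose C := \sum_(e <- F) fine (ee 1 lam (elen e) (pwl (qs e) (c e))).
have main s : 0 < s -> 0 <= 2 * s * B + s ^+ 2 * C.
  move=> s0; have [_ Hvs] := HZ_comb bdd lam0 s0 Hv HZ_pwtest.
  have := AE bdd lam0 Hvs; have := AE bdd lam0 Hv; rewrite !EnE => E1 E2.
  apply: (@le_trans _ _ (A (fun x => v x + s * pwtest x) - A v)).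
    by rewrite subr_ge0 min.
  rewrite (esum_sub_seq uF _ _ _ E2 E1); first last.
  - move=> e eF; apply: eq_ee => // t tI; rewrite /on_edge.
    by have := on_edge_pwtest tI; rewrite /on_edge poff // => ->; rewrite mulr0 addr0.
  - by move=> e; exact: ee_ge0.
  - by move=> e; exact: ee_ge0.
  rewrite le_eqVlt; apply/orP; left; apply/eqP.
  rewrite /B /C !big_distrr -big_split /=; apply: eq_bigr => e _.
  have ce := continuous_on_edge (e := e) cv.
  have cp : continuous (pwl (qs e) (c e)) by exact: continuous_pwl.
  have dv : (Den (elen e) (on_edge v e) < +oo)%E.
    by case: Hv => _ vy _; exact: (@En_lty1 _ _ bdd 1 lam v e ltr01 lam_ge0 vy).
  have -> : ee 1 lam (elen e) (on_edge (fun x => v x + s * pwtest x) e) =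
      ee 1 lam (elen e) (fun t => on_edge v e t + s * pwl (qs e) (c e) t).
    by apply: eq_ee => // t tI; rewrite -on_edge_pwtest.
  rewrite /ee !mul1e (Den_pwl_expand (c e) s (L0 e) ce dv (@bpt e)).
  have := Den_pwl_lty (qs e) (c e) (L0 e); have := Den_ge0 (pwl (qs e) (c e)) (L0 e).
  case: (Den _ (pwl _ _)) => [d _ _|_|//]; last by rewrite ltxx.
  have := Den_ge0 (on_edge v e) (L0 e); move: dv.
  case: (Den _ (on_edge v e)) => [dv' _ _|//|//].
  rewrite -!EFinM -!EFinD /=.
  rewrite (ig_axpy_sqr s (L2_continuous 0 (elen e) ce) (L2_continuous 0 (elen e) cp)).
  by ring.
rewrite leNgt; apply/negP => B0.
have C0 : 0 <= C.
  apply: sumr_ge0 => e _; rewrite fine_ge0 // ee_ge0 //.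
(* If [B < 0], this [s] satisfies [s C <= - B], so the increment is at most [s B < 0]. *)
have s0 : 0 < - B / (C + 1) by rewrite divr_gt0 // ?oppr_gt0 // ltr_wpDl.
have := main _ s0; rewrite leNgt => /negP; apply.
set s := - B / (C + 1) in s0 *.
have sC : s * (C + 1) = - B by rewrite /s divfK // gt_eqF // ltr_wpDl.
have : s * C <= - B by rewrite -sC ler_pM2l //; lra.
rewrite expr2; nra.
Qed.

End PiecewiseLinearTests.

(** * Existence of a maximizer *)

(** Bounded families converge along an ultrafilter, which gives pointwise limits at uncountably many
    points without extracting subsequences. *)
Lemma ultra_bounded_cvg (T : Type) (F : set_system T) (R : realType) (f : T -> R) (M : R) :
  UltraFilter F -> (forall x, `|f x| <= M) -> exists l : R, f @ F --> l.
Proof.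
move=> UF fM.
have [|l [_ cl]] := @segment_compact R (- M) M (f @ F) _.
  apply: (@filterS _ F _ setT); last exact: filterT.
  by move=> x _; rewrite /= in_itv/= -ler_norml fM.
exists l => B lB; have [//|nB] := in_ultra_setVsetC (f @^-1` B) UF.
by have [y [/= nBy /nBy]] := cl (~` B) B nB lB.
Qed.

(** With [x = |a|] and [y = |b|], write [(x + y)^p = x (x + y)^(p-1) + y (x + y)^(p-1)] and use the
    tangent bound at [x] in the first term and at [y] in the second: the only errors are multiples
    of [x y]. *)
Lemma powR_add_le (R : realType) (p M a b : R) : 2 < p -> `|a| <= M -> `|b| <= M ->
  `|a + b| `^ p <= `|a| `^ p + `|b| `^ p + 2 * (p * (2 * M) `^ (p - 2)) * (`|a| * `|b|).
Proof.
move=> p2; have p0 : 0 < p by lra.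
have q1 : 1 < p - 1 by lra.
have q0 : 0 < p - 1 by lra.
move: `|a| `|b| (normr_ge0 a) (normr_ge0 b) (ler_normD a b) => x y x0 y0 xy xM yM.
have M0 : 0 <= M := le_trans x0 xM.
(* Young's inequality [z^(q-1) x <= (1 - 1/q) z^q + x^q / q] is the tangent bound for [z^q] *)
have tangent (s d : R) : 0 <= s -> 0 <= d -> s + d <= 2 * M ->
    (s + d) `^ (p - 1) <= s `^ (p - 1) + p * (2 * M) `^ (p - 2) * d.
  move=> s0 d0 sdM; set z := s + d; have z0 : 0 <= z by rewrite addr_ge0.
  have E : z `^ (p - 1) = z `^ (p - 2) * z.
    by rewrite -{3}(powRr1 z0) -powRD; [congr (_ `^ _); ring|rewrite gt_eqF //; lra].
  have Y : z `^ (p - 2) * s <= (p - 2) / (p - 1) * z `^ (p - 1) + (p - 1)^-1 * s `^ (p - 1).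
    have := @conjugate_powR R (z `^ (p - 2)) s ((p - 1) / (p - 2)) (p - 1) (powR_ge0 _ _) s0.
    rewrite -powRrM mulrCA divff ?mulr1; last by rewrite gt_eqF //; lra.
    rewrite invf_div => H; rewrite [_ * z `^ _]mulrC [(p - 1)^-1 * _]mulrC; apply: H => //.
      by rewrite divr_gt0 //; lra.
    by field; rewrite gt_eqF.
  have zM : z `^ (p - 2) <= (2 * M) `^ (p - 2).
    by rewrite ge0_ler_powR // ?nnegrE //; lra.
  have q0' : p - 1 != 0 by rewrite gt_eqF.
  have Y2 : (p - 1) * (z `^ (p - 2) * s) <= (p - 2) * z `^ (p - 1) + s `^ (p - 1).
    have -> : (p - 2) * z `^ (p - 1) + s `^ (p - 1) =
      (p - 1) * ((p - 2) / (p - 1) * z `^ (p - 1) + (p - 1)^-1 * s `^ (p - 1)) by field.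
    by rewrite ler_pM2l.
  have ds : s = z - d by rewrite /z; ring.
  have H : (p - 1) * z `^ (p - 2) * d <= p * (2 * M) `^ (p - 2) * d.
    by rewrite ler_wpM2r // ler_pM ?powR_ge0 //; lra.
  move: Y2 H; rewrite E ds; move: (z `^ _) ((z - d) `^ _) ((2 * M) `^ _) => Zp S B.
  by lra.
have := tangent x y x0 y0; have := tangent y x y0 x0.
have X (s : R) : 0 <= s -> s `^ p = s * s `^ (p - 1).
  by move=> s0; rewrite -{2}(powRr1 s0) -powRD; [congr (_ `^ _); ring|rewrite gt_eqF //; lra].
rewrite [y + x]addrC => T1 T2.
apply: (@le_trans _ _ ((x + y) `^ p)).
  by rewrite ge0_ler_powR ?nnegrE // ?addr_ge0 // ltW.
have {}T1 := T1 _; have {}T1 : (x + y) `^ (p - 1) <= y `^ (p - 1) + p * (2 * M) `^ (p - 2) * x by apply: T1; lra.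
have {}T2 : (x + y) `^ (p - 1) <= x `^ (p - 1) + p * (2 * M) `^ (p - 2) * y by apply: T2; lra.
rewrite (X _ (addr_ge0 x0 y0)) (X x) // (X y) //.
move: T1 T2; move: ((x + y) `^ _) (x `^ _) (y `^ _) (p * _) => a1 b1 c1 d1 T1 T2.
have := ler_wpM2l x0 T2; have := ler_wpM2l y0 T1; lra.
Qed.

Lemma sqr_le_norm (R : realDomainType) (x y : R) : 0 <= y -> x ^+ 2 <= y ^+ 2 -> `|x| <= y.
Proof. by move=> y0 xy; rewrite -(@ler_pXn2r _ 2) ?nnegrE // real_normK ?num_real. Qed.

(** Equicontinuity reduces uniform closeness to closeness at a finite grid, whose mesh [d] allows an
    oscillation of at most [e / 3] between neighbouring nodes. *)
Lemma hoelder_uniform (R : realType) (T : Type) (U : set_system T) {FU : ProperFilter U}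
    (g : T -> R -> R) (f : R -> R) (l B e : R) :
  0 < l -> 0 <= B ->
  (forall n s t, 0 <= s <= l -> 0 <= t <= l -> (g n t - g n s) ^+ 2 <= B * `|t - s|) ->
  (forall t, 0 <= t <= l -> g ^~ t @ U --> f t) ->
  0 < e -> \forall n \near U, forall t, 0 <= t <= l -> `|g n t - f t| <= e.
Proof.
move=> l0 B0 gH gf e0.
have fH s t : 0 <= s <= l -> 0 <= t <= l -> (f t - f s) ^+ 2 <= B * `|t - s|.
  move=> sI tI; apply: (@closed_cvg _ _ U FU (fun n => (g n t - g n s) ^+ 2)
    [set y | y <= B * `|t - s|]); first exact: closed_le.
    by apply: nearW => n; exact: gH.
  by rewrite expr2; under eq_fun do rewrite expr2; apply: cvgM; apply: cvgB; exact: gf.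
have d0 : 0 < (e / 3) ^+ 2 / (B + 1) by rewrite divr_gt0 ?exprn_gt0 ?divr_gt0 // ltr_wpDl.
set d := _ / (B + 1) in d0.
pose N := Num.truncn (l / d); pose x (i : 'I_N.+1) : R := i%:R * d.
have dB : B * d <= (e / 3) ^+ 2.
  rewrite /d mulrCA ler_piMr ?sqr_ge0 //; rewrite ler_pdivrMr ?mul1r ?lerDl //.
  by rewrite ltr_wpDl.
have cvx : \forall n \near U, forall i, x i <= l -> `|g n (x i) - f (x i)| <= e / 3.
  apply: filter_forall => i; have [xl|lx] := leP (x i) l; last first.
    by apply: nearW => n.
  have xI : 0 <= x i <= l by rewrite xl andbT mulr_ge0 // ltW.
  have e3 : 0 < e / 3 by rewrite divr_gt0.
  have /cvgrPdist_le/(_ _ e3) := gf _ xI.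
  by apply: filterS => n; rewrite distrC.
apply: filterS cvx => n H t tI; have /andP[t0 tl] := tI.
have td0 : 0 <= t / d by rewrite divr_ge0 // ltW.
have /andP[it ti] := truncn_itv td0.
set i := Num.truncn (t / d) in it ti.
have iN : (i < N.+1)%N.
  by rewrite ltnS /i /N le_truncn // ler_wpM2r // invr_ge0 ltW.
have xt : x (Ordinal iN) <= t by rewrite /x /= -ler_pdivlMr.
have tx : t - x (Ordinal iN) <= d.
  move: ti; rewrite ltr_pdivrMr // -natr1 mulrDl mul1r /x /= => ?; lra.
have xI : 0 <= x (Ordinal iN) <= l by rewrite mulr_ge0 ?(ltW d0) //= (le_trans xt).
have := H (Ordinal iN); move: (x _) xt tx xI => y yt ty yI /(_ (proj2 (andP yI))) Hy.
have e3 : 0 <= e / 3 by rewrite divr_ge0 // ltW.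
have close h : (h t - h y) ^+ 2 <= B * `|t - y| -> `|h t - h y| <= e / 3.
  move=> H2; apply: sqr_le_norm => //; apply: (le_trans H2); apply: le_trans dB.
  by rewrite ler_wpM2l // ger0_norm // subr_ge0.
have G1 := close (g n) (gH n y t yI tI); have F1 := close f (fH y t yI tI).
have -> : g n t - f t = (g n t - g n y) + (g n y - f y) - (f t - f y) by ring.
apply: le_trans (ler_normB _ _) _; apply: le_trans (lerD (ler_normD _ _) (lexx _)) _.
by lra.
Qed.

Lemma cvg_igsq (R : realType) (T : Type) (U : set_system T) {FU : ProperFilter U}
    (g : T -> R -> R) (f : R -> R) (l : R) :
  0 < l -> (forall n, continuous (g n)) -> continuous f ->
  (forall e, 0 < e -> \forall n \near U, forall t, 0 <= t <= l -> `|g n t - f t| <= e) ->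
  ig 0 l (fun t => g n t ^+ 2) @[n --> U] --> ig 0 l (fun t => f t ^+ 2).
Proof.
move=> l0 cg cf gf; apply/cvgrPdist_le => e e0.
have [M M0 fM] := cbounded l cf.
have C0 : 0 < l * (2 * M + 1) by rewrite mulr_gt0 // ltr_wpDl // mulr_ge0.
pose d := Num.min 1 (e / (l * (2 * M + 1))).
have d0 : 0 < d by rewrite lt_min ltr01 divr_gt0.
have d1 : d <= 1 by rewrite ge_min lexx.
have dC : d * (2 * M + 1) * l <= e.
  by rewrite -mulrA [_ * l]mulrC -ler_pdivlMr // ge_min lexx orbT.
apply: filterS (gf d d0) => n H.
have [_ fi] := L2_continuous 0 l cf; have [_ gi] := L2_continuous 0 l (cg n).
rewrite -igB //; apply: le_trans (le_norm_ig (intgB fi gi)) _.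
apply: le_trans dC; have -> : d * (2 * M + 1) * l = ig 0 l (fun=> d * (2 * M + 1)).
  by rewrite ig_cst ?subr0 // ltW.
apply: le_ig; [exact/intg_norm/intgB|exact: intg_cst|move=> t /andP[t0 tl]].
have tI : 0 <= t <= l by rewrite t0 ltW.
have -> : f t ^+ 2 - g n t ^+ 2 = - (g n t - f t) * ((g n t - f t) + 2 * f t) by ring.
rewrite normrM normrN ler_pM ?H //.
apply: le_trans (ler_normD _ _) _; rewrite normrM (ger0_norm (_ : 0 <= 2)) //.
have := H t tI; have := fM t tI; lra.
Qed.

(** * Lower semicontinuity of the energies *)

Section LowerSemicontinuity.
Variables (R : realType) (G : metricGraph R).
Hypothesis bdd : forall e : edge G, (len e < +oo)%E.
Variables (T : Type) (U : set_system T).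
Context {FU : ProperFilter U}.
Implicit Types (e : edge G) (u v : gpoint G -> R).

Definition edge_ucvg (v_ : T -> gpoint G -> R) v := forall e (d : R), 0 < d ->
  \forall n \near U, forall t, 0 <= t <= elen e -> `|on_edge (v_ n) e t - on_edge v e t| <= d.

Lemma edge_ucvg_ptw (v_ : T -> gpoint G -> R) v e t : edge_ucvg v_ v -> on_edge (v_ n) e t @[n --> U] --> on_edge v e t.
Proof.
move=> uv; apply/cvgrPdist_le => d d0; apply: filterS (uv e d d0) => n H.
rewrite /on_edge ep_clamp // distrC; apply: H; apply: clamp_itv; exact: elen_gt0.
Qed.

(** Some [Qe] already exceeds [c] at [v], and it is continuous for uniform convergence on its
    finitely many edges. *)
Lemma En_lsc (al be c : R) (v_ : T -> gpoint G -> R) v : 0 <= al -> 0 <= be -> (forall n, continuous (v_ n)) ->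
  continuous v -> edge_ucvg v_ v -> (c%:E < En al be v)%E ->
  \forall n \near U, (c%:E < En al be (v_ n))%E.
Proof.
move=> al0 be0 cv_ cv uv /(En_gt_Qe bdd al0 be0)[s [k [us cQ]]].
have Qcv : Qe al be s k (v_ n) @[n --> U] --> Qe al be s k v.
  rewrite /Qe; elim: (s) => [|e s' IH].
    by rewrite big_nil; under eq_fun do rewrite big_nil; exact: cvg_cst.
  rewrite big_cons; under eq_fun do rewrite big_cons; apply: cvgD => //.
  apply: cvgD; apply: cvgM; try exact: cvg_cst.
    by apply: (@cvg_dyE _ _ _ _ (fun n => on_edge (v_ n) e)) => t; exact: edge_ucvg_ptw.
  apply: (@cvg_igsq _ _ _ _ (fun n => on_edge (v_ n) e)); first exact: elen_gt0.
  - by move=> n; exact: continuous_on_edge.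
  - exact: continuous_on_edge.
  - exact: uv.
have : \forall n \near U, c < Qe al be s k (v_ n) by exact: (cvgr_gt _ Qcv).
by apply: filterS => n H; apply: lt_le_trans (Qe_le_En bdd al0 be0 k (v_ n) us).
Qed.

End LowerSemicontinuity.

Lemma le_esum_comb (R : realType) (T : choiceType) (D S : R) (a b c d f g : T -> \bar R) :
  0 <= D -> 0 <= S -> (forall i, 0 <= a i)%E -> (forall i, 0 <= b i)%E ->
  (forall i, 0 <= c i)%E -> (forall i, 0 <= d i)%E -> (forall i, 0 <= f i)%E ->
  (forall i, 0 <= g i)%E ->
  (forall i, a i + D%:E * b i <= c i + d i + D%:E * (S%:E * f i + g i))%E ->
  ((\esum_(i in [set: T]) a i) + D%:E * (\esum_(i in [set: T]) b i) <=
   (\esum_(i in [set: T]) c i) + (\esum_(i in [set: T]) d i) +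
   D%:E * (S%:E * (\esum_(i in [set: T]) f i) + (\esum_(i in [set: T]) g i)))%E.
Proof.
move=> D0 S0 a0 b0 c0 d0 f0 g0 H.
have Db i : (0 <= D%:E * b i)%E by rewrite mule_ge0 ?lee_fin.
have Sf i : (0 <= S%:E * f i)%E by rewrite mule_ge0 ?lee_fin.
have Sfg i : (0 <= S%:E * f i + g i)%E by exact: adde_ge0.
have DS i : (0 <= D%:E * (S%:E * f i + g i))%E by rewrite mule_ge0 ?lee_fin.
have cd i : (0 <= c i + d i)%E by exact: adde_ge0.
rewrite -(esumZ S0 f0) -(esumD (fun i _ => Sf i) (fun i _ => g0 i)).
rewrite -(esumZ D0 Sfg) -(esumZ D0 b0) -(esumD (fun i _ => a0 i) (fun i _ => Db i)).
rewrite -(esumD (fun i _ => c0 i) (fun i _ => d0 i)).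
rewrite -(esumD (fun i _ => cd i) (fun i _ => DS i)).
by apply: le_esum => i _; exact: H.
Qed.

(** The value of [D] turns the cross term of [powR_add_le] into [D * (2 s |f| |h - f|)], which is
    then expressed by squares. *)
Lemma ig_powR_split (R : realType) (p l M s : R) (f h : R -> R) : 2 < p -> 0 < l -> 0 < s ->
  continuous f -> continuous h -> (forall t, `|f t| <= M) -> (forall t, `|h t - f t| <= M) ->
  forall D, D = p * (2 * M) `^ (p - 2) / s ->
  ig 0 l (fun t => `|h t| `^ p) + D * ig 0 l (fun t => (s * `|f t| - `|h t - f t|) ^+ 2) <=
  ig 0 l (fun t => `|f t| `^ p) + ig 0 l (fun t => `|h t - f t| `^ p) +
  D * (s ^+ 2 * ig 0 l (fun t => f t ^+ 2) + ig 0 l (fun t => (h t - f t) ^+ 2)).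
Proof.
move=> p2 l0 s0 cf ch fM hM D DE.
have p0 : 0 <= p by lra.
have cw : continuous (fun t => h t - f t) by move=> t; apply: cvgB; [exact: ch|exact: cf].
have cn (k : R -> R) : continuous k -> continuous (fun t => `|k t|).
  by move=> ck t; apply: (@continuous_comp _ _ _ k); [exact: ck|exact: norm_continuous].
have cd : continuous (fun t => s * `|f t| - `|h t - f t|).
  move=> t; apply: cvgB; last exact: (cn (fun t => h t - f t)).
  by apply: cvgM; [exact: cvg_cst|exact: cn].
have sq (k : R -> R) : continuous k -> intg 0 l (fun t => k t ^+ 2).
  by move=> ck; have [_] := L2_continuous 0 l ck.
have pw (k : R -> R) : continuous k -> intg 0 l (fun t => `|k t| `^ p) by exact: intg_pow.
have hp := pw _ ch; have fp := pw _ cf; have wp := pw _ cw.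
have dq := sq _ cd; have fq := sq _ cf; have wq := sq _ cw.
have Ddq := intgZ D dq; have sfq := intgZ (s ^+ 2) fq.
have sfw := intgD sfq wq; have Dsfw := intgZ D sfw; have fwp := intgD fp wp.
rewrite -(igZ _ dq) -(igZ _ fq) -(igD sfq wq) -(igZ _ sfw) -(igD hp Ddq) -(igD fp wp).
rewrite -(igD fwp Dsfw); apply: le_ig; [exact: intgD|exact: intgD|move=> t _].
have := powR_add_le p2 (fM t) (hM t); rewrite [f t + _]addrC subrK => H.
have -> : D * (s * `|f t| - `|h t - f t|) ^+ 2 =
   D * (s ^+ 2 * f t ^+ 2 + (h t - f t) ^+ 2) - 2 * (p * (2 * M) `^ (p - 2)) * (`|f t| * `|h t - f t|).
  rewrite -(real_normK (num_real (f t))) -(real_normK (num_real (h t - f t))).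
  by rewrite DE; field; rewrite gt_eqF.
by lra.
Qed.

Lemma powR_le_id (R : realType) (b q : R) : 0 <= b <= 1 -> 1 <= q -> b `^ q <= b.
Proof.
move=> /andP[]; rewrite le_eqVlt => /predU1P[<- _|b0 b1] q1.
  by rewrite powR0 // gt_eqF // (lt_le_trans ltr01).
by rewrite -[leRHS](powRr1 (ltW b0)) ger_powR // b0.
Qed.

(** * The best constant and limits of maximizing families *)

Section Maximization.
Variables (R : realType) (p lam : R) (G : metricGraph R) (Z : set (vertex G)).
Hypothesis bdd : forall e : edge G, (len e < +oo)%E.
Hypothesis cG : class_G G.
Hypothesis e0 : inhabited (edge G).
Hypothesis p2 : 2 < p.
Hypothesis lam0 : 0 < lam.
Implicit Types (e : edge G) (u v w : gpoint G -> R).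

Local Notation HZ := (@H1dy R lam G Z).
Local Notation A := (@h1form R lam G).
Local Notation P := (@lpow R p G).
Local Notation N2 := (@l2pow R G).
Let lam_ge0 : 0 <= lam := ltW lam0.

(* The best constant in [P <= Kmax * A^(p/2)]. *)
Definition Kmax : R := sup [set P u | u in [set u | HZ u /\ A u <= 1]].

Let M1 : R := Num.sqrt (csup lam G).

Lemma unit_bound u x : HZ u -> A u <= 1 -> `|u x| <= M1.
Proof.
move=> Hu Au; have [c0 _] := csupP bdd cG lam0.
apply: sqr_le_norm; rewrite ?sqrtr_ge0 // sqr_sqrtr ?(ltW c0) //.
apply: le_trans (sup_bound bdd cG e0 lam0 x Hu) _.
by rewrite ler_piMr // ltW.
Qed.

Lemma P_le_Kmax u : HZ u -> A u <= 1 -> P u <= Kmax.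
Proof.
move=> Hu Au; apply: ub_le_sup; last by exists u.
exists (M1 `^ (p - 2) / lam) => _ [v [Hv Av] <-].
apply: le_trans (P_le_sup bdd cG e0 p2 lam0 Hv (sqrtr_ge0 _) _) _.
  by move=> e t _; exact: unit_bound.
by rewrite ler_piMr // divr_ge0 ?powR_ge0.
Qed.

Lemma Kmax_approx c : c < Kmax -> exists u, [/\ HZ u, A u <= 1 & c < P u].
Proof.
move=> cK; have [H0 A0] := HZ_0 Z bdd lam0.
have := @sup_adherent R [set P u | u in [set u | HZ u /\ A u <= 1]] (Kmax - c).
case; rewrite ?subr_gt0 //; last first.
  by move=> _ [u [Hu Au] <-]; rewrite subKr => cP; exists u.
split; first by exists (P (cst 0)), (cst 0); rewrite //= A0.
by exists Kmax => _ [v [Hv Av] <-]; exact: P_le_Kmax.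
Qed.

Lemma A_eq0 u : HZ u -> A u = 0 -> u = cst 0.
Proof.
move=> Hu Au; apply: contrapT => u0.
by have [_ _] := HZ_nonzero bdd cG e0 p2 lam0 Hu u0; rewrite Au ltxx.
Qed.

Lemma P_cst0 : P (cst 0) = 0.
Proof.
have [H0 _] := HZ_0 Z bdd lam0; have := P_scale bdd cG e0 p2 lam0 0 H0.
rewrite normr0 powR0 ?mul0r; last by rewrite gt_eqF // (lt_trans _ p2).
by under eq_fun do rewrite mul0r.
Qed.

Lemma powR_sqrt (a q : R) : 0 <= a -> Num.sqrt a `^ q = a `^ (q / 2).
Proof. by move=> a0; rewrite -powR12_sqrt // -powRrM mulrC. Qed.

Lemma normalize u : HZ u -> 0 < A u ->
  exists v, [/\ HZ v, A v = 1 & P u = P v * A u `^ (p / 2)].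
Proof.
move=> Hu Au; have s0 : 0 < Num.sqrt (A u) by rewrite sqrtr_gt0.
exists (fun x => (Num.sqrt (A u))^-1 * u x).
have Hv := HZ_scale bdd lam0 (Num.sqrt (A u))^-1 Hu; split => //.
  by rewrite (A_scale bdd lam0 _ Hu) exprVn sqr_sqrtr ?ltW // mulVf // gt_eqF.
rewrite (P_scale bdd cG e0 p2 lam0 _ Hu) ger0_norm ?invr_ge0 ?ltW //.
rewrite -powR_sqrt ?ltW // mulrAC -powRM ?invr_ge0 ?ltW //.
by rewrite mulVf ?gt_eqF // powR1 mul1r.
Qed.

Lemma P_le_Kmax_pow u : HZ u -> P u <= Kmax * A u `^ (p / 2).
Proof.
move=> Hu; have : 0 <= A u by exact: A_ge0.
rewrite le_eqVlt => /predU1P[A0|Au].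
  rewrite (A_eq0 Hu (esym A0)) P_cst0; apply: mulr_ge0; last exact: powR_ge0.
  have [H0 A00] := HZ_0 Z bdd lam0; rewrite -P_cst0; apply: P_le_Kmax => //.
  by rewrite A00.
have [v [Hv Av ->]] := normalize Hu Au.
by rewrite ler_wpM2r ?powR_ge0 // P_le_Kmax // Av.
Qed.

(* Brezis-Lieb splitting: the cross term is written as [2 s |u||w| = s^2 u^2 + w^2 - (s|u| - |w|)^2]
   so that the lower semicontinuity of the L^2 norm makes it vanish in the limit. *)
Lemma P_split u v (M s : R) : HZ u -> HZ v -> 0 < s ->
  (forall x, `|u x| <= M) -> (forall x, `|v x - u x| <= M) ->
  forall D, D = p * (2 * M) `^ (p - 2) / s ->
  P v + D * N2 (fun x => s * `|u x| - `|v x - u x|) <=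
  P u + P (fun x => v x - u x) + D * (s ^+ 2 * N2 u + N2 (fun x => v x - u x)).
Proof.
move=> Hu Hv s0 uM wM D DE; have [cu _ _] := Hu; have [cv _ _] := Hv.
have [Hw _] := HZ_comb bdd lam0 ltr01 Hv Hu.
have [Hau _] := HZ_abs bdd lam0 Hu; have [Haw _] := HZ_abs bdd lam0 Hw.
have [Hd _] := HZ_comb bdd lam0 ltr01 (HZ_scale bdd lam0 s Hau) Haw.
have p0 : 0 <= p by apply: ltW; apply: lt_trans p2.
have D0 : 0 <= D by rewrite DE divr_ge0 ?(ltW s0) // mulr_ge0 // powR_ge0.
have pw0 u' e : (0 <= (ig 0 (elen e) (fun t => `|on_edge u' e t| `^ p))%:E)%E.
  by rewrite lee_fin ig_ge0 // => x _; exact: powR_ge0.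
have en0 u' e : (0 <= ee 0 1 (elen e) (on_edge u' e))%E by apply: ee_ge0 => //; exact: elen_gt0.
pose d x := s * `|u x| - `|v x - u x|; pose w x := v x - u x.
have key : (Pw p v + D%:E * En 0 1 d <=
    Pw p u + Pw p w + D%:E * ((s ^+ 2)%:E * En 0 1 u + En 0 1 w))%E.
  rewrite !PwE !EnE; apply: (le_esum_comb D0 (sqr_ge0 s) (pw0 v) (en0 d) (pw0 u) (pw0 w)
    (en0 u) (en0 w)) => e.
  have cue := continuous_on_edge (e := e) cu; have cve := continuous_on_edge (e := e) cv.
  have H := ig_powR_split p2 (elen_gt0 bdd e) s0 cue cve (fun t => uM _) (fun t => wM _) DE.
  by rewrite /ee !mul0e !add0e !mul1r -!EFinM -!EFinD lee_fin.
rewrite (N2E bdd lam0 Hd : En 0 1 d = _) (N2E bdd lam0 Hu) (N2E bdd lam0 Hw : En 0 1 w = _) in key.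
rewrite (P_fin bdd cG e0 p2 lam0 Hv) (P_fin bdd cG e0 p2 lam0 Hu) in key.
rewrite (P_fin bdd cG e0 p2 lam0 Hw : Pw p w = _) in key.
move: key; move: (P v) (P u) (N2 u) (N2 _) (N2 _) (P _) => x1 x2 x3 x4 x5 x6.
by rewrite -!EFinM -!EFinD lee_fin.
Qed.

Lemma A_lt_lsc (T : Type) (U : set_system T) {FU : ProperFilter U} (v_ : T -> gpoint G -> R) v c :
  (forall n, HZ (v_ n)) -> HZ v -> edge_ucvg U v_ v -> c < A v ->
  \forall n \near U, c < A (v_ n).
Proof.
move=> Hv_ Hv uv cA; have [cv _ _] := Hv.
have := @En_lsc R G bdd T U FU 1 lam c v_ v ler01 lam_ge0 _ cv uv.
rewrite (AE bdd lam0 Hv) lte_fin => H.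
have {}H := H (fun n => let: And3 cn _ _ := Hv_ n in cn) cA.
by apply: filterS H => n; rewrite (AE bdd lam0 (Hv_ n)) lte_fin.
Qed.

Lemma N2_lt_lsc (T : Type) (U : set_system T) {FU : ProperFilter U} (v_ : T -> gpoint G -> R) v c :
  (forall n, HZ (v_ n)) -> HZ v -> edge_ucvg U v_ v -> c < N2 v ->
  \forall n \near U, c < N2 (v_ n).
Proof.
move=> Hv_ Hv uv cA; have [cv _ _] := Hv.
have := @En_lsc R G bdd T U FU 0 1 c v_ v (lexx _) ler01 _ cv uv.
rewrite (N2E bdd lam0 Hv) lte_fin => H.
have {}H := H (fun n => let: And3 cn _ _ := Hv_ n in cn) cA.
by apply: filterS H => n; rewrite (N2E bdd lam0 (Hv_ n)) lte_fin.
Qed.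

Lemma edge_ucvg_lip (T : Type) (U : set_system T) {FU : ProperFilter U}
    (v_ w_ : T -> gpoint G -> R) v w (c : R) : 0 < c -> edge_ucvg U v_ v ->
  (forall n x, `|w_ n x - w x| <= c * `|v_ n x - v x|) -> edge_ucvg U w_ w.
Proof.
move=> c0 uv H e d d0; apply: filterS (uv e (d / c) (divr_gt0 d0 c0)) => n Hn t tI.
by apply: le_trans (H _ _) _; rewrite mulrC -ler_pdivlMr // Hn.
Qed.

Lemma max_limit (T : Type) (U : set_system T) {FU : ProperFilter U}
    (v_ : T -> gpoint G -> R) v : 0 < Kmax ->
  (forall n, HZ (v_ n)) -> (forall n, A (v_ n) <= 1) -> HZ v -> v <> cst 0 ->
  edge_ucvg U v_ v -> (forall d, 0 < d -> \forall n \near U, Kmax - d < P (v_ n)) ->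
  A v = 1 /\ P v = Kmax.
Proof.
move=> K0 Hv_ Av_ Hv v0 uv PK.
have [_ _ a0] := HZ_nonzero bdd cG e0 p2 lam0 Hv v0; 
have [a aE] : exists a, A v = a by exists (A v).
rewrite aE in a0 *.
have a1 : a <= 1.
  rewrite leNgt; apply/negP => a1.
  have /filter_ex[n] : \forall n \near U, 1 < A (v_ n) by by apply: (A_lt_lsc Hv_ Hv uv); rewrite aE.
  by rewrite ltNge Av_.
pose w_ n := fun x => v_ n x - v x.
have Hw_ n : HZ (w_ n) by have [] := HZ_comb bdd lam0 ltr01 (Hv_ n) Hv.
have Aw d : 0 < d -> \forall n \near U, A (w_ n) <= 1 - a + d.
  (* After division by [s], the loss of 1 in the semicontinuity of [A] at [(1 + s) v] costs [s^-1],
     and so does the coefficient [1 + s^-1] of [A (v_ n)]; together they make [d]. *)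
  move=> d0; pose s := 2 / d; have s0 : 0 < s by rewrite divr_gt0.
  have H1 : HZ (fun x => (1 + s) * v x) by exact: HZ_scale.
  have A1 : A (fun x => (1 + s) * v x) = (1 + s) ^+ 2 * a by by rewrite (A_scale bdd lam0 _ Hv) aE.
  have : \forall n \near U, (1 + s) ^+ 2 * a - 1 < A (fun x => v_ n x + s * v x).
    apply: (@A_lt_lsc _ _ _ _ (fun x => (1 + s) * v x)) => //.
    - by move=> n; have [] := HZ_comb bdd lam0 s0 (Hv_ n) Hv.
    - apply: (@edge_ucvg_lip _ _ _ v_ _ v _ 1) => // n x.
      rewrite mul1r le_eqVlt; apply/orP; left; apply/eqP; congr (`|_|); ring.
    - by rewrite A1 ltrBlDr ltrDl.
  apply: filterS => n Hn.
  have := A_parallelogram bdd lam0 s0 (Hv_ n) Hv; rewrite aE -/(w_ n) => E.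
  have : s^-1 * ((1 + s) ^+ 2 * a - 1) <= s^-1 * A (fun x => v_ n x + s * v x).
    by rewrite ler_wpM2l ?invr_ge0 ?ltW.
  have : (1 + s^-1) * A (v_ n) <= 1 + s^-1.
    by rewrite ler_piMr ?Av_ // addr_ge0 ?invr_ge0 // ltW.
  have -> : s^-1 * ((1 + s) ^+ 2 * a - 1) = (1 + s) * a + s^-1 * a + a - s^-1.
    by field; rewrite gt_eqF.
  have : 0 <= s^-1 * a by apply: mulr_ge0; [rewrite invr_ge0|]; exact: ltW.
  have : s^-1 + s^-1 = d by rewrite /s invf_div; field.
  by move: E; move: (A (w_ n)) (A (v_ n)) (A _) (s^-1); clear - a; move=> x1 x2 x3 x5; lra.
have Av1 : A v <= 1 by rewrite aE.
have M10 : 0 <= M1 by exact: sqrtr_ge0.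
have vM x : `|v x| <= 2 * M1 by have := unit_bound x Hv Av1; lra.
have wM n x : `|v_ n x - v x| <= 2 * M1.
  apply: le_trans (ler_normB _ _) _.
  by have := unit_bound x Hv Av1; have := unit_bound x (Hv_ n) (Av_ n); lra.
have split d : 0 < d -> \forall n \near U, P (v_ n) <= P v + P (w_ n) + d.
  move=> d0; pose C := p * (2 * (2 * M1)) `^ (p - 2).
  have C0 : 0 <= C by rewrite mulr_ge0 ?powR_ge0 // ltW // (lt_trans _ p2).
  have l1 : 0 < lam^-1 + 1 by rewrite addr_gt0 ?invr_gt0.
  (* Semicontinuity leaves an error [(C / s) (N2 (w_ n) + 1)], and [N2 (w_ n) <= lam^-1] eventually;
     a large [s] makes it at most [d]. *)
  pose s := (C + 1) * (lam^-1 + 1) / d.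
  have s0 : 0 < s by rewrite divr_gt0 // mulr_gt0 // ltr_wpDl.
  have Ds : C / s * (lam^-1 + 1) <= d.
    have -> : C / s * (lam^-1 + 1) = C * (lam^-1 + 1) / s by rewrite mulrAC.
    rewrite ler_pdivrMr // /s mulrCA mulfV ?mulr1 ?gt_eqF //.
    by rewrite ler_wpM2r ?(ltW l1) // lerDl.
  have Hav : HZ (fun x => `|v x|) by case: (HZ_abs bdd lam0 Hv).
  have Hsav : HZ (fun x => s * `|v x|) by exact: HZ_scale.
  have Haw n : HZ (fun x => `|w_ n x|) by case: (HZ_abs bdd lam0 (Hw_ n)).
  have N2v : N2 (fun x => s * `|v x|) = s ^+ 2 * N2 v.
    have [cv _ _] := Hv; have [cav _ _] := Hav.
    apply: EFin_inj; rewrite -(N2E bdd lam0 Hsav) EFinM -(N2E bdd lam0 Hv) En_scale //.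
    rewrite !EnE; congr (_ * _)%E; apply: eq_esum => e _.
    by rewrite /ee !mul0e !add0e; congr (_ * _)%:E; apply: eq_ig => t _; rewrite /on_edge real_normK ?num_real.
  have L : \forall n \near U, s ^+ 2 * N2 v - 1 < N2 (fun x => s * `|v x| - `|w_ n x|).
    apply: (@N2_lt_lsc _ _ _ _ (fun x => s * `|v x|)) => //.
    - by move=> n; have [] := HZ_comb bdd lam0 ltr01 Hsav (Haw n).
    - apply: (@edge_ucvg_lip _ _ _ v_ _ v _ 1) => // n x.
      by rewrite mul1r addrAC subrr add0r normrN normr_id.
    - by rewrite N2v ltrBlDr ltrDl.
  apply: filterS2 L (Aw a a0) => n Ln An.
  have := P_split Hv (Hv_ n) s0 vM (wM n) (erefl _).
  have D0 : 0 <= C / s by rewrite divr_ge0 // ltW.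
  rewrite -/C -/(w_ n) => H; have := ler_wpM2l D0 (ltW Ln).
  have Nw : N2 (w_ n) <= lam^-1.
    have := lamN2_le bdd lam0 (Hw_ n); rewrite -ler_pdivlMl // => /le_trans; apply.
    have A1 : A (w_ n) <= 1 by rewrite subrK in An.
    by rewrite ler_piMr // invr_ge0 (ltW lam0).
  have := ler_wpM2l D0 Nw.
  move: H Ds; move: (C / s) (P (v_ n)) (P v) (P (w_ n)) (N2 (w_ n)) (s ^+ 2 * N2 v) (N2 _).
  clear Ln An N2v Nw Av1 aE D0 Hw_ Aw; move=> x1 x2 x3 x4 x5 x6 x7; lra.
have Pa : P v <= Kmax * a `^ (p / 2) by rewrite -aE; exact: P_le_Kmax_pow.
have KP : Kmax * a <= P v.
  apply/ler_addgt0Pr => d d0.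
  (* [h <= a] ensures [A (w_ n) <= 1], so that raising it to the power [p / 2] does not increase it;
     the errors add up to [h (Kmax + 2) <= d]. *)
  pose h := Num.min a (d / (Kmax + 2)).
  have K2 : 0 < Kmax + 2 by lra.
  have h0 : 0 < h by rewrite lt_min a0 divr_gt0.
  have ha : h <= a by rewrite ge_min lexx.
  have hd : h * (Kmax + 2) <= d by rewrite -ler_pdivlMr // ge_min lexx orbT.
  have /filter_ex[n [[n1 n2] n3]] : \forall n \near U, (A (w_ n) <= 1 - a + h /\
      P (v_ n) <= P v + P (w_ n) + h) /\ Kmax - h < P (v_ n).
    by apply: filterI; [apply: filterI; [exact: Aw|exact: split]|exact: PK].
  have : P (w_ n) <= Kmax * (1 - a + h).
    apply: le_trans (P_le_Kmax_pow (Hw_ n)) _; rewrite ler_pM2l //.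
    have w0 : 0 <= A (w_ n) by exact: A_ge0.
    apply: (le_trans _ n1); apply: powR_le_id; last by rewrite ler_pdivlMr // mul1r ltW.
    by rewrite w0 (le_trans n1) // -addrA gerDl addrC subr_le0.
  move: n2 n3 hd; move: (P (w_ n)) (P (v_ n)) (P v) => x1 x2 x3.
  by clear Pa aE Av1 n1; lra.
(* The two bounds give [a <= a^(p/2)] with [p / 2 > 1], impossible for [0 < a < 1]. *)
suff a1' : a = 1 by split => //; move: Pa KP; rewrite a1' powR1 mulr1; lra.
apply/eqP; rewrite eq_le a1 /= leNgt; apply/negP => al1.
have : a <= a `^ (p / 2) by rewrite -(ler_pM2l K0) (le_trans KP).
rewrite leNgt => /negP; apply.
have -> : a `^ (p / 2) = a * a `^ (p / 2 - 1).
  rewrite -{2}(powRr1 (ltW a0)) -powRD; first by congr (_ `^ _); ring.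
  by rewrite (gt_eqF a0) implybT.
rewrite gtr_pMr //.
have q0 : 0 < p / 2 - 1 by rewrite subr_gt0 ltr_pdivlMr // mul1r.
have := @gt0_ltr_powR R _ q0 a 1; rewrite powR1; apply; rewrite ?nnegrE ?ler01 //.
exact: ltW.
Qed.

End Maximization.

Section Tent.
Variable R : realType.
Implicit Types (h m t : R).

(** Slope changes, in the encoding of [pwl], of the tent of height 1 supported in
    [[m - h, m + h]]. *)
Definition tent m h : seq (R * R) := [:: (- h^-1, m - h); (2 / h, m); (- h^-1, m + h)].

Lemma tentE m h t : pwl (tent m h) 0 t =
  (2 * Num.min t m - Num.min t (m - h) - Num.min t (m + h)) / h.
Proof. by rewrite /pwl /tent !big_cons big_nil /=; ring. Qed.

Lemma tent_off m h t : 0 < h -> t <= m - h \/ m + h <= t -> pwl (tent m h) 0 t = 0.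
Proof.
move=> h0 H; rewrite tentE; apply/eqP; rewrite mulf_eq0; apply/orP; left; apply/eqP.
case: H => H; first by rewrite !min_l //; lra.
by rewrite !min_r //; lra.
Qed.

Lemma tent_center m h : 0 < h -> pwl (tent m h) 0 m = 1.
Proof.
move=> h0; rewrite tentE minxx min_r; last by lra.
by rewrite min_l; [field; rewrite gt_eqF|lra].
Qed.

Lemma tent_itv m h t : 0 < h -> 0 <= pwl (tent m h) 0 t <= 1.
Proof.
move=> h0; rewrite tentE divr_ge0 /=; [|by rewrite /Num.min; do 3![case: ltP => ?]; lra|exact: ltW].
rewrite ler_pdivrMr // mul1r.
by rewrite /Num.min; do 3![case: ltP => ?]; lra.
Qed.

Lemma tent_bpt m h l q : 0 <= m - h -> 0 < h -> m + h <= l -> q \in tent m h -> 0 <= q.2 <= l.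
Proof. by move=> a b c; rewrite !inE => /or3P[] /eqP -> /=; lra. Qed.

End Tent.

Section Existence.
Variables (R : realType) (p lam : R) (G : metricGraph R) (Z : set (vertex G)).
Hypothesis bdd : forall e : edge G, (len e < +oo)%E.
Hypothesis cG : class_G G.
Hypothesis e0 : inhabited (edge G).
Hypothesis p2 : 2 < p.
Hypothesis lam0 : 0 < lam.
Implicit Types (e : edge G) (u v w : gpoint G -> R).

Local Notation HZ := (@H1dy R lam G Z).
Local Notation A := (@h1form R lam G).
Local Notation P := (@lpow R p G).
Local Notation Kmax := (@Kmax R p lam G Z).

Definition edge_tent (e1 : edge G) (m h : R) : gpoint G -> R :=
  pwtest (fun=> 0) (fun e => if e == e1 then tent m h else [::]) (fun=> 0).

Section EdgeTent.
Variables (e1 : edge G) (m h : R).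
Hypothesis h0 : 0 < h.
Hypothesis mh : 0 <= m - h.
Hypothesis hm : m + h <= elen e1.

Let qs e := if e == e1 then tent m h else [::].

Lemma edge_tent_bpt e q : q \in qs e -> 0 <= q.2 <= elen e.
Proof. by rewrite /qs; case: eqVneq => [->|//]; exact: tent_bpt. Qed.

Lemma edge_tent_src e : pwl (qs e) 0 0 = 0.
Proof.
rewrite /qs; case: eqVneq => [_|_]; first by rewrite tent_off //; left.
by rewrite /pwl big_nil addr0.
Qed.

Lemma edge_tent_head e : pwl (qs e) 0 (elen e) = 0.
Proof.
rewrite /qs; case: eqVneq => [->|_]; first by rewrite tent_off //; right.
by rewrite /pwl big_nil addr0.
Qed.

Lemma edge_tent_off e t : e \notin [:: e1] -> 0 <= t <= elen e -> pwl (qs e) 0 t = 0.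
Proof.
by rewrite inE /qs => /negbTE -> _; rewrite /pwl big_nil addr0.
Qed.

Lemma HZ_edge_tent : HZ (edge_tent e1 m h).
Proof.
by apply: (@HZ_pwtest R lam G Z bdd lam0 (fun=> 0) qs (fun=> 0) [:: e1]) => //;
  [exact: edge_tent_src|exact: edge_tent_head|exact: edge_tent_off].
Qed.

Lemma edge_tent_center : edge_tent e1 m h (edge_point e1 m) = 1.
Proof.
rewrite -[LHS]/(on_edge _ e1 m) (on_edge_pwtest bdd edge_tent_src edge_tent_head).
  by rewrite /qs eqxx tent_center.
by have := h0; have := mh; have := hm; lra.
Qed.

End EdgeTent.

Lemma Kmax_gt0 : 0 < Kmax.
Proof.
case: e0 => e1; have L0 := elen_gt0 bdd e1.
have h0 : 0 < elen e1 / 2 by rewrite divr_gt0.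
have mh : 0 <= elen e1 / 2 - elen e1 / 2 by rewrite subrr.
have hm : elen e1 / 2 + elen e1 / 2 <= elen e1 by rewrite -splitr.
have Hu := HZ_edge_tent h0 mh hm.
have une : edge_tent e1 (elen e1 / 2) (elen e1 / 2) <> cst 0.
  move=> /(congr1 (fun f => f (edge_point e1 (elen e1 / 2)))).
  by rewrite edge_tent_center //= => /eqP; rewrite oner_eq0.
have [P0 _ A0] := HZ_nonzero bdd cG e0 p2 lam0 Hu une.
have [v [Hv Av Pv]] := normalize bdd cG e0 p2 lam0 Hu A0.
apply: lt_le_trans (P_le_Kmax bdd cG e0 p2 lam0 Hv _); last by rewrite Av.
have : 0 < P v * A (edge_tent e1 (elen e1 / 2) (elen e1 / 2)) `^ (p / 2) by rewrite -Pv.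
by rewrite pmulr_lgt0 // powR_gt0.
Qed.

(** The threshold [d] solves [d^(p-2) / lam = Kmax / 2], so a function bounded by [d] has
    [P u <= Kmax / 2]. *)
Lemma sup_lower_bound u : HZ u -> A u <= 1 -> Kmax / 2 < P u ->
  exists e t, 0 <= t <= elen e /\ (lam * (Kmax / 2)) `^ (p - 2)^-1 < `|on_edge u e t|.
Proof.
move=> Hu Au; set d := _ `^ _ => PK; apply: contrapT => N.
have K2 : 0 < Kmax / 2 by rewrite divr_gt0 // Kmax_gt0.
have dE : d `^ (p - 2) = lam * (Kmax / 2).
  rewrite /d -powRrM mulVf ?powRr1 //; first by rewrite mulr_ge0 // ltW.
  by rewrite gt_eqF // subr_gt0.
have B e t : 0 <= t <= elen e -> `|on_edge u e t| <= d.
  by move=> tI; rewrite leNgt; apply/negP => dt; apply: N; exists e, t.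
have := P_le_sup bdd cG e0 p2 lam0 Hu (powR_ge0 _ _ : 0 <= d) B.
rewrite dE [lam * _]mulrC mulfK ?gt_eqF // leNgt => /negP; apply.
by apply: le_lt_trans PK; rewrite ler_piMr // ltW.
Qed.

End Existence.

Lemma flip_itv (R : numDomainType) (b : bool) (l t : R) :
  0 <= t <= l -> 0 <= (if b then l - t else t) <= l.
Proof. by case: b => // /andP[t0 tl]; rewrite subr_ge0 gerBl tl t0. Qed.

(** * Compactness modulo translations *)

Section PeriodicExistence.
Variables (R : realType) (p lam : R) (G : metricGraph R) (n : nat).
Variables (act : 'rV[int]_n -> gpoint G -> gpoint G) (Z : set (vertex G)).
Hypothesis per : periodic_graph act.
Hypothesis perZ : periodic_vertices act Z.
Hypothesis cG : class_G G.
Hypothesis p2 : 2 < p.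
Hypothesis lam0 : 0 < lam.

Local Notation HZ := (@H1dy R lam G Z).
Local Notation A := (@h1form R lam G).
Local Notation P := (@lpow R p G).
Local Notation Kmax := (@Kmax R p lam G Z).
Let bdd := per_len per.
Let e0 := per_edge per.

Lemma maximizer_exists : exists u, [/\ HZ u, A u = 1 & P u = Kmax].
Proof.
have p0 : 0 < p by exact: lt_trans p2.
have K0 : 0 < Kmax := Kmax_gt0 Z bdd cG e0 p2 lam0.
have [F [finF orb]] := edge_orbits per.
set d := (lam * (Kmax / 2)) `^ (p - 2)^-1.
have d0 : 0 < d by rewrite powR_gt0 // mulr_gt0 // divr_gt0.
have [u_ u_P] : exists u_ : nat -> gpoint G -> R, forall j, [/\ HZ (u_ j), A (u_ j) <= 1,
    Kmax - j.+1%:R^-1 < P (u_ j) &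
    exists e t, [/\ F e, 0 <= t <= elen e & d < `|on_edge (u_ j) e t|]].
  suff /choice[f fP] : forall j : nat, exists u, [/\ HZ u, A u <= 1, Kmax - j.+1%:R^-1 < P u &
    exists e t, [/\ F e, 0 <= t <= elen e & d < `|on_edge u e t|]] by exists f.
  move=> j; have j0 : 0 < j.+1%:R^-1 :> R by rewrite invr_gt0.
  (* The first bound provides a point where [u] is not small, the second makes the sequence
     maximizing. *)
  have : Num.max (Kmax / 2) (Kmax - j.+1%:R^-1) < Kmax.
    by rewrite gt_max ltrBlDr ltrDl j0 andbT ltr_pdivrMr // ltr_pMr // ltr1n.
  move=> /(Kmax_approx bdd cG e0 p2 lam0)[u [Hu Au]]; rewrite gt_max => /andP[P1 P2].
  have [e [t [tI dt]]] := sup_lower_bound bdd cG e0 p2 lam0 Hu Au P1.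
  (* Moves the point where [|u|] exceeds [d] to one of the finitely many representative edges,
     reversing the parameter if the shift flips the edge. *)
  have [k [S [e' [Fe' Se']]]] := orb e.
  have [HS AS] := HZ_shift per perZ lam0 S Hu; have [cu _ _] := Hu.
  have PS : P (u \o shiftP S) = P u by exact: P_shift.
  exists (u \o shiftP S); split; [exact: HS|by rewrite AS|by rewrite PS; exact: P2|].
  have eE : elen e' = elen e by rewrite -Se' (shiftE_len S).
  exists e', (if flip S e' then elen e - t else t); split; first exact: Fe'.
    by rewrite eE; exact: flip_itv.
  have -> : on_edge (u \o shiftP S) e' (if flip S e' then elen e - t else t) = on_edge u e t.
    by rewrite on_edge_shift Se'; case: (flip S e'); rewrite ?subKr.
  exact: dt.
have Hu j : HZ (u_ j) by case: (u_P j).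
have Au j : A (u_ j) <= 1 by case: (u_P j).
have [U [UU sU]] := ultraFilterLemma (eventually_filter : ProperFilter \oo).
have FU : ProperFilter U by exact: ultra_proper.
have [v vP] : exists v : gpoint G -> R, forall x, u_ j x @[j --> U] --> v x.
  suff /choice[f fP] : forall x, exists y : R, u_ j x @[j --> U] --> y by exists f.
  by move=> x; apply: ultra_bounded_cvg => j; exact: (unit_bound bdd cG e0 lam0 x (Hu j) (Au j)).
have hold j e s t : 0 <= s <= elen e -> 0 <= t <= elen e ->
    (on_edge (u_ j) e t - on_edge (u_ j) e s) ^+ 2 <= 1 * `|t - s|.
  move=> sI tI; apply: le_trans (hoelder_edge bdd lam0 (Hu j) sI tI) _.
  by rewrite ler_wpM2r.
have uv : edge_ucvg U u_ v.
  move=> e eps eps0.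
  exact: (hoelder_uniform (g := fun j => on_edge (u_ j) e) (elen_gt0 bdd e) ler01
    (fun j s t => hold j e s t) (fun t _ => vP (edge_point e t)) eps0).
have cv : continuous v.
  apply: continuous_graph => e.
  have vhold s t : 0 <= s <= elen e -> 0 <= t <= elen e ->
      `|on_edge v e t - on_edge v e s| ^+ 2 <= `|t - s|.
    move=> sI tI; rewrite real_normK ?num_real //.
    apply: (@closed_cvg _ _ U FU (fun j => (on_edge (u_ j) e t - on_edge (u_ j) e s) ^+ 2)
      [set y | y <= `|t - s|]); first exact: closed_le.
      by apply: nearW => j; rewrite /= -[leRHS]mul1r hold.
    by rewrite expr2; under eq_fun do rewrite expr2; apply: cvgM; apply: cvgB; exact: vP.
  move=> t; apply/cvgrPdist_le => eps eps0.
  near=> s.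
  rewrite /on_edge (ep_clamp bdd e s) (ep_clamp bdd e t).
  have L0 := elen_gt0 bdd e.
  apply: sqr_le_norm; first exact: ltW.
  rewrite -real_normK ?num_real //; apply: le_trans (vhold _ _ _ _) _; try exact: clamp_itv.
  near: s.
  have : clamp (elen e) s @[s --> t] --> clamp (elen e) t by exact: continuous_clamp.
  by move/cvgrPdist_le => /(_ (eps ^+ 2) (exprn_gt0 2 eps0)).
have Zv x : Z x -> v (Vert x) = 0.
  move=> Zx; apply: cvg_unique (vP (Vert x)) _; first exact: norm_hausdorff.
  have -> : (fun j => u_ j (Vert x)) = cst 0.
    by apply/funext => j; have [_ _ /(_ x Zx) ->] := Hu j.
  exact: cvg_cst.
have A1 : (En 1 lam v <= 1%:E)%E.
  rewrite leNgt; apply/negP => A1; have lam_ge0 := ltW lam0.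
  have cu_ j : continuous (u_ j) by case: (Hu j).
  have /filter_ex[j] : \forall j \near U, (1%:E < En 1 lam (u_ j))%E.
    exact: (En_lsc bdd ler01 lam_ge0 cu_ cv uv A1).
  by apply/negP; rewrite -leNgt (AE bdd lam0 (Hu j)) lee_fin.
have Hv : HZ v by split => //; apply: le_lt_trans A1 (ltry _).
(* Uniform convergence to 0 on the finitely many edges of [F] would contradict the lower bound
   [d]. *)
have v0 : v <> cst 0.
  move=> v0.
  have : \forall j \near U, forall e, F e -> forall t, 0 <= t <= elen e ->
      `|on_edge (u_ j) e t| <= d.
    have /finite_seqP[s Fs] := finF.
    suff : \forall j \near U, forall e, e \in s -> forall t, 0 <= t <= elen e ->
        `|on_edge (u_ j) e t| <= d.
      by apply: filterS => j H e; rewrite Fs /= => es; exact: H.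
    elim: (s) => [|e s' IH]; first exact: nearW.
    have := uv e d d0; apply: filterS2 IH => j IH H e'.
    rewrite inE => /predU1P[->|/IH//] t tI.
    by have := H t tI; rewrite {1}v0 /on_edge /= subr0.
  move=> /filter_ex[j jP]; have [_ _ _ [e [t [Fe tI]]]] := u_P j.
  by apply/negP; rewrite -leNgt; exact: jP.
have PK (eps : R) : 0 < eps -> \forall j \near U, Kmax - eps < P (u_ j).
  move=> eps0; apply: sU; have := near_infty_natSinv_lt (PosNum eps0).
  apply: filterS => j /= je; have [_ _ Pj _] := u_P j; apply: le_lt_trans Pj.
  by rewrite lerD2l lerN2 ltW.
by exists v; have [] := max_limit bdd cG e0 p2 lam0 K0 Hu Au Hv v0 uv PK.
Unshelve. all: by end_near. Qed.

End PeriodicExistence.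

(** * Nehari sets *)

Section Nehari.
Variables (R : realType) (p lam : R) (G : metricGraph R) (Z : set (vertex G)).
Hypothesis bdd : forall e : edge G, (len e < +oo)%E.
Hypothesis cG : class_G G.
Hypothesis e0 : inhabited (edge G).
Hypothesis p2 : 2 < p.
Hypothesis lam0 : 0 < lam.
Implicit Types (e : edge G) (u v w : gpoint G -> R).

Local Notation HZ := (@H1dy R lam G Z).
Local Notation A := (@h1form R lam G).
Local Notation P := (@lpow R p G).
Local Notation Kmax := (@Kmax R p lam G Z).
Let lam_ge0 : 0 <= lam := ltW lam0.
Let p0 : 0 < p := p_gt0 p2.

Lemma energy_parts u : HZ u -> exists D N : R,
  [/\ dirichlet u = D%:E, Lq_pow 2 u = N%:E, Lq_pow p u = (P u)%:E & A u = D + lam * N].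
Proof.
move=> Hu; have [cu _ _] := Hu; have [H1u _] := (H1_ZP Z bdd lam0 u).2 Hu.
exists (fine (En 1 0 u)), (l2pow u).
have D0 : (0 <= En 1 0 u)%E by exact: En_ge0.
have S := En_split bdd u ler01 lam_ge0.
have N2u := N2E bdd lam0 Hu; have Au := AE bdd lam0 Hu.
have Df : En 1 0 u \is a fin_num.
  rewrite ge0_fin_numE //; apply: (@le_lt_trans _ _ (En 1 lam u)); last by rewrite Au ltry.
  by rewrite S mul1e leeDl // mule_ge0 ?lee_fin // En_ge0.
split.
- by rewrite (H1_dirichlet bdd H1u) fineK.
- by rewrite (Lq_pow2 bdd cu).
- by rewrite (Lq_pow_Pw bdd (ltW p0) cu) (P_fin bdd cG e0 p2 lam0 Hu).
- by apply: EFin_inj; rewrite -Au S mul1e N2u -EFinM -{1}(fineK Df) EFinD.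
Qed.

Lemma nehariP u : nehari lam p Z u <-> [/\ HZ u, u <> cst 0 & A u = P u].
Proof.
split=> [[/(H1_ZP Z bdd lam0) Hu u0]|[Hu u0 AP]].
  have [D [N [-> -> -> AE]]] := energy_parts Hu.
  by rewrite -EFinM -EFinD -AE => -[].
have [D [N [dE NE PE AE]]] := energy_parts Hu.
split=> //; first by apply/(H1_ZP Z bdd lam0).
by rewrite dE NE PE -EFinM -EFinD -AE AP.
Qed.

Lemma actionE u : HZ u -> nls_action lam p u = (2^-1 * A u - p^-1 * P u)%:E.
Proof.
move=> Hu; have [D [N [dE NE PE AE]]] := energy_parts Hu.
rewrite /nls_action dE NE PE AE -!EFinM -EFinD; congr (_%:E).
by ring.
Qed.

Definition kappa : R := 2^-1 - p^-1.
(* The minimum of [A] on the Nehari set: there [A = P <= Kmax * A^(p/2)]. *)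
Definition h1form_min : R := Kmax^-1 `^ (2 / (p - 2)).

Lemma kappa_gt0 : 0 < kappa.
Proof. by rewrite subr_gt0 ltf_pV2 // posrE. Qed.

Let K0 : 0 < Kmax := Kmax_gt0 Z bdd cG e0 p2 lam0.
Let p20 : 0 < p - 2. Proof. by rewrite subr_gt0. Qed.

Lemma h1form_min_gt0 : 0 < h1form_min.
Proof. by rewrite powR_gt0 // invr_gt0. Qed.

Lemma h1form_min_pow : Kmax * h1form_min `^ (p / 2 - 1) = 1.
Proof.
rewrite /h1form_min -powRrM (_ : 2 / (p - 2) * (p / 2 - 1) = 1); last by field; rewrite gt_eqF.
by rewrite powRr1 ?invr_ge0 ?(ltW K0) // mulfV // gt_eqF.
Qed.

Lemma powR_theta (a : R) : 0 < a -> a `^ (p / 2) = a * a `^ (p / 2 - 1).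
Proof.
move=> a0; rewrite -{2}(powRr1 (ltW a0)) -powRD; first by congr (_ `^ _); ring.
by rewrite (gt_eqF a0) implybT.
Qed.

Lemma theta_gt0 : 0 < p / 2 - 1.
Proof. by rewrite subr_gt0 ltr_pdivlMr // mul1r. Qed.

Lemma nehari_lower u : nehari lam p Z u -> h1form_min <= A u.
Proof.
move=> /nehariP[Hu u0 AP]; have [_ _ Au] := HZ_nonzero bdd cG e0 p2 lam0 Hu u0.
have := P_le_Kmax_pow bdd cG e0 p2 lam0 Hu; rewrite -AP powR_theta // mulrCA.
rewrite -{1}[A u]mulr1 ler_pM2l // -[leLHS]h1form_min_pow ler_pM2l // => H.
rewrite leNgt; apply/negP => lt; move: H; rewrite leNgt => /negP; apply.
by apply: (gt0_ltr_powR theta_gt0); rewrite ?nnegrE ?(ltW Au) ?(ltW h1form_min_gt0).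
Qed.

(** The positive solution [c] of [c^2 A u = c^p P u]. *)
Definition nscale u : R := (A u / P u) `^ (p - 2)^-1.

Lemma nehari_nscale u : HZ u -> u <> cst 0 ->
  [/\ 0 < nscale u, nehari lam p Z (fun x => nscale u * u x) &
      A (fun x => nscale u * u x) = (A u / P u) `^ (2 / (p - 2)) * A u].
Proof.
move=> Hu u0; have [Pu _ Au] := HZ_nonzero bdd cG e0 p2 lam0 Hu u0.
have q0 : 0 < A u / P u by rewrite divr_gt0.
have c0 : 0 < nscale u by rewrite powR_gt0.
have As := A_scale bdd lam0 (nscale u) Hu; have Ps := P_scale bdd cG e0 p2 lam0 (nscale u) Hu.
have c2 : nscale u ^+ 2 = (A u / P u) `^ (2 / (p - 2)).
  by rewrite -powR_mulrn ?(ltW c0) // /nscale -powRrM; congr (_ `^ _); rewrite mulrC.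
split => //; last by rewrite As c2.
apply/nehariP; split; first exact: HZ_scale.
  by apply: (A_gt0_nonzero Z bdd lam0); rewrite As mulr_gt0 ?exprn_gt0.
have pE (x : R) : 0 < x -> x `^ p = x ^+ 2 * x `^ (p - 2).
  move=> x0; rewrite -(powR_mulrn 2 (ltW x0)) -powRD; first by congr (_ `^ _); ring.
  by rewrite (gt_eqF x0) implybT.
rewrite As Ps gtr0_norm // pE // -mulrA; congr (_ * _).
rewrite /nscale -powRrM mulVf ?gt_eqF // powRr1 ?(ltW q0) //.
by rewrite divfK // gt_eqF.
Qed.

Lemma action_nehari u : nehari lam p Z u -> nls_action lam p u = (kappa * A u)%:E.
Proof. by move=> /nehariP[Hu u0 AP]; rewrite actionE // -AP -mulrBl. Qed.

Lemma inf_nehari_ge : ((kappa * h1form_min)%:E <= inf_action lam p (nehari lam p Z))%E.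
Proof.
apply: le_ereal_inf_tmp => _ [u Nu <-]; rewrite action_nehari // lee_fin ler_pM2l ?kappa_gt0 //.
exact: nehari_lower.
Qed.

Lemma inf_nehari_attained u : HZ u -> A u = 1 -> P u = Kmax ->
  inf_action lam p (nehari lam p Z) = (kappa * h1form_min)%:E /\
  ground_state lam p Z (fun x => nscale u * u x).
Proof.
move=> Hu Au Pu; have u0 : u <> cst 0 by apply: (@A_gt0_nonzero R lam G Z) => //; rewrite Au.
have [c0 Nu] := nehari_nscale Hu u0; rewrite Au Pu mulr1 div1r -/h1form_min => AE.
have acE := action_nehari Nu; rewrite AE in acE.
have E : inf_action lam p (nehari lam p Z) = (kappa * h1form_min)%:E.
  apply/eqP; rewrite eq_le inf_nehari_ge andbT -acE.
  by apply: ereal_inf_lbound; exists (fun x => nscale u * u x).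
by split => //; split => //; rewrite acE E.
Qed.

(** [P] splits exactly between the two parts and [A] is superadditive, so the action of [v] is at
    least the sum of the actions of its parts, both of which lie on the Nehari set. *)
Lemma nodal_action_ge v : nodal_nehari lam p Z v -> exists a b : R,
  [/\ (nls_action lam p v >= (kappa * (a + b))%:E)%E, h1form_min <= a, h1form_min <= b & a = A (pos_part v)].
Proof.
move=> [/(H1_ZP Z bdd lam0) Hv Np Nn]; have [cv _ _] := Hv.
exists (A (pos_part v)), (A (neg_part v)); split => //; try exact: nehari_lower.
have [Hp _ APp] := (nehariP _).1 Np; have [Hn _ APn] := (nehariP _).1 Nn.
have AL : A (pos_part v) + A (neg_part v) <= A v.
  have := En_pos_neg bdd ler01 lam_ge0 cv.
  by rewrite (AE bdd lam0 Hp) (AE bdd lam0 Hn) (AE bdd lam0 Hv).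
have PE : P v = P (pos_part v) + P (neg_part v).
  have := Pw_pos_neg p0 cv.
  rewrite (P_fin bdd cG e0 p2 lam0 Hp) (P_fin bdd cG e0 p2 lam0 Hn) (P_fin bdd cG e0 p2 lam0 Hv).
  by move=> [].
rewrite actionE // lee_fin PE -APp -APn /kappa.
by rewrite mulrBl lerD2r ler_pM2l.
Qed.

Lemma inf_nodal_ge :
  ((2 * (kappa * h1form_min))%:E <= inf_action lam p (nodal_nehari lam p Z))%E.
Proof.
apply: le_ereal_inf_tmp => _ [v Nv <-].
have [a [b [H a0 b0 _]]] := nodal_action_ge Nv; apply: le_trans H.
by rewrite lee_fin mulrCA ler_pM2l ?kappa_gt0 // mulrDl mul1r lerD.
Qed.

(** If [A w < A v], then [P w <= Kmax * A w^(p/2) < Kmax * h1form_min^(p/2) = P v]. Minimality in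
    this form is tested by adding non-negative functions to [v], with no derivative of [P]. *)
Lemma minimal_energy_min v : nehari lam p Z v -> A v = h1form_min ->
  forall w, HZ w -> P v <= P w -> A v <= A w.
Proof.
move=> /nehariP[Hv v0 AP] AA w Hw PP; rewrite leNgt; apply/negP => lt.
have h1form_min' := h1form_min_gt0; have := P_le_Kmax_pow bdd cG e0 p2 lam0 Hw.
apply/negP; rewrite -ltNge; apply: lt_le_trans PP; rewrite -AP AA.
have -> : h1form_min = Kmax * h1form_min `^ (p / 2).
  by rewrite powR_theta // mulrCA h1form_min_pow mulr1.
rewrite ltr_pM2l //; apply: gt0_ltr_powR; rewrite ?nnegrE ?(ltW h1form_min') ?A_ge0 //.
- by rewrite divr_gt0.
- by rewrite -AA.
Qed.

End Nehari.

Lemma cut_powR_le (R : realType) (p t y : R) : 2 < p -> 0 < t < 1 -> 0 <= y ->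
  (1 - t) `^ p * y `^ p <= Num.max (y - t ^+ 2) 0 `^ p + (1 - t) `^ p * t `^ (p - 2) * y ^+ 2.
Proof.
move=> p2 /andP[t0 t1] y0; have p0 : 0 <= p by lra.
have t1' : 0 <= 1 - t by lra.
have [ty|yt] := leP t y.
  apply: (@le_trans _ _ (Num.max (y - t ^+ 2) 0 `^ p)).
    rewrite -powRM // ge0_ler_powR ?nnegrE ?mulr_ge0 // ?le_max ?lexx ?orbT //.
    by apply/orP; left; rewrite expr2; nra.
  by rewrite lerDl mulr_ge0 ?sqr_ge0 // mulr_ge0 ?powR_ge0.
apply: (@le_trans _ _ ((1 - t) `^ p * t `^ (p - 2) * y ^+ 2)); last by rewrite lerDr powR_ge0.
rewrite -mulrA ler_wpM2l ?powR_ge0 //.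
have [->|y00] := eqVneq y 0; first by rewrite powR0 ?expr0n ?mulr0 // gt_eqF //; lra.
have -> : y `^ p = y `^ (p - 2) * y ^+ 2.
  rewrite -(powR_mulrn 2 y0) -powRD; first by congr (_ `^ _); ring.
  by rewrite y00 implybT.
rewrite ler_wpM2r ?sqr_ge0 // ge0_ler_powR ?nnegrE ?(ltW t0) ?(ltW yt) //.
by rewrite subr_ge0 ltW.
Qed.

(** * Truncation to finitely many edges *)

Section Truncation.
Variables (R : realType) (p lam : R) (G : metricGraph R) (Z : set (vertex G)).
Hypothesis bdd : forall e : edge G, (len e < +oo)%E.
Hypothesis cG : class_G G.
Hypothesis e0 : inhabited (edge G).
Hypothesis p2 : 2 < p.
Hypothesis lam0 : 0 < lam.
Implicit Types (e : edge G) (u v w : gpoint G -> R).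

Local Notation HZ := (@H1dy R lam G Z).
Local Notation A := (@h1form R lam G).
Local Notation P := (@lpow R p G).
Local Notation N2 := (@l2pow R G).
Let lam_ge0 : 0 <= lam := ltW lam0.
Let p0 : 0 < p := p_gt0 p2.

(** For [u >= 0] this is a contraction of [u], so [A] does not increase and no estimate on the
    gradient of a cut-off function arises. *)
Definition cut (d : R) u : gpoint G -> R := fun x => Num.max (u x - d) 0.

Lemma HZ_cut d u : HZ u -> (forall x, 0 <= u x) -> 0 <= d -> HZ (cut d u) /\ A (cut d u) <= A u.
Proof.
move=> Hu u0 d0; have [cu _ _] := Hu; apply: HZ_contract => //.
- apply: continuous_graph => e.
  have ce : continuous (fun t => on_edge u e t - d).
    by move=> t; apply: cvgB; [exact: (continuous_on_edge cu)|exact: cvg_cst].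
  exact: (continuous_posp ce).
- by move=> x y; apply: le_trans (max0_contract _ _) _; rewrite opprB addrA subrK.
- move=> x; rewrite /cut (ger0_norm (u0 x)) ger0_norm ?le_max ?lexx ?orbT //.
  by rewrite ge_max u0 andbT lerBlDr lerDl.
Qed.

(* [u - t^2 >= (1 - t) u] where [u >= t], and [u^p <= t^(p-2) u^2] elsewhere. *)
Lemma P_cut t u : HZ u -> (forall x, 0 <= u x) -> 0 < t < 1 ->
  (1 - t) `^ p * (P u - t `^ (p - 2) * N2 u) <= P (cut (t ^+ 2) u).
Proof.
move=> Hu u0 tI; have [Hc _] := HZ_cut Hu u0 (sqr_ge0 t).
have [cu _ _] := Hu; have [cc _ _] := Hc.
set a := (1 - t) `^ p; set b := t `^ (p - 2).
have a0 : 0 <= a by exact: powR_ge0.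
have b0 : 0 <= b by exact: powR_ge0.
have pw0 u' e : (0 <= (ig 0 (elen e) (fun t => `|on_edge u' e t| `^ p))%:E)%E.
  by rewrite lee_fin ig_ge0 // => x _; exact: powR_ge0.
have en0 e : (0 <= ee 0 1 (elen e) (on_edge u e))%E by apply: ee_ge0 => //; exact: elen_gt0.
have key : (a%:E * Pw p u <= Pw p (cut (t ^+ 2) u) + (a * b)%:E * En 0 1 u)%E.
  rewrite !PwE EnE -(esumZ a0 (pw0 u)) -(esumZ (mulr_ge0 a0 b0) en0).
  rewrite -(esumD (fun e _ => pw0 _ e)); last by move=> e _; rewrite mule_ge0 ?lee_fin ?mulr_ge0.
  apply: le_esum => e _; rewrite /ee mul0e add0e mul1r -!EFinM -EFinD lee_fin.
  have ce := continuous_on_edge (e := e) cu; have cce := continuous_on_edge (e := e) cc.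
  have [_ ui] := L2_continuous 0 (elen e) ce.
  have pui := intg_pow (elen e) (ltW p0) ce; have pci := intg_pow (elen e) (ltW p0) cce.
  rewrite -(igZ _ pui) -(igZ _ ui) -(igD pci (intgZ _ ui)).
  apply: le_ig; [exact: intgZ|by apply: intgD => //; exact: intgZ|move=> s _].
  have := cut_powR_le p2 tI (u0 (edge_point e s)).
  by rewrite /on_edge (ger0_norm (u0 _)) (ger0_norm (_ : 0 <= cut _ _ _)) // le_max lexx orbT.
rewrite (P_fin bdd cG e0 p2 lam0 Hu) (P_fin bdd cG e0 p2 lam0 Hc) (N2E bdd lam0 Hu) in key.
move: key; move: (P u) (P _) (N2 u) => x1 x2 x3.
by rewrite -!EFinM -EFinD lee_fin mulrBr lerBlDr mulrA.
Qed.

Lemma P_cut_lim u c : HZ u -> (forall x, 0 <= u x) -> c < P u ->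
  exists2 t, 0 < t & c < P (cut t u).
Proof.
move=> Hu u0 cP.
pose g t := `|1 - t| `^ p * (P u - `|t| `^ (p - 2) * N2 u).
have g0 : g 0 = P u.
  rewrite /g subr0 normr1 powR1 mul1r normr0 powR0 ?mul0r ?subr0 // gt_eqF // subr_gt0 //.
have cg : g t @[t --> (0 : R)] --> g 0.
  apply: cvgM.
    have c1 : continuous (fun t : R => 1 - t).
      by move=> t; apply: cvgB; [exact: cvg_cst|exact: cvg_id].
    exact: (continuous_pow p0 c1).
  apply: cvgB; first exact: cvg_cst.
  apply: cvgM; last exact: cvg_cst.
  by apply: continuous_norm_powR; rewrite subr_gt0.
have : \forall t \near (0 : R)^'+, c < g t.
  by apply: (cvgr_gt (g 0)); [exact: cvg_at_right_filter|rewrite g0].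
move=> H; have /filter_ex[t [[ct t0] t1]] : \forall t \near (0 : R)^'+, (c < g t /\ 0 < t) /\ t < 1.
  apply: filterI; first by apply: filterI => //; exact: nbhs_right_gt.
  exact: nbhs_right_lt.
exists (t ^+ 2); first by rewrite exprn_gt0.
have t1' : 0 < 1 - t by rewrite subr_gt0.
have tI : 0 < t < 1 by rewrite t0.
have := P_cut Hu u0 tI; rewrite -{1}(gtr0_norm t1') -{2}(gtr0_norm t0); exact: lt_le_trans.
Qed.

(** An edge on which [u] reaches [d] carries energy at least [d^2 / csup], and the total energy is
    finite. *)
Lemma cut_finite u d : HZ u -> (forall x, 0 <= u x) -> 0 < d ->
  finite_set [set e | exists2 t, 0 <= t <= elen e & on_edge (cut d u) e t != 0].
Proof.
move=> Hu u0 d0; have [c0 H] := csupP bdd cG lam0; have [cu uy _] := Hu.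
apply: (@sub_finite_set _ _ [set e | ((d ^+ 2 / csup lam G)%:E <= ee 1 lam (elen e) (on_edge u e))%E]).
  move=> e [t tI nz] /=; have := H u e t cu tI.
  have dt : d <= on_edge u e t.
    rewrite leNgt; apply/negP => lt; move: nz; rewrite /on_edge /cut max_r ?eqxx //.
    by rewrite subr_le0 ltW.
  have h2 : d ^+ 2 <= on_edge u e t ^+ 2 by rewrite ler_pXn2r ?nnegrE ?(ltW d0) // u0.
  have : (0 <= ee 1 lam (elen e) (on_edge u e))%E by apply: ee_ge0 => //; exact: elen_gt0.
  case: (ee _ _ _ _) => [r _|_ _|//]; last by rewrite leey.
  rewrite -EFinM !lee_fin ler_pdivrMr // mulrC; exact: le_trans.
apply: esum_lt_finite; first by move=> e; apply: ee_ge0 => //; exact: elen_gt0.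
  by rewrite divr_gt0 // exprn_gt0.
by rewrite -EnE.
Qed.

Lemma ee_zero (al be l : R) (f : R -> R) : 0 < l -> 0 <= al -> 0 <= be ->
  (forall t, 0 <= t <= l -> f t = 0) -> ee al be l f = 0%E.
Proof.
move=> l0 al0 be0 f0; rewrite (@eq_ee _ _ _ _ _ (fun t => 0 * 0)) //; last first.
  by move=> t tI; rewrite f0 // mulr0.
rewrite (@ee_scale _ _ _ al0 be0 _ 0 (cst 0)) ?expr0n ?mul0e //.
by move=> x; exact: cvg_cst.
Qed.

Section DisjointSupports.
Variables (v1 v2 : gpoint G -> R).
Hypothesis H1 : HZ v1.
Hypothesis H2 : HZ v2.
Hypothesis ge1 : forall x, 0 <= v1 x.
Hypothesis ge2 : forall x, 0 <= v2 x.
Variable F : set (edge G).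
Hypothesis F1 : forall e t, ~ F e -> 0 <= t <= elen e -> on_edge v1 e t = 0.
Hypothesis F2 : forall e t, F e -> 0 <= t <= elen e -> on_edge v2 e t = 0.

Lemma disjoint_parts :
  pos_part (fun x => v1 x - v2 x) = v1 /\ neg_part (fun x => v1 x - v2 x) = (fun x => -1 * v2 x).
Proof.
have D x : v1 x = 0 \/ v2 x = 0.
  have [e [t [tI ->]]] := gcover bdd cG e0 x.
  by have [Fe|nFe] := pselect (F e); [right; exact: F2|left; exact: F1].
split; apply/funext => x; rewrite /pos_part /neg_part.
  by case: (D x) => ->; rewrite ?sub0r ?subr0; [rewrite max_r ?oppr_le0|rewrite max_l].
by rewrite mulN1r; case: (D x) => ->; rewrite ?sub0r ?subr0; [rewrite min_l ?oppr_le0|rewrite min_r ?oppr0].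
Qed.

Lemma A_disjoint : A (fun x => v1 x - v2 x) = A v1 + A v2.
Proof.
have [Hv _] := HZ_comb bdd lam0 ltr01 H1 H2.
apply: EFin_inj; rewrite EFinD -(AE bdd lam0 Hv) -(AE bdd lam0 H1) -(AE bdd lam0 H2) !EnE.
have L0 e : 0 < elen e by exact: elen_gt0.
have en0 u e : (0 <= ee 1 lam (elen e) (on_edge u e))%E by exact: ee_ge0.
rewrite -(esumD (fun e _ => en0 v1 e) (fun e _ => en0 v2 e)); apply: eq_esum => e _.
have [Fe|nFe] := pselect (F e).
  rewrite [X in (_ + X)%E]ee_zero ?adde0 // => [|t tI]; last exact: F2.
  by apply: eq_ee => // t tI; have := F2 Fe tI; rewrite /on_edge => ->; rewrite subr0.
rewrite [X in (X + _)%E]ee_zero ?add0e // => [|t tI]; last exact: F1.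
have [cv2 _ _] := H2; have ce := continuous_on_edge (e := e) cv2.
have := ee_scale ler01 lam_ge0 (-1) (L0 e) ce; rewrite sqrrN expr1n mul1e => <-.
apply: eq_ee => // t tI; have := F1 nFe tI; rewrite /on_edge => ->.
by rewrite sub0r mulN1r.
Qed.

End DisjointSupports.
End Truncation.

(** * Nodal functions made of two distant copies *)

Section NodalUpperBound.
Variables (R : realType) (p lam : R) (G : metricGraph R) (n : nat).
Variables (act : 'rV[int]_n -> gpoint G -> gpoint G) (Z : set (vertex G)).
Hypothesis n0 : (0 < n)%N.
Hypothesis per : periodic_graph act.
Hypothesis perZ : periodic_vertices act Z.
Hypothesis cG : class_G G.
Hypothesis p2 : 2 < p.
Hypothesis lam0 : 0 < lam.

Local Notation HZ := (@H1dy R lam G Z).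
Local Notation A := (@h1form R lam G).
Local Notation P := (@lpow R p G).
Local Notation Kmax := (@Kmax R p lam G Z).
Local Notation h1form_min := (@h1form_min R p lam G Z).
Let bdd := per_len per.
Let e0 := per_edge per.
Let p0 : 0 < p := p_gt0 p2.
Let lam_ge0 : 0 <= lam := ltW lam0.
Let nehP := nehariP Z bdd cG e0 p2 lam0.

(** A truncated maximizer [w] has [A w <= 1] and [P w > c], so its multiple on the Nehari set has
    [A] at most [c^-1] to the power [2 / (p - 2)]. The translate lives on other edges, so both
    energies of the difference are exactly twice those of one copy. *)
Lemma nodal_approx c : 0 < c -> c < Kmax -> exists2 v, nodal_nehari lam p Z v &
  (nls_action lam p v <= (2 * (kappa p * c^-1 `^ (2 / (p - 2))))%:E)%E.
Proof.
move=> c0 cK; have two : 0 < 2 :> R by [].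
have [u [Hu Au Pu u0]] : exists u, [/\ HZ u, A u <= 1, P u = Kmax & forall x, 0 <= u x].
  have [u' [Hu' Au' Pu']] := maximizer_exists per perZ cG p2 lam0.
  have [Hu Au] := HZ_abs bdd lam0 Hu'; rewrite Au' in Au.
  exists (fun x => `|u' x|).
  by split; [exact: Hu|exact: Au|rewrite P_abs; exact: Pu'|move=> x; exact: normr_ge0].
have cPu : c < P u by rewrite Pu.
have [t t0 ct] := P_cut_lim bdd cG e0 p2 lam0 Hu u0 cPu.
have [w [Hw Aw1 w0 finF cw]] : exists w, [/\ HZ w, A w <= 1, forall x, 0 <= w x,
    finite_set [set e | exists2 t, 0 <= t <= elen e & on_edge w e t != 0] & c < P w].
  have [Hw Aw] := HZ_cut bdd lam0 Hu u0 (ltW t0).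
  exists (cut t u); split; [exact: Hw|exact: le_trans Aw Au| |exact: (cut_finite bdd cG lam0 Hu u0 t0)|exact: ct].
  by move=> x; rewrite le_max lexx orbT.
have [k [S SF]] := shift_escape per n0 finF.
set F := [set e | _] in finF SF.
have Pw0 : 0 < P w by exact: lt_trans cw.
have wn0 : w <> cst 0.
  by move=> wE; move: Pw0; rewrite wE (P_cst0 Z bdd cG e0 p2 lam0) ltxx.
have [s [s0 Nv1 Av1]] : exists s, [/\ 0 < s, nehari lam p Z (fun x => s * w x) &
    A (fun x => s * w x) = (A w / P w) `^ (2 / (p - 2)) * A w].
  by exists (nscale p lam w); exact: (nehari_nscale bdd cG e0 p2 lam0 Hw wn0).
pose v1 x := s * w x.
have [H1 v1n0 AP1] := (nehP v1).1 Nv1.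
pose v2 := v1 \o shiftP S.
have [H2 A2] : HZ v2 /\ A v2 = A v1 := HZ_shift per perZ lam0 S H1.
have [c1 _ _] := H1.
have P2 : P v2 = P v1 := P_shift per S p0 c1.
have ge1 x : 0 <= v1 x by apply: mulr_ge0; [exact: (ltW s0)|exact: w0].
have ge2 x : 0 <= v2 x by exact: ge1.
have F1 e r : ~ F e -> 0 <= r <= elen e -> on_edge v1 e r = 0.
  move=> nF rI; case: (eqVneq (on_edge w e r) 0) => [w0r|nz]; last by case: nF; exists r.
  by rewrite -[LHS]/(s * on_edge w e r) w0r mulr0.
have F2 e r : F e -> 0 <= r <= elen e -> on_edge v2 e r = 0.
  move=> Fe rI; rewrite /v2 (on_edge_shift S); apply: F1; first exact: SF.
  by rewrite (shiftE_len S); exact: flip_itv.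
have [Ep En] := disjoint_parts bdd cG e0 ge1 ge2 F1 F2.
have [Hv _] := HZ_comb bdd lam0 ltr01 H1 H2.
have Hn2 : HZ (fun x => -1 * v2 x) by exact: HZ_scale.
have An2 : A (fun x => -1 * v2 x) = A v1 by rewrite (A_scale bdd lam0 _ H2) sqrrN expr1n mul1r.
have Pn2 : P (fun x => -1 * v2 x) = P v1.
  by rewrite (P_scale bdd cG e0 p2 lam0 _ H2) normrN1 powR1 mul1r.
have [_ _ A1pos] := HZ_nonzero bdd cG e0 p2 lam0 H1 v1n0.
have Nn2 : nehari lam p Z (fun x => -1 * v2 x).
  apply/nehP; split; [exact: Hn2| |by rewrite An2 Pn2; exact: AP1].
  by apply: (A_gt0_nonzero Z bdd lam0); rewrite An2; exact: A1pos.
exists (fun x => v1 x - v2 x).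
  split; [apply/(H1_ZP Z bdd lam0); exact: Hv|rewrite Ep; exact: Nv1|rewrite En; exact: Nn2].
have [cv _ _] := Hv.
have PE : P (fun x => v1 x - v2 x) = P v1 + P v1.
  have := Pw_pos_neg p0 cv; rewrite Ep En.
  rewrite (P_fin bdd cG e0 p2 lam0 Hv) (P_fin bdd cG e0 p2 lam0 H1) (P_fin bdd cG e0 p2 lam0 Hn2).
  by rewrite Pn2 => -[].
rewrite (actionE bdd cG e0 p2 lam0 Hv) lee_fin PE (A_disjoint bdd lam0 H1 H2 F1 F2) A2 -AP1.
have -> : 2^-1 * (A v1 + A v1) - p^-1 * (A v1 + A v1) = 2 * (kappa p * A v1).
  by rewrite /kappa; ring.
rewrite (ler_pM2l two) (ler_pM2l (kappa_gt0 p2)) -[A v1]/(A (fun x => s * w x)) Av1.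
have [_ _ Aw0] := HZ_nonzero bdd cG e0 p2 lam0 Hw wn0.
have q0 : 0 <= 2 / (p - 2) by apply: divr_ge0; [exact: ltW|rewrite subr_ge0; exact: ltW].
move: (A w) (P w) Aw0 Aw1 Pw0 cw => a b a0 a1 b0 cb; clear - c0 q0 a0 a1 b0 cb.
apply: (@le_trans _ _ ((a / b) `^ (2 / (p - 2)))); first by rewrite ler_piMr // powR_ge0.
apply: (ge0_ler_powR q0); rewrite ?nnegrE ?divr_ge0 ?invr_ge0 ?(ltW a0) ?(ltW b0) ?(ltW c0) //.
rewrite -[c^-1]mul1r ler_pM ?invr_ge0 ?(ltW a0) ?(ltW b0) //.
by rewrite lef_pV2 ?posrE // ltW.
Qed.

Lemma inf_nodal_le :
  (inf_action lam p (nodal_nehari lam p Z) <= (2 * (kappa p * h1form_min))%:E)%E.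
Proof.
have K0 : 0 < Kmax := Kmax_gt0 Z bdd cG e0 p2 lam0.
have q0 : 0 < 2 / (p - 2) by rewrite divr_gt0 // subr_gt0.
have le c : 0 < c -> c < Kmax -> (inf_action lam p (nodal_nehari lam p Z) <=
    (2 * (kappa p * c^-1 `^ (2 / (p - 2))))%:E)%E.
  move=> c0 cK; have [v Nv vc] := nodal_approx c0 cK; apply: le_trans vc.
  by apply: ereal_inf_lbound; exists v.
apply/lee_addgt0Pr => d d0.
(* The absolute value brings in a power that is continuous on the whole line; it disappears for
   [c > 0]. *)
have cv : 2 * (kappa p * `|c^-1| `^ (2 / (p - 2))) @[c --> Kmax] --> 2 * (kappa p * h1form_min).
  apply: cvgM; first exact: cvg_cst.
  apply: cvgM; first exact: cvg_cst.
  rewrite /h1form_min -(gtr0_norm (_ : 0 < Kmax^-1)) ?invr_gt0 //.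
  apply: (@continuous_comp _ _ _ (fun c : R => c^-1) (fun y => `|y| `^ (2 / (p - 2)))).
    by apply: cvgV; [rewrite gt_eqF|exact: cvg_id].
  exact: continuous_norm_powR.
have /filter_ex[c [[c1 c2] c3]] : \forall c \near Kmax^'-,
    (2 * (kappa p * `|c^-1| `^ (2 / (p - 2))) < 2 * (kappa p * h1form_min) + d /\ 0 < c) /\ c < Kmax.
  apply: filterI; last exact: nbhs_left_lt.
  apply: filterI; last exact: nbhs_left_gt.
  apply: (cvgr_lt (2 * (kappa p * h1form_min)) (cvg_at_left_filter cv)).
  by rewrite ltrDl.
apply: le_trans (le _ c2 c3) _; rewrite -EFinD lee_fin ltW //.
by move: c1; rewrite gtr0_norm // invr_gt0.
Qed.

End NodalUpperBound.

(** * Strong maximum principle *)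

(** A positive supremum [S], finite by the bound [M], would satisfy [S <= S / 2]. This plays the
    role of a Gronwall argument. *)
Lemma halving_le0 (R : realType) (T : Type) (I : set T) (f : T -> R) (M : R) :
  (forall x, I x -> f x <= M) ->
  (forall m, 0 <= m -> (forall x, I x -> f x <= m) -> forall x, I x -> f x <= m / 2) ->
  forall x, I x -> f x <= 0.
Proof.
move=> fM H x Ix; rewrite leNgt; apply/negP => fx.
pose S := sup (f @` I).
have hs : has_sup (f @` I).
  by split; [exists (f x), x|exists M => _ [y Iy <-]; exact: fM].
have fS y : I y -> f y <= S by move=> Iy; apply: (ub_le_sup hs.2); exists y.
have S0 : 0 < S by apply: lt_le_trans fx (fS _ Ix).
have : S <= S / 2.
  apply: ge_sup; first by exists (f x), x.
  by move=> _ [y Iy <-]; exact: (H _ (ltW S0) fS).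
by rewrite ler_pdivlMr // ger_pMr // leNgt ltr1n.
Qed.

(** * Test functions around a vertex *)

Section Star.
Variables (R : realType) (G : metricGraph R).
Variables (w : vertex G) (h : R).
Implicit Types (e : edge G) (t : R).

(** Together with the constant in [star_fun], this encodes the function that is 1 at [w] and
    decreases linearly to 0 over a length [h] along each end at [w]; a loop at [w] carries the sum
    of two ramps. *)
Definition star_slopes e : seq (R * R) :=
  (if src e == w then [:: (- h^-1, h)] else [::]) ++
  (if vhead e == w then [:: (h^-1, elen e); (- h^-1, elen e - h)] else [::]).

Definition star_fun e : R -> R := pwl (star_slopes e) (src e == w)%:R.

Definition src_ramp t : R := 1 - Num.min t h / h.
Definition head_ramp (l t : R) : R := (Num.min t l - Num.min t (l - h)) / h.

Lemma star_funE e t :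
  star_fun e t = (src e == w)%:R * src_ramp t + (vhead e == w)%:R * head_ramp (elen e) t.
Proof.
rewrite /star_fun /pwl /star_slopes big_cat /= /src_ramp /head_ramp.
by case: (src e == w); case: (vhead e == w); rewrite !(big_cons, big_nil) /=; ring.
Qed.

Hypothesis h0 : 0 < h.

Lemma src_ramp_itv t : 0 <= t -> 0 <= src_ramp t <= 1.
Proof.
move=> t0; rewrite /src_ramp subr_ge0 gerBl ler_pdivrMr // mul1r ge_min lexx orbT /=.
by rewrite divr_ge0 ?(ltW h0) // le_min t0 ltW.
Qed.

Lemma head_ramp_itv l t : 0 <= head_ramp l t <= 1.
Proof.
have := h0; rewrite /head_ramp ler_pdivrMr // mul1r => hp; apply/andP; split.
  by rewrite divr_ge0 ?(ltW h0) //; case: (leP t l); case: (leP t (l - h)); lra.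
by case: (leP t l); case: (leP t (l - h)); lra.
Qed.

Lemma src_ramp_off t : h <= t -> src_ramp t = 0.
Proof. by move=> ht; rewrite /src_ramp min_r // divff ?subrr // gt_eqF. Qed.

Lemma head_ramp_off l t : t <= l - h -> head_ramp l t = 0.
Proof. by move=> tl; have hp := h0; rewrite /head_ramp !min_l ?subrr ?mul0r //; lra. Qed.

Lemma star_bpt e q : h <= elen e -> q \in star_slopes e -> 0 <= q.2 <= elen e.
Proof.
move=> hL; rewrite /star_slopes mem_cat; case: ifP => _; case: ifP => _; rewrite !inE ?orbF; try by [].
- by case/or3P => /eqP -> /=; have := h0; lra.
- by move=> /eqP -> /=; have := h0; lra.
- by case/predU1P => [->|/eqP ->] /=; have := h0; lra.
Qed.

Lemma star_src e : h <= elen e -> star_fun e 0 = (src e == w)%:R.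
Proof.
move=> hL; rewrite star_funE head_ramp_off ?subr_ge0 // mulr0 addr0.
by rewrite /src_ramp min_l ?(ltW h0) // mul0r subr0 mulr1.
Qed.

Lemma star_head e : h <= elen e -> star_fun e (elen e) = (vhead e == w)%:R.
Proof.
move=> hL; rewrite star_funE src_ramp_off // mulr0 add0r /head_ramp minxx min_r.
  by rewrite opprB addrC subrK divff ?mulr1 // gt_eqF.
by rewrite gerBl ltW.
Qed.

Lemma star_slope_sum e (f : R -> R) : h <= elen e ->
  (src e == w -> f 0 = 0) -> (vhead e == w -> f (elen e) = 0) ->
  \sum_(q <- star_slopes e) q.1 * (f q.2 - f 0) =
  - h^-1 * ((src e == w)%:R * f h + (vhead e == w)%:R * f (elen e - h)).
Proof.
move=> hL fs fh; rewrite /star_slopes big_cat /=.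
case: (src e == w) fs => [/(_ isT) ->|_]; case: (vhead e == w) fh => [/(_ isT) E|_];
  rewrite !(big_cons, big_nil) /= ?E; ring.
Qed.

End Star.

Section StrongMaximum.
Variables (R : realType) (p lam : R) (G : metricGraph R) (Z : set (vertex G)).
Hypothesis bdd : forall e : edge G, (len e < +oo)%E.
Hypothesis cG : class_G G.
Hypothesis e0 : inhabited (edge G).
Hypothesis p2 : 2 < p.
Hypothesis lam0 : 0 < lam.
Implicit Types (e : edge G) (u w : gpoint G -> R).

Local Notation HZ := (@H1dy R lam G Z).
Local Notation A := (@h1form R lam G).
Local Notation P := (@lpow R p G).

Variable v : gpoint G -> R.
Hypothesis Hv : HZ v.
Hypothesis v_ge0 : forall x, 0 <= v x.
Hypothesis vmin : forall w, HZ w -> P v <= P w -> A v <= A w.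

(** Adding a non-negative function to [v >= 0] cannot decrease [P], so [vmin] applies. *)
Lemma min_perturb w : HZ w -> (forall x, 0 <= w x) ->
  forall s, 0 < s -> A v <= A (fun x => v x + s * w x).
Proof.
move=> Hw w0 s s0; have [_ Hs] := HZ_comb bdd lam0 s0 Hv Hw.
apply: (vmin Hs); apply: (P_le bdd cG e0 p2 lam0 Hv Hs) => x.
have sw : 0 <= s * w x by apply: mulr_ge0 => //; exact: ltW.
by rewrite (ger0_norm (v_ge0 x)) ger0_norm ?addr_ge0 // lerDl.
Qed.

Lemma v_bounded : exists M, forall x, v x <= M.
Proof.
exists (Num.sqrt (csup lam G * A v)) => x.
rewrite -(ger0_norm (v_ge0 x)); apply: sqr_le_norm; first exact: sqrtr_ge0.
have [c0 _] := csupP bdd cG lam0.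
have c1 : 0 <= csup lam G * A v by rewrite mulr_ge0 ?A_ge0 // ltW.
by rewrite sqr_sqrtr //; exact: (sup_bound bdd cG e0 lam0 x Hv).
Qed.

(* If [v <= B] on [[m - h, m + h]] and [v m = 0], testing with tents at [m] gives [v <= B / 2]. *)
Lemma edge_zero_step e m h : 0 < h -> 0 <= m - h -> m + h <= elen e ->
  lam * h * elen e <= 2^-1 -> on_edge v e m = 0 ->
  forall t, m - h <= t <= m + h -> on_edge v e t = 0.
Proof.
move=> h0 mh hm small vm t tI; have [M vM] := v_bounded.
have [cv _ _] := Hv; set f := on_edge v e in vm *.
have cf : continuous f := continuous_on_edge cv.
have f0 s : 0 <= f s by exact: v_ge0.
apply/eqP; rewrite eq_le f0 andbT.
apply: (@halving_le0 R R [set s | m - h <= s <= m + h] f M) => // [s _|]; first exact: vM.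
move=> B B0 fB s /= sI; have [->|sm] := eqVneq s m; first by rewrite vm divr_ge0.
(* The tent at [m] whose support ends at [s]: the first variation bounds [f (m - k) + f (m + k)],
   and [f s] is one of the two terms. *)
pose k := `|s - m|; have k0 : 0 < k by rewrite normr_gt0 subr_eq0.
have kh : k <= h by rewrite ler_norml; move: sI; lra.
have mk : 0 <= m - k by lra.
have km : m + k <= elen e by lra.
have Ht : HZ (edge_tent e m k) := HZ_edge_tent Z bdd lam0 k0 mk km.
pose qs e' := if e' == e then tent m k else [::].
have T0 x : 0 <= edge_tent e m k x.
  have [e' [r [rI ->]]] := gcover bdd cG e0 x.
  rewrite -[edge_tent _ _ _ _]/(on_edge (edge_tent e m k) e' r).
  rewrite (on_edge_pwtest bdd (edge_tent_src e k0 mk) (edge_tent_head k0 km)) //.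
  case: ifP => _; first by have /andP[] := tent_itv m r k0.
  by rewrite /pwl big_nil addr0.
have := @first_variation R lam G Z bdd lam0 (fun=> 0) qs (fun=> 0) [:: e] isT
  (edge_tent_bpt k0 mk km) (edge_tent_src e k0 mk) (edge_tent_head k0 km)
  (@edge_tent_off R G e m k) (fun _ _ => erefl) v Hv (min_perturb Ht T0).
rewrite big_seq1 /qs eqxx -/f /tent !big_cons big_nil /= vm -/(tent m k).
set X := ig _ _ _ => V.
have XB : X <= elen e * B.
  have -> : elen e * B = ig 0 (elen e) (fun=> B).
    by rewrite ig_cst ?subr0 1?mulrC // ltW // elen_gt0.
  apply: le_ig; last 1 first.
  - move=> r _; have /andP[t0 t1] := tent_itv m r k0.
    have [rI|rI] := boolP (m - h <= r <= m + h).
      by apply: le_trans (ler_wpM2l (f0 r) t1) _; rewrite mulr1; exact: fB.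
    rewrite tent_off ?mulr0 //; move: rI; rewrite negb_and -!ltNge => /orP[?|?].
      by left; lra.
    by right; lra.
  - apply: intg_mul; apply: L2_continuous => //; exact: continuous_pwl.
  - exact: intg_cst.
have kB : k * (lam * X) <= B / 2.
  apply: (@le_trans _ _ (h * (lam * (elen e * B)))).
    apply: (@le_trans _ _ (k * (lam * (elen e * B)))).
      by rewrite ler_pM2l // ler_pM2l.
    apply: ler_wpM2r => //; apply: mulr_ge0; first exact: ltW.
    by apply: mulr_ge0 => //; apply: ltW; exact: elen_gt0.
  have -> : h * (lam * (elen e * B)) = B * (lam * h * elen e) by ring.
  by rewrite ler_wpM2l.
have S : f (m - k) + f (m + k) <= k * (lam * X).
  rewrite -subr_ge0; have := mulr_ge0 (ltW k0) V.
  suff -> : k * (- k^-1 * (f (m - k) - f 0) + (2 / k * (0 - f 0) +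
      (- k^-1 * (f (m + k) - f 0) + 0)) + lam * X) =
      k * (lam * X) - (f (m - k) + f (m + k)) by [].
  by field; rewrite gt_eqF.
have := f0 (m - k); have := f0 (m + k).
have [sm'|sm'] := leP m s.
  have -> : s = m + k by rewrite /k ger0_norm ?subr_ge0 // addrC subrK.
  by move: S kB; lra.
have -> : s = m - k by rewrite /k ltr0_norm ?subr_lt0 // opprK addrC subrK.
by move: S kB; lra.
Qed.

(** The zeros inside the edge form an open and closed subset of an interval; each end is then
    covered by the step from an inner zero at distance [r]. *)
Lemma edge_zero e m : 0 < m < elen e -> on_edge v e m = 0 ->
  forall t, 0 <= t <= elen e -> on_edge v e t = 0.
Proof.
move=> mI vm; have L0 := elen_gt0 bdd e; set L := elen e in mI L0 *.
have [cv _ _] := Hv; set f := on_edge v e in vm *.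
have cf : continuous f := continuous_on_edge cv.
pose h0 := (2 * (lam * L))^-1; have h00 : 0 < h0 by rewrite invr_gt0 !mulr_gt0.
have h0E : lam * h0 * L = 2^-1 by rewrite /h0; field; rewrite !gt_eqF.
have step r h : 0 < h -> h <= h0 -> 0 <= r - h -> r + h <= L -> f r = 0 ->
    forall t, r - h <= t <= r + h -> f t = 0.
  move=> hp hh rh hr fr; apply: edge_zero_step => //.
  rewrite -h0E ler_wpM2r ?(ltW L0) // ler_wpM2l // ltW //.
have inner : [set t | 0 < t < L /\ f t = 0] = `]0, L[%classic.
  have conn : connected (`]0, L[%classic : set R) by apply/connected_intervalP; exact: interval_is_interval.
  apply: conn; first by exists m.
  - exists [set t | 0 < t < L /\ f t = 0]; last first.
      by apply/seteqP; split => t /=; rewrite in_itv /=; [case|case].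
    rewrite openE => t [/andP[t0 tL] ft]; apply/nbhs_ballP.
    pose h := Num.min h0 (Num.min t (L - t)).
    have hp : 0 < h by rewrite !lt_min h00 t0 subr_gt0.
    have hh0 : h <= h0 by rewrite ge_min lexx.
    have ht : h <= t by rewrite !ge_min lexx !orbT.
    have hL : h <= L - t by rewrite !ge_min lexx !orbT.
    exists h => //= s; rewrite /ball /= ltr_distlC => /andP[s1 s2]; split; first by lra.
    by apply: (step t h) => //; lra.
  - exists (f @^-1` [set 0]); last first.
      by apply/seteqP; split => t /=; rewrite in_itv /=.
    by move/continuous_closedP: cf; apply; exact: closed_eq.
have {}inner t : 0 < t < L -> f t = 0.
  move=> tI; have : [set t | 0 < t < L /\ f t = 0] t by rewrite inner /= in_itv.
  by case.
pose r := Num.min h0 (L / 2).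
have L2 : 0 < L / 2 by rewrite divr_gt0.
have r0 : 0 < r by rewrite lt_min h00.
have rh : r <= h0 by rewrite ge_min lexx.
have rL : r <= L / 2 by rewrite ge_min lexx orbT.
move=> t /andP[]; rewrite le_eqVlt => /predU1P[<- _|t0].
  by apply: (step r r) => //; [lra|lra|apply: inner; lra|lra].
rewrite le_eqVlt => /predU1P[->|tL]; last by apply: inner; rewrite t0.
by apply: (step (L - r) r) => //; [lra|lra|apply: inner; lra|lra].
Qed.

(** Since [w] is not in [Z], a test function may be 1 at [w]. The first variation couples all the
    edges at [w], so the halving argument has to run on all ends at once. *)
Lemma star_zero (w : vertex G) : ~ Z w -> v (Vert w) = 0 ->
  forall e, src e = w \/ vhead e = w -> forall t, 0 <= t <= elen e -> on_edge v e t = 0.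
Proof.
move=> nZw vw; have [_ _ _ finw _] := cG.
have [F uF FP] : exists2 F : seq (edge G), uniq F & forall e, (e \in F) = (src e == w) || (vhead e == w).
  have fin : finite_set [set e | src e = w \/ vhead e = w].
    apply: (@sub_finite_set _ _ (fst @` ends w)); last by apply: finite_image; exact: finw.
    move=> e [E|E]; first by exists (e, false) => //; rewrite /ends /= E.
    by exists (e, true) => //; rewrite /ends /= (tgt_head bdd) E.
  have /finite_seqP[s sP] := fin; exists (undup s); first exact: undup_uniq.
  move=> e; rewrite mem_undup; apply/idP/orP => [es|H].
    have : [set` s] e by []. by rewrite -sP => -[->|->]; [left|right].
  have : [set e | src e = w \/ vhead e = w] e by case: H => /eqP; [left|right].
  by rewrite sP.
have [l0 l00 l0e] := elen_lb bdd cG.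
(* The factor 2 is for loops, on which two ramps are added. *)
pose C := \sum_(e <- F) (2 * elen e).
have C0 : 0 <= C by apply: sumr_ge0 => e _; rewrite mulr_ge0 // ltW // elen_gt0.
have C1 : 0 < C + 1 by apply: ltr_wpDl.
pose h0 := Num.min l0 (2 * (lam * (C + 1)))^-1.
have h00 : 0 < h0 by rewrite lt_min l00 invr_gt0 !mulr_gt0.
have h0l e : h0 <= elen e by rewrite (le_trans _ (l0e e)) // ge_min lexx.
have h0C : lam * h0 * C <= 2^-1.
  apply: (@le_trans _ _ (lam * (2 * (lam * (C + 1)))^-1 * (C + 1))).
    apply: ler_pM => //; [by rewrite mulr_ge0 ?ltW|by rewrite ler_pM2l // ge_min lexx orbT|by rewrite lerDl].
  by rewrite le_eqVlt; apply/orP; left; apply/eqP; field; rewrite !gt_eqF.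
have [cv _ _] := Hv; have [M vM] := v_bounded.
have fsrc e : src e == w -> on_edge v e 0 = 0 by move=> /eqP E; rewrite /on_edge ep_src // E.
have fhead e : vhead e == w -> on_edge v e (elen e) = 0.
  by move=> /eqP E; rewrite /on_edge (ep_head bdd) // E.
pose I := [set q : edge G * R | (src q.1 == w /\ 0 <= q.2 <= h0) \/
                                (vhead q.1 == w /\ elen q.1 - h0 <= q.2 <= elen q.1)].
have zero q : I q -> on_edge v q.1 q.2 <= 0.
  apply: (@halving_le0 R _ I (fun q => on_edge v q.1 q.2) M) => [q' _|B B0 IB]; first exact: vM.
  (* The test with ramps of length [h] bounds the sum, over all ends at [w], of the values at
     distance [h]; as these are non-negative, each edge obeys the same bound. *)
  have key h : 0 < h -> h <= h0 -> forall e,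
      (src e == w)%:R * on_edge v e h + (vhead e == w)%:R * on_edge v e (elen e - h) <= B / 2.
    move=> hp hh; have hL e : h <= elen e := le_trans hh (h0l e).
    pose qs := star_slopes w h; pose c e : R := (src e == w)%:R.
    pose fV x : R := (x == w)%:R.
    have psrc e : pwl (qs e) (c e) 0 = fV (src e) by exact: star_src.
    have phead e : pwl (qs e) (c e) (elen e) = fV (vhead e) by exact: star_head.
    have poff e t : e \notin F -> 0 <= t <= elen e -> pwl (qs e) (c e) t = 0.
      rewrite FP negb_or => /andP[/negbTE se /negbTE he] _.
      by rewrite -[LHS]/(star_fun w h e t) star_funE se he !mul0r addr0.
    have pZ x : Z x -> fV x = 0.
      by move=> Zx; rewrite /fV; case: eqVneq => // xw; case: nZw; rewrite -xw.
    have Ht : HZ (pwtest fV qs c) := HZ_pwtest bdd lam0 uF psrc phead poff pZ.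
    have T0 x : 0 <= pwtest fV qs c x.
      have [e [r [rI ->]]] := gcover bdd cG e0 x; have /andP[r0 _] := rI.
      rewrite -[pwtest _ _ _ _]/(on_edge (pwtest fV qs c) e r) (on_edge_pwtest bdd psrc phead) //.
      rewrite -[pwl _ _ _]/(star_fun w h e r) star_funE.
      have /andP[a0 _] := src_ramp_itv hp r0; have /andP[b0 _] := head_ramp_itv hp (elen e) r.
      by rewrite addr_ge0 // mulr_ge0.
    have bpt e q0 : q0 \in qs e -> 0 <= q0.2 <= elen e by exact: star_bpt.
    have := first_variation bdd lam0 uF bpt psrc phead poff pZ Hv (min_perturb Ht T0).
    pose S e := (src e == w)%:R * on_edge v e h + (vhead e == w)%:R * on_edge v e (elen e - h).
    have S0 e : 0 <= S e by rewrite addr_ge0 // mulr_ge0 //; exact: v_ge0.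
    set X := fun e => ig 0 (elen e) (fun t => on_edge v e t * pwl (qs e) (c e) t).
    rewrite (eq_bigr (fun e => - h^-1 * S e + lam * X e)); last first.
      by move=> e _; congr (_ + _); apply: star_slope_sum => //; [exact: fsrc|exact: fhead].
    have XB e : X e <= 2 * elen e * B.
      have le0 : 0 <= elen e by rewrite ltW // elen_gt0.
      have -> : 2 * elen e * B = ig 0 (elen e) (fun=> 2 * B).
        by rewrite ig_cst // subr0; ring.
      apply: le_ig; last 1 first.
      - move=> t /andP[t0 tL]; rewrite -[pwl _ _ _]/(star_fun w h e t) star_funE.
        have f0 : 0 <= on_edge v e t by exact: v_ge0.
        have /andP[a0 a1] := src_ramp_itv hp t0; have /andP[b0 b1] := head_ramp_itv hp (elen e) t.
        have bd (y : R) : 0 <= y -> y <= 1 -> on_edge v e t <= B -> on_edge v e t * y <= B.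
          by move=> y0 y1 fB; rewrite (le_trans _ fB) // ler_piMr.
        have t1 : on_edge v e t * ((src e == w)%:R * src_ramp h t) <= B.
          case: (boolP (src e == w)) => [se|_]; last by rewrite mul0r mulr0.
          rewrite mul1r; have [ht|th] := leP h t; first by rewrite src_ramp_off // mulr0.
          by apply: bd => //; apply: (IB (e, t)); left; rewrite /= se t0 (le_trans (ltW th)).
        have t2 : on_edge v e t * ((vhead e == w)%:R * head_ramp h (elen e) t) <= B.
          case: (boolP (vhead e == w)) => [se|_]; last by rewrite mul0r mulr0.
          rewrite mul1r; have [ht|th] := leP t (elen e - h); first by rewrite head_ramp_off // mulr0.
          apply: bd => //; apply: (IB (e, t)); right; rewrite /= se (ltW tL) andbT; split => //.
          by apply: le_trans (ltW th); rewrite lerD2l lerN2.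
        by rewrite mulrDr mulrDl mul1r lerD.
      - apply: intg_mul; apply: L2_continuous; first exact: continuous_on_edge.
        exact: continuous_pwl.
      - exact: intg_cst.
    have SX : \sum_(e <- F) X e <= C * B.
      by rewrite /C mulr_suml; apply: ler_sum => e _; exact: XB.
    rewrite big_split /= -!mulr_sumr => V.
    have SS : \sum_(e <- F) S e <= B / 2.
      apply: (@le_trans _ _ (h * (lam * \sum_(e <- F) X e))).
        have := mulr_ge0 (ltW hp) V; rewrite mulrDr mulNr mulrN mulVKf ?gt_eqF //.
        by rewrite addrC subr_ge0.
      apply: (@le_trans _ _ (h * (lam * (C * B)))).
        by rewrite ler_pM2l // ler_pM2l.
      apply: (@le_trans _ _ (h0 * (lam * (C * B)))).
        by rewrite ler_wpM2r // !mulr_ge0 // ltW.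
      have -> : h0 * (lam * (C * B)) = B * (lam * h0 * C) by ring.
      by rewrite ler_wpM2l.
    move=> e; rewrite -/(S e); apply: le_trans SS.
    have [eF|eF] := boolP (e \in F).
      by rewrite (bigD1_seq e) //= lerDl sumr_ge0.
    have -> : S e = 0.
      by move: eF; rewrite FP negb_or /S => /andP[/negbTE -> /negbTE ->]; rewrite !mul0r addr0.
    by rewrite sumr_ge0.
  move=> [e t] [[/= se /andP[t0 th]]|[/= he /andP[t1 t2]]].
    move: t0; rewrite le_eqVlt => /predU1P[<-|t0]; first by rewrite fsrc // divr_ge0.
    apply: le_trans (key t t0 th e); rewrite se mul1r lerDl mulr_ge0 //; exact: v_ge0.
  have [->|tL] := eqVneq t (elen e); first by rewrite fhead // divr_ge0.
  have ht : 0 < elen e - t by rewrite subr_gt0 lt_neqAle tL.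
  have := key _ ht _ e; rewrite he mul1r subKr => H.
  apply: le_trans (H _); last by lra.
  by rewrite lerDr mulr_ge0 //; exact: v_ge0.
have {}zero q : I q -> on_edge v q.1 q.2 = 0.
  by move=> Iq; apply/eqP; rewrite eq_le zero // v_ge0.
move=> e H; have L0 := elen_gt0 bdd e.
pose r := Num.min h0 (elen e / 2).
have r0 : 0 < r by rewrite lt_min h00 divr_gt0.
have rh : r <= h0 by rewrite ge_min lexx.
have rL : r <= elen e / 2 by rewrite ge_min lexx orbT.
case: H => /eqP E.
  apply: (edge_zero (m := r)); first by lra.
  by apply: (zero (e, r)); left; rewrite /= E rh ltW.
apply: (edge_zero (m := elen e - r)); first by lra.
by apply: (zero (e, elen e - r)); right; rewrite /= E; split => //; lra.
Qed.

End StrongMaximum.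

(** * Propagation of zeros through the whole graph *)

Section StrongMaximumPrinciple.
Variables (R : realType) (p lam : R) (G : metricGraph R) (Z : set (vertex G)).
Hypothesis bdd : forall e : edge G, (len e < +oo)%E.
Hypothesis cG : class_G G.
Hypothesis e0 : inhabited (edge G).
Hypothesis p2 : 2 < p.
Hypothesis lam0 : 0 < lam.
Hypothesis degZ : forall z, Z z -> degree z = 1%N.

Lemma degree1_incident (z : vertex G) (e e' : edge G) : Z z ->
  src e = z \/ vhead e = z -> src e' = z \/ vhead e' = z -> e = e'.
Proof.
move=> Zz; have [_ _ _ finz _] := cG; have := degZ Zz.
move=> /eqP; rewrite /degree => /cardfs1P[a aE].
have H x : src x = z \/ vhead x = z -> x = a.1.
  move=> Hx; have [b xb] : exists b, ends z (x, b).
    by case: Hx => <-; [exists false|exists true]; rewrite /ends //= (tgt_head bdd).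
  have : (x, b) \in fset_set (ends z) by rewrite in_fset_set ?inE; [exact: xb|exact: finz].
  by rewrite aE inE => /eqP <-.
by move=> /H -> /H ->.
Qed.

Variable v : gpoint G -> R.
Hypothesis Hv : H1dy lam Z v.
Hypothesis v_ge0 : forall x, 0 <= v x.
Hypothesis vmin : forall w, H1dy lam Z w -> lpow p v <= lpow p w -> h1form lam v <= h1form lam w.

(** The union [S] of the edges on which [v] vanishes is open and closed: one leaves an edge of [S]
    only through a vertex, from which zeros spread to all its edges if it is outside [Z], and which
    belongs to no other edge if it is in [Z]. *)
Lemma strong_maximum x0 : v x0 = 0 -> (forall z, Z z -> x0 <> Vert z) -> v = cst 0.
Proof.
move=> vx0 x0Z.
pose E0 := [set e : edge G | forall t, 0 <= t <= elen e -> on_edge v e t = 0].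
have inner e t : 0 < t < elen e -> on_edge v e t = 0 -> E0 e.
  by move=> tI vt; exact: (edge_zero bdd cG e0 p2 lam0 Hv v_ge0 vmin tI vt).
have star (w : vertex G) e : ~ Z w -> v (Vert w) = 0 -> src e = w \/ vhead e = w -> E0 e.
  by move=> nZ vw ew; exact: (star_zero bdd cG e0 p2 lam0 Hv v_ge0 vmin nZ vw ew).
(* A zero on [e] makes [v] vanish along [e], except possibly when it is a vertex of [Z]; that case
   is left to the second continuation. *)
have zero_edge e t (Q : Prop) : on_edge v e t = 0 ->
    (E0 e -> Q) -> (forall z, Z z -> edge_point e t = Vert z -> src e = z \/ vhead e = z -> Q) -> Q.
  move=> vt Q1 Q2; have [t0|t0] := leP t 0.
    have E := ep_src e t0; have [Zs|nZ] := pselect (Z (src e)).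
      by apply: (Q2 _ Zs E); left.
    by apply: Q1; apply: (star _ e nZ); [rewrite -E|left].
  have [tl|tl] := leP (elen e) t; last by apply: Q1; apply: (inner e t) => //; rewrite t0.
  have E := ep_head bdd tl; have [Zs|nZ] := pselect (Z (vhead e)).
    by apply: (Q2 _ Zs E); right.
  by apply: Q1; apply: (star _ e nZ); [rewrite -E|right].
pose S := [set x : gpoint G | exists e t, [/\ E0 e, 0 <= t <= elen e & x = edge_point e t]].
have S0 x : S x -> v x = 0 by case=> e [t [Ee tI ->]]; exact: Ee.
have SE e t : S (edge_point e t) -> E0 e.
  move=> St; have vt := S0 _ St; apply: (zero_edge e t) => // z Zz Ez inc.
  have [e' [s [Ee' _ Es]]] := St; rewrite Es in Ez.
  (* The vertex of [Z] is also on an edge [e'] of zeros, and it meets only one edge, so [e = e']. *)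
  by rewrite (degree1_incident Zz inc (ep_vert bdd Ez)).
have ES e t : E0 e -> S (edge_point e t).
  by move=> Ee; exists e, (clamp (elen e) t); split; [|exact/clamp_itv/elen_gt0|exact: ep_clamp].
have pre e : (edge_point e @^-1` S = setT :> set R) \/ (edge_point e @^-1` S = set0 :> set R).
  have [Ee|nE] := pselect (E0 e); [left|right].
    by apply/seteqP; split=> t // _; exact: ES.
  by apply/seteqP; split=> t //= /SE.
have oS : open S.
  by move=> e; case: (pre e) => ->; [exact: openT|exact: open0].
have oN : open (~` S).
  move=> e; have [E|E] := pre e.
    rewrite (_ : _ @^-1` _ = set0); first exact: open0.
    by apply/seteqP; split=> t //= nS; apply: nS; have : [set: R] t by []; rewrite -E.
  rewrite (_ : _ @^-1` _ = setT); first exact: openT.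
  by apply/seteqP; split=> t //= _ St; have : (set0 : set R) t by rewrite -E.
have cS : closed S by rewrite -openC.
have [cn _ _ _ _] := cG.
have ST : S = setT.
  apply: cn; last 2 first.
  - by exists S => //; rewrite setTI.
  - by exists S => //; rewrite setTI.
  have [e [t [_ xE]]] := gcover bdd cG e0 x0; exists x0; rewrite xE; apply: ES.
  apply: (zero_edge e t) => //; first by rewrite /on_edge -xE.
  by move=> z Zz; rewrite -xE => /(x0Z z Zz).
by apply/funext => x; apply: S0; rewrite ST.
Qed.

End StrongMaximumPrinciple.

Theorem theorem1p7 (R : realType) (p lambda : R) (G : metricGraph R)
    (n : nat) (act : 'rV[int]_n -> gpoint G -> gpoint G)
    (Z : set (vertex G)) :
  2 < p ->
  class_G G ->
  (0 < n)%N ->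
  periodic_graph act ->
  (forall v, Z v -> degree v = 1%N) ->
  periodic_vertices act Z ->
  0 < lambda ->
  (exists u : gpoint G -> R, ground_state lambda p Z u) /\
  inf_action lambda p (nodal_nehari lambda p Z) =
    (2%:E * inf_action lambda p (nehari lambda p Z))%E /\
  ~ (exists u : gpoint G -> R, nodal_ground_state lambda p Z u).
Proof.
move=> p2 cG n0 per degZ perZ lam0.
have bdd := per_len per; have e0 := per_edge per.
have [u [Hu Au Pu]] := maximizer_exists per perZ cG p2 lam0.
have [infN GS] := inf_nehari_attained bdd cG e0 p2 lam0 Hu Au Pu.
have infM : inf_action lambda p (nodal_nehari lambda p Z) = (2 * (kappa p * h1form_min p lambda Z))%:E.
  apply/eqP; rewrite eq_le (inf_nodal_le n0 per perZ cG p2 lam0).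
  exact: (inf_nodal_ge Z bdd cG e0 p2 lam0).
split; first by eexists; exact: GS.
split; first by rewrite infM infN EFinM.
move=> [w [Nw]]; rewrite infM => acw.
have [a [b [acge a0 b0 aE]]] := nodal_action_ge bdd cG e0 p2 lam0 Nw.
have k0 := kappa_gt0 p2.
(* Each part contributes at least half of the action of [w], which is twice the minimal one; so the
   positive part attains its lower bound. *)
have aA : a = h1form_min p lambda Z.
  apply/eqP; rewrite eq_le a0 andbT; move: acge; rewrite acw lee_fin mulrCA ler_pM2l //.
  by move: (h1form_min p lambda Z) a0 b0 => c; lra.
have [/(H1_ZP Z bdd lam0)[_ _ wZ] Np Nn] := Nw.
rewrite aA in aE; have vmin := minimal_energy_min bdd cG e0 p2 lam0 Np (esym aE).
have [Hp p0 _] := (nehariP Z bdd cG e0 p2 lam0 _).1 Np.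
have [_ n0' _] := (nehariP Z bdd cG e0 p2 lam0 _).1 Nn.
(* The positive part vanishes at such a point, which is not in [Z] because [w = 0] there; this
   starts the propagation of zeros. *)
have [x wx] : exists x, w x < 0.
  apply: contrapT => N; apply: n0'; apply/funext => x; rewrite /neg_part min_r //.
  by rewrite leNgt; apply/negP => wx; apply: N; exists x.
apply: p0; apply: (strong_maximum bdd cG e0 p2 lam0 degZ Hp _ vmin (x0 := x)).
- by move=> y; rewrite /pos_part le_max lexx orbT.
- by rewrite /pos_part max_r // ltW.
- by move=> z Zz xz; move: wx; rewrite xz wZ // ltxx.
Qed.
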